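(* Let $\alpha>0$. The random graph $G(n,n^{-\alpha})$ does not obey the FO zero-one $3$-law if and only if $\alpha\in\{1,\frac{7}{6},\frac{6}{5},\frac{5}{4},\frac{4}{3},\frac{3}{2},2\}$.
   Context: $G(n,p)$ denotes the Erdős–Rényi random graph on vertex set $V_n=\{1,\dots,n\}$ in which each pair of vertices is joined by an edge independently with probability $p$. First order (FO) formulae of graphs are built from the relations $\sim$ (adjacency) and $=$ between vertex variables, logical connectives, and quantifiers $\forall,\exists$ over vertices. The quantifier depth of a formula is the maximum number of nested quantifiers in it. $G(n,p)$ obeys the FO zero-one $k$-law if every FO sentence (formula without free variables) of quantifier depth $k$ is either true asymptotically almost surely (with probability tending to $1$ as $n\to\infty$) or false asymptotically almost surely for $G(n,p)$. *)

(* Defs.v *)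
From HB Require Import structures.
From mathcomp Require Import all_boot all_order all_algebra.
From mathcomp Require Import all_classical all_reals all_analysis.

Set Implicit Arguments.
Unset Strict Implicit.
Unset Printing Implicit Defensive.

Import Order.TTheory GRing.Theory Num.Theory.
Import numFieldNormedType.Exports.

Local Open Scope ring_scope.

(* [fo m] is the type of first order formulae of graphs whose free variables
   are among m given ones (well-scoped de Bruijn indices; variable [ord0] is
   the one bound by the innermost enclosing quantifier). *)
Inductive fo : nat -> Type :=
| FEq m : 'I_m -> 'I_m -> fo m
| FAdj m : 'I_m -> 'I_m -> fo m
| FNot m : fo m -> fo m
| FAnd m : fo m -> fo m -> fo m
| FOr m : fo m -> fo m -> fo m
| FImp m : fo m -> fo m -> fo m
| FIff m : fo m -> fo m -> fo m
| FAll m : fo m.+1 -> fo m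
| FEx m : fo m.+1 -> fo m.

Definition sentence := fo 0.

Fixpoint qdepth m (f : fo m) : nat :=
  match f with
  | FEq _ _ _ | FAdj _ _ _ => 0
  | FNot _ g => qdepth g
  | FAnd _ g h | FOr _ g h | FImp _ g h | FIff _ g h =>
      maxn (qdepth g) (qdepth h)
  | FAll _ g | FEx _ g => (qdepth g).+1
  end.

Definition extend (T : Type) m (x : T) (v : 'I_m -> T) : 'I_m.+1 -> T :=
  fun i => if unlift ord0 i is Some j then v j else x.

Fixpoint eval (V : finType) (adj : rel V) m (f : fo m) : ('I_m -> V) -> bool :=
  match f in fo m return ('I_m -> V) -> bool with
  | FEq _ i j => fun v => v i == v j
  | FAdj _ i j => fun v => adj (v i) (v j)
  | FNot _ g => fun v => ~~ eval adj g v
  | FAnd _ g h => fun v => eval adj g v && eval adj h v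
  | FOr _ g h => fun v => eval adj g v || eval adj h v
  | FImp _ g h => fun v => eval adj g v ==> eval adj h v
  | FIff _ g h => fun v => eval adj g v == eval adj h v
  | FAll _ g => fun v => [forall x, eval adj g (extend x v)]
  | FEx _ g => fun v => [exists x, eval adj g (extend x v)]
  end.

Definition no_vars (T : Type) : 'I_0 -> T :=
  fun i => False_rect T (notF (ltn_ord i)).

Definition holds (V : finType) (adj : rel V) (f : sentence) : bool :=
  eval adj f (@no_vars V).

Definition vpairs n : {set {set 'I_n}} := [set e : {set 'I_n} | #|e| == 2].

(* A simple graph on 'I_n is given by its edge set G \subset vpairs n. *)
Definition adj_of n (G : {set {set 'I_n}}) : rel 'I_n :=
  fun x y => [set x; y] \in G.

(* Probability that G(n, p) satisfies A; each pair in [vpairs n] is an edge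
   with probability p, independently of the others. *)
Definition Gnp_prob (R : realType) n (p : R) (A : rel 'I_n -> bool) : R :=
  \sum_(G in powerset (vpairs n) | A (adj_of G))
     \prod_(e in vpairs n) (if e \in G then p else 1 - p).

Local Open Scope classical_set_scope.

Definition aas (R : realType) (p : R^nat)
    (A : forall n, rel 'I_n -> bool) : Prop :=
  (fun n => Gnp_prob (p n) (@A n)) @ \oo --> (1 : R).

Definition zero_one_law (R : realType) (p : R^nat) (k : nat) : Prop :=
  forall f : sentence, qdepth f = k ->
    aas p (fun n E => holds E f) \/ aas p (fun n E => ~~ holds E f).

(* Main.v *)
(* By Ehrenfeucht games, two graphs agree on sentences of depth 3 as soon as every
   vertex of one has a counterpart in the other with the same depth 2 type, and
   this type is read off from the vertices y, their adjacency to x, and which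
   patterns of adjacency to (x, y) are realized by a third vertex.

   For alpha < 1 all patterns other than a common neighbour occur around every
   pair. If alpha < 1/2 common neighbours always exist. If 1/2 <= alpha < 1 every
   vertex has neighbours and non-neighbours without common neighbour, and the
   only question left is which vertices lie in triangles: all of them if
   alpha < 2/3, some but not all if alpha >= 2/3.

   For 1 < alpha < 2 the graph has no short cycles, and the depth 2 type of a vertex
   is one of twelve. Each type forces a smallest tree, with k <= 6 edges, and any
   component isomorphic to that tree realizes it; so the type occurs or not
   according to whether alpha < (k+1)/k or alpha > (k+1)/k. At alpha = (k+1)/k the
   number of such trees has bounded mean, and both outcomes keep a positive
   probability, by Paley-Zygmund and by Harris' inequality. The triangles play
   this role at alpha = 1, and for alpha > 2 there are no edges. *)

From HB Require Import structures.
From mathcomp Require Import all_boot all_order all_algebra.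
From mathcomp Require Import all_classical all_reals all_analysis.
From mathcomp Require Import zify ring lra.
From mathcomp Require Import fintype finset bigop.
Require Import Defs.

Set Implicit Arguments.
Unset Strict Implicit.
Unset Printing Implicit Defensive.

Import Order.TTheory GRing.Theory Num.Theory.
Import numFieldNormedType.Exports.

Local Open Scope classical_set_scope.
Local Open Scope set_scope.
Local Open Scope bool_scope.
Local Open Scope ring_scope.


(** * Product measures on subsets *)

(** The sparse thresholds come out sharp because each type is caught between two events of the same
    order. A component that is a copy of the tree realizes the type, and conversely the type forces
    the tree as a subgraph, not necessarily induced. A tree with k edges has about n^(k+1)
    placements, each present with probability n^(-alpha k), whence (k+1)/k. Asking that the copy be
    a component costs only a factor of at least (1 - p)^((k+1) n), bounded below because n p <= 1
    for alpha >= 1.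

    For 1/2 <= alpha < 1 the difficulty is that the relevant events concern the random set N(v), and
    must fail or hold for all v at once. Fixing N(v) turns them into events about the pairs away
    from v, independent of N(v), whose probabilities are o(1/n) for every N(v) of typical size; this
    survives the union bound over v.

    In both ranges the law follows from a single event of probability tending to 1 on which the
    theory of depth 3 is the same for graphs of all orders, so the limit value of a sentence can be
    read off from any one graph in the event. *)

Lemma set_add_ind (T : finType) (P : {set T} -> Prop) :
  P set0 -> (forall (e : T) (D : {set T}), e \notin D -> P D -> P (e |: D)) -> forall D, P D.
Proof.
move=> P0 PS D; have [k] := ubnP #|D|; elim: k D => // k IH D.
rewrite ltnS => Dk; have [->//|[e eD]] := set_0Vmem D.
rewrite -(setD1K eD); apply: PS; first by rewrite setD11.
by apply: IH; apply: leq_trans Dk; rewrite (cardsD1 e D) eD.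
Qed.

Section ProductMeasure.
Variables (R : realType) (T : finType) (p : R).
Implicit Types (D F G : {set T}) (f g : {set T} -> R).

Definition wt D G : R := \prod_(e in D) (if e \in G then p else 1 - p).

(* Expectation of [f] for the random subset of [D] that contains each element
   independently with probability [p]. *)
Definition Ex D f : R := \sum_(G in powerset D) f G * wt D G.

Definition Pr D (A : pred {set T}) : R := Ex D (fun G => (A G)%:R).

Definition depends_on D (X : Type) (f : {set T} -> X) :=
  forall G, f (G :&: D) = f G.

Lemma eq_Ex D f g : (forall G, G \subset D -> f G = g G) -> Ex D f = Ex D g.
Proof. by move=> fg; apply: eq_bigr => G; rewrite inE => /fg ->. Qed.

Lemma Ex0 f : Ex set0 f = f set0.
Proof. by rewrite /Ex powerset0 big_set1 /wt big_set0 mulr1. Qed.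

(** Conditioning on whether [e] is present. This recursion drives the inductions on [D] below,
    including the one for Harris' inequality. *)
Lemma Ex_setU1 e D f : e \notin D ->
  Ex (e |: D) f = p * Ex D (fun G => f (e |: G)) + (1 - p) * Ex D f.
Proof.
move=> eD; rewrite /Ex (bigID (fun G : {set T} => e \in G)) /=; congr (_ + _).
- rewrite (reindex_onto (fun G => e |: G) (fun G => G :\ e)) /=; last first.
    by move=> G /andP[_ eG]; rewrite setD1K.
  rewrite big_distrr /=; apply: eq_big => [G|G /andP[/andP[GD _] /eqP Ge]].
    rewrite !inE eqxx /= andbT; apply/andP/idP => [[GD /eqP Ge]|GD].
      apply/subsetP => x xG; move: (subsetP GD x); rewrite !inE xG orbT.
      move=> /(_ isT) /orP[/eqP xe|//].
      by move: xG; rewrite -Ge xe setD11.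
    split; first by rewrite setUS.
    by apply/eqP/setU1K; apply: contra eD => /(subsetP GD).
  have eG : e \notin G by rewrite -Ge setD11.
  rewrite /wt big_setU1 //= setU11 mulrCA; congr (_ * (_ * _)).
  apply: eq_bigr => x xD; rewrite !inE; case: eqP => [xe|//].
  by rewrite -xe xD in eD.
- rewrite big_distrr /=; apply: eq_big => [G|G /andP[GD eG]].
    rewrite !inE; apply/andP/idP => [[GD eG]|GD].
      apply/subsetP => x xG; move: (subsetP GD x xG); rewrite !inE.
      by move=> /orP[/eqP xe|//]; rewrite -xe xG in eG.
    by split; [rewrite (subset_trans GD) ?subsetUr | apply: contra eD => /(subsetP GD)].
  by rewrite /wt big_setU1 //= (negbTE eG) mulrCA.
Qed.

Lemma Ex_const D (c : R) : Ex D (fun=> c) = c.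
Proof.
elim/set_add_ind: D => [|e D eD IH]; first by rewrite Ex0.
by rewrite Ex_setU1 // IH -mulrDl addrC subrK mul1r.
Qed.

Lemma ExD D f g : Ex D (fun G => f G + g G) = Ex D f + Ex D g.
Proof. by rewrite -big_split; apply: eq_bigr => G _; rewrite mulrDl. Qed.

Lemma ExZ D c f : Ex D (fun G => c * f G) = c * Ex D f.
Proof. by rewrite /Ex big_distrr; apply: eq_bigr => G _; rewrite /= mulrA. Qed.

Lemma ExZr D c f : Ex D (fun G => f G * c) = Ex D f * c.
Proof. by rewrite mulrC -ExZ; apply: eq_Ex => G _; rewrite mulrC. Qed.

Lemma ExB D f g : Ex D (fun G => f G - g G) = Ex D f - Ex D g.
Proof.
rewrite (eq_Ex (g := fun G => f G + (- 1) * g G)) => [|G _]; last by rewrite mulN1r.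
by rewrite ExD ExZ mulN1r.
Qed.

Lemma Ex_sum D (I : finType) (Q : pred I) (F : I -> {set T} -> R) :
  Ex D (fun G => \sum_(i | Q i) F i G) = \sum_(i | Q i) Ex D (F i).
Proof.
by rewrite exchange_big /=; apply: eq_bigr => G _; rewrite mulr_suml.
Qed.

Lemma Ex_setU D1 D2 f : [disjoint D1 & D2] ->
  Ex (D1 :|: D2) f = Ex D1 (fun G1 => Ex D2 (fun G2 => f (G1 :|: G2))).
Proof.
elim/set_add_ind: D1 f => [|e D1 eD IH] f.
  by move=> _; rewrite Ex0 set0U; apply: eq_Ex => G _; rewrite set0U.
move=> dj; have eD2 : e \notin D2 by rewrite (disjointFr dj (setU11 e D1)).
have D12 : [disjoint D1 & D2] := disjointWl (subsetUr _ _) dj.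
rewrite -setUA Ex_setU1 ?inE ?negb_or ?eD // !IH // Ex_setU1 //.
congr (_ * _ + _); apply: eq_Ex => G1 _; apply: eq_Ex => G2 _.
by rewrite setUA.
Qed.

(** Fubini over [D :&: D1] and [D :\: D1]: [f] sees only the first trace, and [g] only the second
    because [D2] avoids [D1]. *)
Lemma Ex_indep D D1 D2 f g : [disjoint D1 & D2] ->
  depends_on D1 f -> depends_on D2 g ->
  Ex D (fun G => f G * g G) = Ex D f * Ex D g.
Proof.
move=> D12 fD gD.
have dsj : [disjoint D :&: D1 & D :\: D1].
  by rewrite -setI_eq0; apply/eqP/setP => x; rewrite !inE; case: (x \in D1); rewrite ?andbF.
rewrite -[D in LHS](setID D D1) -[D in X in X * _](setID D D1).
rewrite -[D in X in _ * X](setID D D1) !Ex_setU //.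
have fE G1 G2 : G1 \subset D :&: D1 -> G2 \subset D :\: D1 -> f (G1 :|: G2) = f G1.
  move=> s1 s2; rewrite -fD -(fD G1); congr f; apply/setP => x; rewrite !inE.
  case xD: (x \in D1); rewrite ?andbF ?andbT //.
  by case xG: (x \in G2); rewrite ?orbF //; move/(subsetP s2): xG; rewrite !inE xD.
have gE G1 G2 : G1 \subset D :&: D1 -> G2 \subset D :\: D1 -> g (G1 :|: G2) = g G2.
  move=> s1 s2; rewrite -gD -(gD G2); congr g; apply/setP => x; rewrite !inE.
  case xD: (x \in D2); rewrite ?andbF ?andbT //.
  case xG: (x \in G1); rewrite //=; move/(subsetP s1): xG; rewrite !inE => /andP[_ xD1].
  by move: (disjointFr D12 xD1); rewrite xD.
transitivity (Ex (D :&: D1) (fun G1 => f G1 * Ex (D :\: D1) g)).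
  apply: eq_Ex => G1 s1; rewrite -ExZ; apply: eq_Ex => G2 s2.
  by rewrite fE // gE.
rewrite ExZr; congr (_ * _).
  apply: eq_Ex => G1 s1; rewrite -(Ex_const (D :\: D1) (f G1)).
  by apply: eq_Ex => G2 s2; rewrite fE.
rewrite -[LHS](Ex_const (D :&: D1)); apply: eq_Ex => G1 s1.
by apply: eq_Ex => G2 s2; rewrite gE.
Qed.

Lemma Pr_indep D D1 D2 (A B : pred {set T}) : [disjoint D1 & D2] ->
  depends_on D1 A -> depends_on D2 B ->
  Pr D (predI A B) = Pr D A * Pr D B.
Proof.
move=> D12 AD BD; rewrite -(@Ex_indep _ D1 D2) //.
- by apply: eq_Ex => G _ /=; rewrite -natrM mulnb.
- by move=> G; rewrite AD.
- by move=> G; rewrite BD.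
Qed.

Lemma PrC D A : Pr D (predC A) = 1 - Pr D A.
Proof.
rewrite -[1](Ex_const D) -ExB; apply: eq_Ex => G _ /=.
by case: (A G); rewrite ?subrr ?subr0.
Qed.

Lemma eq_Pr D (A B : pred {set T}) :
  (forall G, G \subset D -> A G = B G) -> Pr D A = Pr D B.
Proof. by move=> AB; apply: eq_Ex => G /AB ->. Qed.

Lemma Pr_trace D D0 F : D0 \subset D -> F \subset D0 ->
  Pr D (fun G => G :&: D0 == F) = p ^+ #|F| * (1 - p) ^+ #|D0 :\: F|.
Proof.
move=> D0D FD0.
have {1}<- : D0 :|: (D :\: D0) = D.
  by apply/setP => x; rewrite !inE; case xD: (x \in D0) => //=; rewrite (subsetP D0D).
rewrite /Pr Ex_setU; last first.
  by rewrite -setI_eq0; apply/eqP/setP => x; rewrite !inE; case: (x \in D0); rewrite ?andbF.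
transitivity (Ex D0 (fun G => (G == F)%:R)).
  apply: eq_Ex => G1 s1; rewrite -[RHS](Ex_const (D :\: D0)); apply: eq_Ex => G2 s2.
  congr (_ == _)%:R; apply/setP => x; rewrite !inE.
  case xD: (x \in D0); rewrite ?andbF ?andbT; last first.
    by apply/esym/negbTE; apply: contraFN xD => /(subsetP s1).
  case xG: (x \in G2); rewrite ?orbF //; move/(subsetP s2): xG.
  by rewrite !inE xD.
rewrite /Ex (bigD1 F) ?inE //= eqxx mul1r big1 ?addr0; last first.
  by move=> G /andP[_ /negbTE ->]; rewrite mul0r.
rewrite /wt (bigID (mem F)) /= (eq_bigr (fun=> p)) => [|x /andP[_ ->]//].
rewrite [X in _ * X](eq_bigr (fun=> 1 - p)) => [|x /andP[_ /negbTE ->]//].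
rewrite (eq_bigl (fun i => i \in F)) => [|x]; last first.
  by rewrite andbC; case xF: (x \in F) => //=; rewrite (subsetP FD0).
rewrite [X in _ * X](eq_bigl (fun i => i \in D0 :\: F)) => [|x]; last by rewrite inE andbC.
by rewrite !prodr_const.
Qed.

Lemma Pr_sub D F : F \subset D -> Pr D (fun G => F \subset G) = p ^+ #|F|.
Proof.
move=> FD; rewrite -[RHS]mulr1 -[X in _ * X](expr0 (1 - p)) -(cards0 T) -(setDv F).
by rewrite -(@Pr_trace D) //; apply: eq_Pr => G _ /=; rewrite (sameP eqP setIidPr).
Qed.

(** The traces on disjoint blocks are independent. With [F y] empty the event says that every block
    contains an edge; with [F y] a pattern on the two pairs from [y] to a given pair, it says that
    no vertex shows the pattern. *)
Lemma Pr_avoid D (I : finType) (Y : {set I}) (E F : I -> {set T}) :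
  (forall y, y \in Y -> E y \subset D) ->
  (forall y, y \in Y -> F y \subset E y) ->
  {in Y &, forall y z, y != z -> [disjoint E y & E z]} ->
  Pr D (fun G => [forall y in Y, G :&: E y != F y]) =
  \prod_(y in Y) (1 - p ^+ #|F y| * (1 - p) ^+ #|E y :\: F y|).
Proof.
elim/set_add_ind: Y => [|y Y yY IH] ED FE dsj.
  rewrite big_set0 -[RHS](Ex_const D); apply: eq_Ex => G _.
  by case: forallP => // -[] x; rewrite inE.
rewrite big_setU1 //= -IH; first last.
- by move=> a b aY bY; apply: dsj; rewrite inE ?aY ?bY orbT.
- by move=> a aY; apply: FE; rewrite inE aY orbT.
- by move=> a aY; apply: ED; rewrite inE aY orbT.
rewrite -(@Pr_trace D) ?ED ?FE ?setU11 // -PrC.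
rewrite -(@Pr_indep _ (E y) (\bigcup_(z in Y) E z)).
- apply: eq_Pr => G _ /=; apply/forall_inP/andP => [H|[H1 /forall_inP H2] z].
    split; first by apply: H; rewrite setU11.
    by apply/forall_inP => z zY; apply: H; rewrite inE zY orbT.
  by rewrite !inE => /orP[/eqP ->//|/H2].
- apply/bigcup_disjointP => z zY; apply: dsj; rewrite ?inE ?eqxx ?zY ?orbT //.
  by apply: contraNneq yY => ->.
- by move=> G /=; rewrite -setIA setIid.
- move=> G; apply: eq_forallb_in => z zY; rewrite -setIA; congr (_ :&: _ != _).
  by apply/setIidPr/bigcup_sup.
Qed.

Section Nonneg.
Hypothesis p01 : 0 <= p <= 1.

Lemma wt_ge0 D G : 0 <= wt D G.
Proof.
by apply: prodr_ge0 => e _; case: ifP => _; move: p01 => /andP[? ?]; rewrite ?subr_ge0.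
Qed.

Lemma le_Ex D f g : (forall G, G \subset D -> f G <= g G) -> Ex D f <= Ex D g.
Proof.
move=> fg; apply: ler_sum => G; rewrite inE => /fg le.
by rewrite ler_wpM2r ?wt_ge0.
Qed.

Lemma Ex_ge0 D f : (forall G, G \subset D -> 0 <= f G) -> 0 <= Ex D f.
Proof. by move=> f0; rewrite -(Ex_const D 0); apply: le_Ex. Qed.

Lemma le_Pr D (A B : pred {set T}) :
  (forall G, G \subset D -> A G -> B G) -> Pr D A <= Pr D B.
Proof.
move=> AB; apply: le_Ex => G /AB; case: (A G) => [-> //|_]; exact: ler0n.
Qed.

Lemma Pr_ge0 D A : 0 <= Pr D A.
Proof. by apply: Ex_ge0 => G _; exact: ler0n. Qed.

Lemma Pr_le1 D A : Pr D A <= 1.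
Proof.
by rewrite -[leRHS](Ex_const D); apply: le_Ex => G _; case: (A G); rewrite ?ler01.
Qed.

Lemma Pr_or D A B : Pr D (predU A B) <= Pr D A + Pr D B.
Proof.
rewrite -ExD; apply: le_Ex => G _ /=.
by case: (A G); case: (B G); rewrite /= ?addr0 ?add0r ?lerDl ?ler01.
Qed.

Lemma Pr_exists D (I : finType) (Q : pred I) (A : I -> pred {set T}) :
  Pr D (fun G => [exists (i | Q i), A i G]) <= \sum_(i | Q i) Pr D (A i).
Proof.
rewrite -Ex_sum; apply: le_Ex => G _.
case: existsP => [[i /andP[Qi Ai]]|_]; last by apply: sumr_ge0 => i _; exact: ler0n.
by rewrite (bigD1 i) //= Ai lerDl sumr_ge0 // => j _; exact: ler0n.
Qed.

(** Stated for decreasing functions. Splitting off one element leaves an inequality on two points,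
    whose defect is [p * (1 - p) * ((a0 - a1) * (b0 - b1))], a product of nonnegative factors. *)
Lemma harris D f g :
  (forall G H : {set T}, G \subset H -> f H <= f G) ->
  (forall G H : {set T}, G \subset H -> g H <= g G) ->
  Ex D f * Ex D g <= Ex D (fun G => f G * g G).
Proof.
elim/set_add_ind: D f g => [|e D eD IH] f g fd gd; first by rewrite !Ex0.
rewrite !Ex_setU1 //.
have H0 := IH f g fd gd.
have H1 : Ex D (fun G => f (e |: G)) * Ex D (fun G => g (e |: G)) <=
          Ex D (fun G => f (e |: G) * g (e |: G)).
  by apply: IH => G H GH; [apply: fd | apply: gd]; rewrite setUS.
have df : Ex D (fun G => f (e |: G)) <= Ex D f.
  by apply: le_Ex => G _; apply: fd; rewrite subsetUr.
have dg : Ex D (fun G => g (e |: G)) <= Ex D g.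
  by apply: le_Ex => G _; apply: gd; rewrite subsetUr.
move: p01 => /andP[p0 p1]; have q0 : 0 <= 1 - p by rewrite subr_ge0.
move: H0 H1 df dg.
move: (Ex D (fun G => f (e |: G))) (Ex D (fun G => g (e |: G))) (Ex D f) (Ex D g).
move: (Ex D (fun G => f (e |: G) * g (e |: G))) (Ex D (fun G => f G * g G)).
move=> c1 c0 a1 b1 a0 b0 H0 H1 df dg.
apply: (@le_trans _ _ (p * (a1 * b1) + (1 - p) * (a0 * b0))); last first.
  by apply: lerD; apply: ler_wpM2l.
rewrite -subr_ge0.
suff -> : p * (a1 * b1) + (1 - p) * (a0 * b0) -
   (p * a1 + (1 - p) * a0) * (p * b1 + (1 - p) * b0) =
   p * (1 - p) * ((a0 - a1) * (b0 - b1)) by rewrite !mulr_ge0 ?subr_ge0.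
by ring.
Qed.

(** Not containing [F y] is a decreasing event, so these events are positively correlated however
    the sets [F y] overlap; the product for independent events is then a lower bound. *)
Lemma harris_none D (I : finType) (Y : {set I}) (F : I -> {set T}) :
  (forall y, F y \subset D) ->
  \prod_(y in Y) (1 - p ^+ #|F y|) <=
  Pr D (fun G => [forall y in Y, ~~ (F y \subset G)]).
Proof.
move=> FD; elim/set_add_ind: Y => [|y Y yY IH].
  rewrite big_set0 -[leLHS](Ex_const D); apply: le_Ex => G _.
  by case: forallP => // -[] x; rewrite inE.
have F1 : 1 - p ^+ #|F y| = Pr D (fun G => ~~ (F y \subset G)) by rewrite -(@Pr_sub D) // -PrC.
rewrite big_setU1 //= F1; apply: (le_trans (ler_wpM2l _ IH)); first exact: Pr_ge0.
apply: le_trans (_ : Ex D (fun G => (~~ (F y \subset G))%:R *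
   ([forall z in Y, ~~ (F z \subset G)])%:R) <= _).
  apply: harris => G H GH; rewrite ler_nat.
    by case: (boolP (F y \subset G)) => [/subset_trans -> //|_] /=; exact: leq_b1.
  case: (boolP [forall z in Y, ~~ (F z \subset H)]) => //= /forall_inP FH.
  rewrite lt0b; apply/forall_inP => z /FH; apply: contra => FG; exact: subset_trans GH.
apply: le_Ex => G _; rewrite -natrM ler_nat mulnb.
case: andP => [[a /forall_inP b]|//]; rewrite lt0b.
by apply/forall_inP => z; rewrite !inE => /orP[/eqP ->|/b].
Qed.

Lemma chebyshev_upper D (X : {set T} -> R) (m s : R) : 0 < s -> m = Ex D X ->
  Pr D (fun G => s <= `|X G - m|) <= (Ex D (fun G => X G ^+ 2) - m ^+ 2) / s ^+ 2.
Proof.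
move=> s0 mE; rewrite ler_pdivlMr ?exprn_gt0 // -ExZr.
have -> : Ex D (fun G => X G ^+ 2) - m ^+ 2 = Ex D (fun G => (X G - m) ^+ 2).
  rewrite [RHS](eq_Ex (g := fun G => X G ^+ 2 + ((- 2 * m) * X G + m ^+ 2))).
    by rewrite !ExD ExZ Ex_const -mE; ring.
  by move=> G _; ring.
apply: le_Ex => G _; case: (boolP (s <= _)) => [h|_]; rewrite ?mul1r ?mul0r ?sqr_ge0 //.
by rewrite -[leRHS]real_normK ?num_real // ler_sqr ?nnegrE ?normr_ge0 // ltW.
Qed.

(* Paley-Zygmund: Cauchy-Schwarz applied to [X] and the indicator of [t < X]. *)
Lemma paley_zygmund D (X : {set T} -> R) (t : R) : 0 <= t -> t < Ex D X ->
  (forall G, 0 <= X G) ->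
  (Ex D X - t) ^+ 2 <= Ex D (fun G => X G ^+ 2) * Pr D (fun G => t < X G).
Proof.
move=> t0 tX X0; set m := Ex D X; set S := Ex D (fun G => _ ^+ 2); set P := Pr D _.
pose Y G : R := (t < X G)%R%:R.
have YY G : Y G ^+ 2 = Y G by rewrite /Y; case: (_ < _); rewrite ?expr1n ?expr0n.
have H1 : m - t <= Ex D (fun G => X G * Y G).
  rewrite lerBlDr -[X in _ + X](Ex_const D) -ExD; apply: le_Ex => G _.
  by rewrite /Y; case: ltP => h; rewrite ?mulr1 ?mulr0 ?lerDl ?add0r.
have a0 : 0 < m - t by rewrite subr_gt0.
(* Cauchy-Schwarz through the quadratic in [l]: the value [l = b] excludes [S = 0], and then
   [l = S / b] gives [b ^+ 2 <= S * P]. *)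
have H2 (l : R) : 0 <= S - 2 * l * Ex D (fun G => X G * Y G) + l ^+ 2 * P.
  have <- : Ex D (fun G => (X G - l * Y G) ^+ 2) =
      S - 2 * l * Ex D (fun G => X G * Y G) + l ^+ 2 * P.
    rewrite (eq_Ex (g := fun G => X G ^+ 2 + ((- 2 * l) * (X G * Y G) + l ^+ 2 * Y G))).
      by rewrite !ExD !ExZ -/S /P /Pr; ring.
    by move=> G _; rewrite -[l ^+ 2 * _ in RHS](congr1 _ (YY G)); ring.
  by apply: Ex_ge0 => G _; exact: sqr_ge0.
set b := Ex D (fun G => X G * Y G) in H1 H2.
have b0 : 0 < b by apply: lt_le_trans H1.
have S0 : 0 < S.
  have : 0 <= S by apply: Ex_ge0 => G _; exact: sqr_ge0.
  rewrite le_eqVlt => /orP[/eqP S0|//].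
  have P1 : P <= 1 by exact: Pr_le1.
  have := H2 b; rewrite -S0; nra.
apply: (@le_trans _ _ (b ^+ 2)).
  by rewrite ler_sqr ?nnegrE // ltW.
have := H2 (S / b); rewrite -(@pmulr_rge0 _ (b ^+ 2 / S)); last by rewrite divr_gt0 ?exprn_gt0.
suff -> : b ^+ 2 / S * (S - 2 * (S / b) * b + (S / b) ^+ 2 * P) = S * P - b ^+ 2.
  by rewrite subr_ge0.
by field; rewrite !gt_eqF.
Qed.

(** The moment generating function of a binomial variable, for the Chernoff bounds on degrees. *)
Lemma Ex_expR_card D D0 (s : R) : D0 \subset D ->
  Ex D (fun G => expR (s * #|G :&: D0|%:R)) = (1 - p + p * expR s) ^+ #|D0|.
Proof.
move=> D0D.
have {1}<- : D0 :|: (D :\: D0) = D.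
  by apply/setP => x; rewrite !inE; case xD: (x \in D0) => //=; rewrite (subsetP D0D).
rewrite Ex_setU; last first.
  by rewrite -setI_eq0; apply/eqP/setP => x; rewrite !inE; case: (x \in D0); rewrite ?andbF.
transitivity (Ex D0 (fun G => expR (s * #|G|%:R))).
  apply: eq_Ex => G1 s1; rewrite -[RHS](Ex_const (D :\: D0)); apply: eq_Ex => G2 s2.
  congr (expR (s * #|pred_of_set _|%:R)); apply/setP => x; rewrite !inE.
  case xD: (x \in D0); rewrite ?andbF ?andbT; last first.
    by apply/esym/negbTE; apply: contraFN xD => /(subsetP s1).
  case xG: (x \in G2); rewrite ?orbF //; move/(subsetP s2): xG.
  by rewrite !inE xD.
elim/set_add_ind: {D0D} D0 => [|e E eE IH]; first by rewrite Ex0 !cards0 mulr0 expR0 expr0.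
rewrite Ex_setU1 // cardsU1 eE add1n exprS -IH [RHS]mulrDl addrC; congr (_ + _); rewrite -mulrA; congr (_ * _); rewrite -ExZ.
apply: eq_Ex => G GE; rewrite cardsU1 (_ : e \notin G) ?natrD ?mulrDr ?mulr1 ?expRD //.
by apply: contra eE => /(subsetP GE).
Qed.

End Nonneg.
End ProductMeasure.

(** * Ehrenfeucht games and zero-one laws *)

Definition pattern (V : finType) (adj : rel V) (x y : V) (a b : bool) :=
  [exists z, [&& z != x, z != y, adj z x == a & adj z y == b]].

Section Ehrenfeucht.
Variables (V W : finType) (adjV : rel V) (adjW : rel W).

Definition same_atoms m (v : 'I_m -> V) (w : 'I_m -> W) :=
  forall i j, (v i == v j) = (w i == w j) /\ adjV (v i) (v j) = adjW (w i) (w j).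

Fixpoint ef k m (v : 'I_m -> V) (w : 'I_m -> W) : Prop :=
  same_atoms v w /\
  if k is k'.+1 then
    (forall x, exists y, ef k' (extend x v) (extend y w)) /\
    (forall y, exists x, ef k' (extend x v) (extend y w))
  else True.

Lemma ef_eval m (f : fo m) k (v : 'I_m -> V) (w : 'I_m -> W) :
  (qdepth f <= k)%N -> ef k v w -> eval adjV f v = eval adjW f w.
Proof.
elim: f k v w => {m} [m i j|m i j|m g IH|m g IHg h IHh|m g IHg h IHh|m g IHg h IHh|
   m g IHg h IHh|m g IH|m g IH] k v w /=.
- by move=> _; case: k => [|k] [/(_ i j)[-> _]].
- by move=> _; case: k => [|k] [/(_ i j)[_ ->]].
- by move=> gk vw; rewrite (IH k v w).
- by rewrite geq_max => /andP[gk hk] vw; rewrite (IHg k v w) // (IHh k v w).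
- by rewrite geq_max => /andP[gk hk] vw; rewrite (IHg k v w) // (IHh k v w).
- by rewrite geq_max => /andP[gk hk] vw; rewrite (IHg k v w) // (IHh k v w).
- by rewrite geq_max => /andP[gk hk] vw; rewrite (IHg k v w) // (IHh k v w).
- case: k => // k gk [_ [vw wv]]; apply/forallP/forallP => H x.
    by have [y /IH <-] := wv x.
  by have [y /IH ->] := vw x.
- case: k => // k gk [_ [vw wv]]; apply/existsP/existsP => -[x Hx].
    by have [y /IH E] := vw x; exists y; rewrite -E.
  by have [y /IH E] := wv x; exists y; rewrite E.
Qed.

(** The digit in [sim1] and [sim2] is the number of moves left: [sim1] compares pairs before the
    last move, where only equality, adjacency and realized patterns count, and [sim2] compares
    single vertices before the last two. *)
Definition sim1 (x y : V) (x' y' : W) :=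
  [/\ (x == y) = (x' == y'), adjV x y = adjW x' y' &
      forall a b, pattern adjV x y a b = pattern adjW x' y' a b].

Definition sim2 (x : V) (x' : W) :=
  (forall y, exists y', sim1 x y x' y') /\ (forall y', exists y, sim1 x y x' y').

Hypotheses (symV : symmetric adjV) (irrV : irreflexive adjV).
Hypotheses (symW : symmetric adjW) (irrW : irreflexive adjW).

Lemma same_atoms_extend m (v : 'I_m -> V) (w : 'I_m -> W) x y :
  same_atoms v w ->
  (forall i, (x == v i) = (y == w i) /\ adjV x (v i) = adjW y (w i)) ->
  same_atoms (extend x v) (extend y w).
Proof.
move=> vw xy i j; rewrite /extend.
case: unliftP => [i' _|_]; case: unliftP => [j' _|_] //; last by rewrite !eqxx irrV irrW.
by have [e a] := xy i'; rewrite eq_sym e eq_sym symV a symW.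
Qed.

(** The last move is answered by [x'] or [y'] if it repeats an earlier vertex, and otherwise by a
    vertex realizing the same pattern. *)
Lemma sim2_ef : (forall x, exists x', sim2 x x') -> (forall x', exists x, sim2 x x') ->
  ef 3 (@no_vars V) (@no_vars W).
Proof.
have a0 : same_atoms (@no_vars V) (@no_vars W) by case.
have a1 x x' : same_atoms (extend x (@no_vars V)) (extend x' (@no_vars W)).
  by apply: same_atoms_extend => // -[].
have a2 x y x' y' : sim1 x y x' y' ->
    same_atoms (extend y (extend x (@no_vars V))) (extend y' (extend x' (@no_vars W))).
  move=> [e a _]; apply: same_atoms_extend => // i; rewrite /extend.
  by case: unliftP => [[]//|_]; rewrite eq_sym e eq_sym symV a symW.
have a3 x y z x' y' z' : sim1 x y x' y' -> (z == x) = (z' == x') -> (z == y) = (z' == y') ->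
    adjV z x = adjW z' x' -> adjV z y = adjW z' y' ->
    ef 0 (extend z (extend y (extend x (@no_vars V))))
         (extend z' (extend y' (extend x' (@no_vars W)))).
  move=> s zx zy azx azy; split=> //; apply: same_atoms_extend; first exact: a2.
  by move=> i; rewrite /extend; do 2?[case: unliftP => [{}i _|_] //]; case: i.
have e2 x y x' y' : sim1 x y x' y' ->
    ef 1 (extend y (extend x (@no_vars V))) (extend y' (extend x' (@no_vars W))).
  move=> s; split; first exact: a2.
  have [e a pt] := s; split=> z.
    have [zx|zx] := eqVneq z x.
      by exists x'; apply: a3 => //; rewrite zx ?eqxx ?irrV ?irrW.
    have [zy|zy] := eqVneq z y.
      by exists y'; apply: a3 => //; rewrite zy ?eqxx ?irrV ?irrW 1?eq_sym ?e 1?eq_sym // symV a symW.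
    have := pt (adjV z x) (adjV z y).
    rewrite (_ : pattern adjV _ _ _ _ = true); last by apply/existsP; exists z; rewrite zx zy !eqxx.
    move/esym/existsP => [z' /and4P[z'x z'y /eqP ax /eqP ay]].
    by exists z'; apply: a3 => //; rewrite ?(negbTE zx) ?(negbTE zy) ?(negbTE z'x) ?(negbTE z'y).
  have [zx|zx] := eqVneq z x'.
    by exists x; apply: a3 => //; rewrite zx ?eqxx ?irrV ?irrW.
  have [zy|zy] := eqVneq z y'.
    by exists y; apply: a3 => //; rewrite zy ?eqxx ?irrV ?irrW 1?eq_sym ?e 1?eq_sym // symV a symW.
  have := pt (adjW z x') (adjW z y').
  rewrite [RHS](_ : pattern adjW _ _ _ _ = true); last by apply/existsP; exists z; rewrite zx zy !eqxx.
  move/existsP => [z' /and4P[z'x z'y /eqP ax /eqP ay]].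
  by exists z'; apply: a3 => //; rewrite ?(negbTE zx) ?(negbTE zy) ?(negbTE z'x) ?(negbTE z'y).
move=> H1 H2; split=> //; split=> x; [have [x' [s1 s2]] := H1 x|have [x' [s1 s2]] := H2 x];
  exists x'; (split; first exact: a1); split=> y.
- by have [y' /e2] := s1 y; exists y'.
- by have [y' /e2] := s2 y; exists y'.
- by have [y' /e2] := s1 y; exists y'.
- by have [y' /e2] := s2 y; exists y'.
Qed.

End Ehrenfeucht.

Lemma sim1_sym (V W : finType) (adjV : rel V) (adjW : rel W) x y x' y' :
  sim1 adjV adjW x y x' y' -> sim1 adjW adjV x' y' x y.
Proof. by case=> e a pt; split=> // a' b; rewrite pt. Qed.

Lemma sim2_sym (V W : finType) (adjV : rel V) (adjW : rel W) x x' :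
  sim2 adjV adjW x x' -> sim2 adjW adjV x' x.
Proof.
by case=> s1 s2; split=> y; [have [z /sim1_sym] := s2 y|have [z /sim1_sym] := s1 y]; exists z.
Qed.

Lemma adj_of_sym n (G : {set {set 'I_n}}) : symmetric (adj_of G).
Proof. by move=> x y; rewrite /adj_of setUC. Qed.

Lemma adj_of_irr n (G : {set {set 'I_n}}) : G \subset vpairs n -> irreflexive (adj_of G).
Proof.
move=> GV x; apply/negbTE; apply/negP => /(subsetP GV).
by rewrite inE setUid cards1.
Qed.

Lemma sim2_holds n (G : {set {set 'I_n}}) n' (G' : {set {set 'I_n'}}) (f : sentence) :
  G \subset vpairs n -> G' \subset vpairs n' ->
  (forall x, exists x', sim2 (adj_of G) (adj_of G') x x') ->
  (forall x', exists x, sim2 (adj_of G) (adj_of G') x x') ->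
  (qdepth f <= 3)%N -> holds (adj_of G) f = holds (adj_of G') f.
Proof.
move=> GV GV' H1 H2 f3; apply: (ef_eval f3); apply: sim2_ef => //.
all: by [exact: adj_of_sym | exact: adj_of_irr].
Qed.

(** * Events that hold with probability tending to 1 *)

Section Whp.
Variables (R : realType) (p : R^nat).
Hypothesis p01 : forall n, 0 <= p n <= 1.

Definition PrG n (A : pred {set {set 'I_n}}) : R := Pr (p n) (vpairs n) A.

Lemma Gnp_probE n (A : rel 'I_n -> bool) :
  Gnp_prob (p n) A = PrG (fun G => A (adj_of G)).
Proof.
rewrite /Gnp_prob /PrG /Pr /Ex big_mkcondr /=; apply: eq_bigr => G _.
by case: (A _); rewrite ?mul1r ?mul0r.
Qed.

Definition negl (A : forall n, pred {set {set 'I_n}}) :=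
  (fun n => PrG (@A n)) @ \oo --> (0 : R).

Definition whp (A : forall n, pred {set {set 'I_n}}) := negl (fun n G => ~~ A n G).

Lemma negl_le (A : forall n, pred {set {set 'I_n}}) (u : R^nat) :
  (\forall n \near \oo, PrG (@A n) <= u n) -> u @ \oo --> (0 : R) -> negl A.
Proof.
move=> Au u0; apply: (squeeze_cvgr _ (cvg_cst 0) u0).
near=> n; apply/andP; split; first exact: Pr_ge0.
by near: n.
Unshelve. all: by end_near. Qed.

Lemma negl_mono (A B : forall n, pred {set {set 'I_n}}) :
  (\forall n \near \oo, forall G : {set {set 'I_n}}, G \subset vpairs n -> A n G -> B n G) ->
  negl B -> negl A.
Proof.
move=> AB; apply: negl_le; near=> n; apply: le_Pr => //.
by near: n.
Unshelve. all: by end_near. Qed.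

Lemma negl_or (A B : forall n, pred {set {set 'I_n}}) :
  negl A -> negl B -> negl (fun n G => A n G || B n G).
Proof.
move=> nA nB; apply: (@negl_le _ (fun n => PrG (@A n) + PrG (@B n))).
  by near=> n; exact: Pr_or.
by rewrite -[0](addr0 (0 : R)); exact: cvgD.
Unshelve. all: by end_near. Qed.

Lemma whp_mono (A B : forall n, pred {set {set 'I_n}}) :
  (\forall n \near \oo, forall G : {set {set 'I_n}}, G \subset vpairs n -> A n G -> B n G) ->
  whp A -> whp B.
Proof.
move=> AB; apply: negl_mono; near=> n => G GV; apply: contra; move: G GV.
by near: n.
Unshelve. all: by end_near. Qed.

Lemma whpN (A : forall n, pred {set {set 'I_n}}) : negl A -> whp (fun n G => ~~ A n G).
Proof.
by apply: negl_mono; near=> n => G _; rewrite negbK.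
Unshelve. all: by end_near. Qed.

Lemma whp_and (A B : forall n, pred {set {set 'I_n}}) :
  whp A -> whp B -> whp (fun n G => A n G && B n G).
Proof.
move=> wA wB; apply: (negl_mono _ (negl_or wA wB)).
by near=> n => G _; rewrite negb_and.
Unshelve. all: by end_near. Qed.

Lemma whp_true : whp (fun _ _ => true).
Proof.
rewrite /whp /negl (_ : (fun n => _) = fun=> 0) ?funeqE; first exact: cvg_cst.
by move=> n; rewrite /PrG /Pr Ex_const.
Qed.

Lemma whp_all (I : eqType) (s : seq I) (A : I -> forall n, pred {set {set 'I_n}}) :
  (forall i, i \in s -> whp (A i)) -> whp (fun n G => all (fun i => A i n G) s).
Proof.
elim: s => [|i s IH] H; first exact: whp_true.
apply: whp_and; first by apply: H; rewrite inE eqxx.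
by apply: IH => j js; apply: H; rewrite inE js orbT.
Qed.

Lemma whpP (A : forall n, rel 'I_n -> bool) :
  whp (fun n G => A n (adj_of G)) <-> aas p A.
Proof.
rewrite /whp /negl /aas.
have E n : PrG (fun G : {set {set 'I_n}} => ~~ A n (adj_of G)) = 1 - Gnp_prob (p n) (@A n).
  by rewrite Gnp_probE -PrC.
under eq_fun do rewrite E.
split=> [H|H].
  have H' : 1 - (1 - Gnp_prob (p n) (@A n)) @[n --> \oo] --> (1 - 0 : R).
    by apply: cvgB => //; exact: cvg_cst.
  by move: H'; rewrite subr0; under eq_fun do rewrite subKr.
have H' : 1 - Gnp_prob (p n) (@A n) @[n --> \oo] --> (1 - 1 : R).
  by apply: cvgB => //; exact: cvg_cst.
by move: H'; rewrite subrr.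
Qed.

(* [A] only has to determine the theory of depth 3, uniformly in [n]. *)
Lemma zero_one_of_whp (A : forall n, pred {set {set 'I_n}}) : whp A ->
  (forall n (G : {set {set 'I_n}}) n' (G' : {set {set 'I_n'}}),
     G \subset vpairs n -> G' \subset vpairs n' -> A n G -> A n' G' ->
     forall x, exists x', sim2 (adj_of G) (adj_of G') x x') ->
  zero_one_law p 3.
Proof.
move=> wA HA f f3.
(* Either some graph in [A], of whatever order, satisfies [f], and then all graphs in [A] do, or
   none does. [HA] gives one direction of the correspondence of vertices; exchanging the two graphs
   gives the other. *)
have [[n0 [G0 [G0V AG0 fG0]]]|Hn] :=
  pselect (exists n (G : {set {set 'I_n}}), [/\ G \subset vpairs n, A n G & holds (adj_of G) f]).
- left; apply/(whpP (fun n E => holds E f)); apply: whp_mono wA; near=> n => G GV AG.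
  suff -> : holds (adj_of G) f = holds (adj_of G0) f by [].
  apply: sim2_holds => //; rewrite ?f3 //; first exact: HA.
  by move=> x'; have [x /sim2_sym s] := HA _ _ _ _ G0V GV AG0 AG x'; exists x.
- right; apply/(whpP (fun n E => ~~ holds E f)); apply: whp_mono wA; near=> n => G GV AG.
  by apply/negP => fG; apply: Hn; exists n, G.
Unshelve. all: by end_near. Qed.

End Whp.

(** * Asymptotics *)

Section Asymptotics.
Variable R : realType.
Implicit Types (r c M : R).

Lemma near_powR_ge r M : 0 < r -> \forall n \near \oo, M <= n%:R `^ r.
Proof.
move=> r0; pose K := Num.max M 1; have K0 : 0 <= K by rewrite le_max ler01 orbT.
near=> n; apply: (@le_trans _ _ K); first by rewrite le_max lexx.
have -> : K = (K `^ r^-1) `^ r by rewrite -powRrM mulVf ?gt_eqF // powRr1.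
apply: ge0_ler_powR; rewrite ?nnegrE ?powR_ge0 //; first exact: ltW.
by near: n; exact: nbhs_infty_ger.
Unshelve. all: by end_near. Qed.

Lemma powR_natN0 n r s : (0 < n)%N -> n%:R `^ r * n%:R `^ s = n%:R `^ (r + s) :> R.
Proof. by move=> n0; rewrite powRD // pnatr_eq0 -lt0n n0 implybT. Qed.

Lemma powR_natX n r k : (n%:R `^ r) ^+ k = n%:R `^ (r * k%:R) :> R.
Proof. by rewrite powRrM powR_mulrn // powR_ge0. Qed.

Lemma ler_powR_nat n r s : (0 < n)%N -> r <= s -> n%:R `^ r <= n%:R `^ s :> R.
Proof. by move=> n0 rs; rewrite ler_powR // ler1n. Qed.

Lemma cvg_powRN r : 0 < r -> (n%:R `^ (- r)) @[n --> \oo] --> (0 : R).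
Proof.
move=> r0; apply/cvgrPdist_le => e e0; near=> n.
rewrite sub0r normrN ger0_norm ?powR_ge0 // powRN.
rewrite -[e]invrK lef_pV2 ?posrE ?invr_gt0 //; last first.
  by apply: powR_gt0; near: n; exact: nbhs_infty_gtr.
by near: n; exact: near_powR_ge.
Unshelve. all: by end_near. Qed.

Lemma cvg_powRN_scale c r : 0 < r -> (c * n%:R `^ (- r)) @[n --> \oo] --> (0 : R).
Proof. by move=> r0; rewrite -[0](mulr0 c); apply: cvgM; [exact: cvg_cst|exact: cvg_powRN]. Qed.

Lemma powR_expR_cvg0 (k : nat) c r : 0 < c -> 0 < r ->
  (n%:R ^+ k * expR (- (c * n%:R `^ r))) @[n --> \oo] --> (0 : R).
Proof.
(* With [r * j.+1 >= k.+1] the term of degree [j.+1] in the exponential series already beats the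
   power [n ^ k] by a factor of order [n]. *)
move=> c0 r0; pose j := Num.truncn ((k.+1)%:R / r).
have jr : (k.+1)%:R <= r * (j.+1)%:R.
  by rewrite -ler_pdivrMl // mulrC; apply/ltW/truncnS_gt.
pose C := (j.+1)`!%:R / c ^+ j.+1.
apply: (squeeze_cvgr _ (cvg_cst 0) (@cvg_powRN_scale C 1 ltr01)).
near=> n.
have n0 : (0 < n)%N by near: n; exact: nbhs_infty_gt.
have N0 : 0 < (n%:R : R) by rewrite ltr0n.
apply/andP; split; first by rewrite mulr_ge0 ?expR_ge0 // exprn_ge0 // ltW.
have y0 : 0 < c * n%:R `^ r by rewrite mulr_gt0 // powR_gt0.
have := expR_ge1Dxn j (ltW y0); set y := c * _ in y0 *.
move=> H; have {}H : y ^+ j.+1 / (j.+1)`!%:R <= expR y by apply: le_trans H; rewrite lerDr.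
rewrite expRN ler_pdivrMr ?expR_gt0 //.
apply: (@le_trans _ _ (C * n%:R `^ (-1) * (y ^+ j.+1 / (j.+1)`!%:R))); last first.
  by rewrite ler_wpM2l // mulr_ge0 ?powR_ge0 // divr_ge0 ?exprn_ge0 // ltW.
rewrite /y exprMn powR_natX.
have -> : C * n%:R `^ (-1) * (c ^+ j.+1 * n%:R `^ (r * j.+1%:R) / (j.+1)`!%:R) =
   n%:R `^ (-1) * n%:R `^ (r * j.+1%:R).
  by rewrite /C; field; rewrite expf_neq0 ?gt_eqF //= ?andbT.
rewrite powR_natN0 // -powR_mulrn ?ler0n // ler_powR_nat //.
by move: jr; rewrite -natr1; lra.
Unshelve. all: by end_near. Qed.

Lemma expr_onem_le_expR (q : R) k : q <= 1 -> (1 - q) ^+ k <= expR (- (q * k%:R)).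
Proof.
move=> q1; rewrite -mulNr mulrC expRM_natl.
by apply: lerXn2r; rewrite ?nnegrE ?subr_ge0 ?expR_ge0 // expR_ge1Dx.
Qed.

(** For [q <= 1 / 2] one has [1 <= (1 + 2 * q) * (1 - q)], and [1 + 2 * q] is at most
    [expR (2 * q)]. *)
Lemma expr_onem_ge_expR (q : R) k : 0 <= q -> q <= 1 / 2 ->
  expR (- (2 * q * k%:R)) <= (1 - q) ^+ k.
Proof.
move=> q0 q1; rewrite -mulNr mulrC expRM_natl.
apply: lerXn2r; rewrite ?nnegrE ?expR_ge0 //; first lra.
rewrite expRN -[leRHS]invrK lef_pV2 ?posrE ?expR_gt0 ?invr_gt0 //; last by lra.
apply: le_trans (expR_ge1Dx _); rewrite -[_^-1]mul1r ler_pdivrMr; [nra|lra].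
Qed.

Lemma onem_expr_onem_le (q : R) k : 0 <= q <= 1 -> 1 - (1 - q) ^+ k <= k%:R * q.
Proof.
move=> /andP[q0 q1]; elim: k => [|k IH]; first by rewrite expr0 subrr mul0r.
have h : (1 - q) ^+ k <= 1 by rewrite exprn_ile1 ?subr_ge0 // gerBl.
rewrite exprS -natr1; nra.
Qed.

Lemma pw01 r n : 0 < r -> 0 <= (n%:R : R) `^ (- r) <= 1.
Proof.
(* At [n = 0] the real power with a nonzero exponent has the default value [0], which is still a
   probability. *)
move=> r0; rewrite powR_ge0 /=; case: n => [|n].
  by rewrite powR0 // oppr_eq0 gt_eqF.
by rewrite -[leRHS](powRr0 n.+1%:R) ler_powR_nat // oppr_le0 ltW.
Qed.

Lemma near_pw_le r M : 0 < r -> 0 < M -> \forall n \near \oo, (n%:R : R) `^ (- r) <= M.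
Proof.
move=> r0 M0; near=> n.
have : `|0 - n%:R `^ (- r)| <= M by near: n; move/cvgrPdist_le: (cvg_powRN r0); apply.
by rewrite sub0r normrN ger0_norm ?powR_ge0.
Unshelve. all: by end_near. Qed.

End Asymptotics.

(** * Adjacency patterns *)

Lemma pair_inj (T : finType) (x y z : T) : [set x; y] = [set x; z] -> y = z.
Proof.
move=> E; have : y \in [set x; z] by rewrite -E !inE eqxx orbT.
rewrite !inE => /orP[/eqP yx|/eqP //].
have : z \in [set x; y] by rewrite E !inE eqxx orbT.
by rewrite !inE yx orbb => /eqP.
Qed.

Lemma pair_vpairs n (x y : 'I_n) : ([set x; y] \in vpairs n) = (x != y).
Proof. by rewrite inE cards2; case: (x != y). Qed.

Section Dense.
Variables (R : realType) (alpha : R).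
Hypothesis alpha_gt0 : 0 < alpha.
Let p (n : nat) : R := n%:R `^ (- alpha).
Let p01 n : 0 <= p n <= 1 := pw01 n alpha_gt0.

Definition has_pattern (a b : bool) n (G : {set {set 'I_n}}) :=
  [forall v, [forall x, (v != x) ==> pattern (adj_of G) v x a b]].

(** A third vertex [y] shows the pattern or not through its own two pairs [[set y; v]] and
    [[set y; x]], so this is a product over [n - 2] independent trials. *)
Lemma Pr_no_pattern (a b : bool) n (v x : 'I_n) : v != x ->
  PrG p (fun G => ~~ pattern (adj_of G) v x a b) =
  (1 - p n ^+ (a + b) * (1 - p n) ^+ (2 - (a + b))) ^+ (n - 2).
Proof.
move=> vx; pose Y := [set~ v] :\ x.
pose E (y : 'I_n) := [set [set y; v]; [set y; x]].
pose F (y : 'I_n) := [set e in E y | (a && (e == [set y; v])) || (b && (e == [set y; x]))].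
have vxy y : [set y; v] != [set y; x].
  by apply: contraNneq vx => /pair_inj ->.
have cE y : #|E y| = 2 by rewrite cards2 vxy.
have FE y : F y \subset E y by apply/subsetP => e; rewrite inE => /andP[].
have cF y : #|F y| = (a + b)%N.
  rewrite /F; case: (a); case: (b) => /=.
  - rewrite (_ : [set e in _ | _] = E y) ?cE //.
    by apply/setP => e; rewrite !inE andbb.
  - rewrite (_ : [set e in _ | _] = [set [set y; v]]) ?cards1 //.
    by apply/setP => e; rewrite !inE orbF; case: (e == [set y; v]); rewrite ?andbF.
  - rewrite (_ : [set e in _ | _] = [set [set y; x]]) ?cards1 //.
    by apply/setP => e; rewrite !inE; case: (e == [set y; x]); rewrite ?orbT ?andbF.
  - by apply/eqP; rewrite cards_eq0; apply/eqP/setP => e; rewrite !inE andbF.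
have cEF y : #|E y :\: F y| = (2 - (a + b))%N by rewrite cardsD (setIidPr (FE y)) cE cF.
have cY : #|Y| = (n - 2)%N.
  have := cardsD1 x [set~ v]; rewrite cardsC1 card_ord !inE eq_sym vx -/Y; lia.
rewrite (_ : PrG _ _ = Pr (p n) (vpairs n) (fun G => [forall y in Y, G :&: E y != F y])).
  rewrite Pr_avoid.
  - rewrite (eq_bigr (fun=> 1 - p n ^+ (a + b) * (1 - p n) ^+ (2 - (a + b)))).
      by rewrite prodr_const cY.
    by move=> y _; rewrite cF cEF.
  - move=> y; rewrite !inE => /andP[yx yv]; apply/subsetP => e; rewrite !inE.
    by case/orP => /eqP ->; rewrite cards2 ?yx ?yv.
  - by [].
  - move=> y z; rewrite !inE => /andP[yx yv] /andP[zx zv] yz.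
    rewrite -setI_eq0; apply/eqP/setP => e; rewrite !inE; apply/negbTE/negP.
    move=> /andP[H1 H2].
    have ye : y \in e by case/orP: H1 => /eqP ->; rewrite !inE eqxx.
    by move: ye; case/orP: H2 => /eqP ->; rewrite !inE (negbTE yz) ?(negbTE yx) ?(negbTE yv).
apply: eq_Pr => G _; rewrite negb_exists; apply/forallP/forall_inP => H y.
  rewrite !inE => /andP[yx yv]; move: (H y); rewrite yv yx /=; apply: contra => /eqP/setP EF.
  have := EF [set y; v]; have := EF [set y; x]; rewrite /adj_of !inE !eqxx ?orbT ?andbT /=.
  rewrite (negbTE (vxy y)) eq_sym (negbTE (vxy y)) !andbF ?orbF /=.
  by move=> -> ->; rewrite !eqxx.
apply/negP => /and4P[yv yx /eqP ya /eqP yb].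
have /H/negP : y \in Y by rewrite !inE yx yv.
apply; apply/eqP/setP => e; rewrite !inE.
case ev: (e == [set y; v]).
  rewrite (eqP ev) (negbTE (vxy y)) /= andbF orbF andbT -ya /adj_of.
  by rewrite andbT.
case ex: (e == [set y; x]) => /=; last by rewrite andbF.
by rewrite (eqP ex) andbF /= andbT -yb /adj_of andbT.
Qed.

(** Around a given pair the mean number of vertices showing the pattern is at least n^s / 8 with s =
    1 - alpha (a + b) > 0, where [8] absorbs [(1 - p) ^+ 2 >= 1 / 4] and [n - 2 >= n / 2]. The
    chance of having none is at most exp(- n^s / 8), small enough for a union over all pairs. *)
Lemma whp_pattern (a b : bool) : alpha * (a + b)%:R < 1 -> whp p (has_pattern a b).
Proof.
move=> ab; pose s := 1 - alpha * (a + b)%:R; have s0 : 0 < s by rewrite subr_gt0.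
apply: (@negl_le _ _ p01 _ (fun n => n%:R ^+ 2 * expR (- (8^-1 * n%:R `^ s)))); last first.
  by apply: powR_expR_cvg0.
near=> n.
have n4 : (4 <= n)%N by near: n; exact: nbhs_infty_ge.
have n0 : (0 < n)%N by apply: leq_trans n4.
have p2 : p n <= 1 / 2 by near: n; apply: near_pw_le.
pose q := p n ^+ (a + b) * (1 - p n) ^+ (2 - (a + b)).
have [p0 p1] := andP (p01 n).
have q1 : q <= 1.
  by rewrite mulr_ile1 ?exprn_ge0 ?exprn_ile1 ?subr_ge0 // gerBl.
apply: (@le_trans _ _ (\sum_(vx : 'I_n * 'I_n | vx.1 != vx.2)
   PrG p (fun G => ~~ pattern (adj_of G) vx.1 vx.2 a b))).
  apply: le_trans (Pr_exists _ _ _ _) => //; apply: le_Pr => // G _.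
  rewrite negb_forall => /existsP[v]; rewrite negb_forall => /existsP[x].
  by rewrite negb_imply => H; apply/existsP; exists (v, x).
apply: (@le_trans _ _ (\sum_(vx : 'I_n * 'I_n | vx.1 != vx.2) expR (- (8^-1 * n%:R `^ s)))).
  apply: ler_sum => -[v x] /= vx; rewrite Pr_no_pattern //.
  apply: le_trans (expr_onem_le_expR _ _) _ => //.
  rewrite ler_expR lerN2.
  have -> : n%:R `^ s = n%:R * p n ^+ (a + b).
    by rewrite /p powR_natX /s mulNr -{2}[n%:R]powRr1 // powR_natN0.
  have qq : p n ^+ (a + b) / 4 <= q.
    rewrite /q ler_wpM2l ?exprn_ge0 //.
    apply: (@le_trans _ _ ((1 / 2) ^+ (2 - (a + b)))).
      apply: (@le_trans _ _ ((1 / 2) ^+ 2)); first by rewrite expr2; lra.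
      by apply: ler_wiXn2l; [lra|lra|exact: leq_subr].
    by apply: lerXn2r; rewrite ?nnegrE; lra.
  have nn : n%:R / 2 <= (n - 2)%:R :> R.
    rewrite natrB ?(leq_trans _ n4) //.
    by have : 4 <= n%:R :> R; [rewrite ler_nat|lra].
  have P0 : 0 <= p n ^+ (a + b) by exact: exprn_ge0.
  have : 0 <= n%:R :> R by [].
  move: nn qq P0; rewrite -/q; set N2 := (n - 2)%:R; set P := p n ^+ _; nra.
rewrite sumr_const -[leLHS]mulr_natl ler_wpM2r ?expR_ge0 // -natrX ler_nat.
by apply: leq_trans (max_card _) _; rewrite card_prod card_ord.
Unshelve. all: by end_near. Qed.

End Dense.

(** * Conditioning on a neighbourhood *)

Definition nbrs n (G : {set {set 'I_n}}) (v : 'I_n) := [set y | adj_of G v y].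

Definition star n (v : 'I_n) := [set e : {set 'I_n} | v \in e].

Lemma nbrs_star n (G : {set {set 'I_n}}) v : nbrs (G :&: star v) v = nbrs G v.
Proof. by apply/setP => y; rewrite !inE /adj_of !inE eqxx andbT. Qed.

Lemma nbrs_irr n (G : {set {set 'I_n}}) v : G \subset vpairs n -> v \notin nbrs G v.
Proof. by move=> GV; rewrite inE adj_of_irr. Qed.

Section Neighbourhoods.
Variables (R : realType) (alpha : R).
Hypothesis alpha_gt0 : 0 < alpha.
Let p (n : nat) : R := n%:R `^ (- alpha).
Let p01 n : 0 <= p n <= 1 := pw01 n alpha_gt0.

(** Total probability over the values [S] of the neighbourhood: that value depends on the pairs at
    [v] and [B S] on the others, so the two are independent. Values outside [Q] are paid for by the
    first term of the bound. *)
Lemma Pr_cond_nbrs n (v : 'I_n) (B : {set 'I_n} -> pred {set {set 'I_n}})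
    (Q : pred {set 'I_n}) (eps : R) :
  (forall S : {set 'I_n}, v \notin S -> Q S -> depends_on (~: star v) (B S)) ->
  (forall S : {set 'I_n}, v \notin S -> Q S -> PrG p (B S) <= eps) -> 0 <= eps ->
  PrG p (fun G => B (nbrs G v) G) <= PrG p (fun G => ~~ Q (nbrs G v)) + eps.
Proof.
move=> dB leB eps0.
apply: (@le_trans _ _ (PrG p (fun G => ~~ Q (nbrs G v)) +
   PrG p (fun G => Q (nbrs G v) && B (nbrs G v) G))).
  rewrite -ExD; apply: le_Ex => // G _.
  by case: (Q _); case: (B _ _); rewrite /= ?addr0 ?add0r ?ler01.
rewrite lerD2l.
rewrite (_ : PrG _ _ = Ex (p n) (vpairs n) (fun G => \sum_(S | Q S && (v \notin S))
    (nbrs G v == S)%:R * (B S G)%:R)); last first.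
  apply: eq_Ex => G GV.
  case: (boolP (Q (nbrs G v))) => QN /=; last first.
    rewrite big1 // => S /andP[QS _]; case: eqP => [E|]; last by rewrite mul0r.
    by rewrite E QS in QN.
  rewrite (bigD1 (nbrs G v)) ?QN ?nbrs_irr //= eqxx mul1r big1 ?addr0 //.
  by move=> S /andP[_ /negbTE]; rewrite eq_sym => ->; rewrite mul0r.
rewrite Ex_sum.
apply: (@le_trans _ _ (\sum_(S | Q S && (v \notin S)) PrG p (fun G => nbrs G v == S) * eps)).
  apply: ler_sum => S /andP[QS vS].
  rewrite (@Ex_indep _ _ _ _ (star v) (~: star v)).
  - by rewrite ler_wpM2l ?leB // Pr_ge0.
  - by rewrite -setI_eq0 setICr.
  - by move=> G; rewrite nbrs_star.
  - by move=> G; rewrite dB.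
rewrite -mulr_suml -[leRHS]mul1r ler_wpM2r //.
rewrite /PrG /Pr -Ex_sum -[leRHS](Ex_const (p n) (vpairs n)); apply: le_Ex => // G GV.
case: (boolP (Q (nbrs G v))) => QN; last first.
  rewrite big1 // => S /andP[QS _]; case: eqP => [E|//].
  by rewrite E QS in QN.
rewrite (bigD1 (nbrs G v)) ?QN ?nbrs_irr //= eqxx big1 ?addr0 //.
by move=> S /andP[_ /negbTE]; rewrite eq_sym => ->.
Qed.

Lemma card_nbrs n (v : 'I_n) (G : {set {set 'I_n}}) : G \subset vpairs n ->
  #|nbrs G v| = #|G :&: [set [set v; y] | y in [set~ v]]|.
Proof.
move=> GV; rewrite -(card_imset (mem (nbrs G v)) (@pair_inj _ v)).
apply: eq_card => e; rewrite !inE; apply/imsetP/andP => [[y]|[eG /imsetP[y _ ey]]].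
  rewrite inE => vy ->; split=> //; apply/imsetP; exists y => //.
  by rewrite !inE; apply: contraTneq vy => ->; rewrite adj_of_irr.
by exists y => //; rewrite inE /adj_of -ey.
Qed.

Lemma star_vpairs n (v : 'I_n) : [set [set v; y] | y in [set~ v]] \subset vpairs n.
Proof.
apply/subsetP => e /imsetP[y]; rewrite !inE => yv ->.
by rewrite cards2 (eq_sym v) yv.
Qed.

Lemma card_star n (v : 'I_n) : #|[set [set v; y] | y in [set~ v]]| = n.-1.
Proof. by rewrite card_imset ?cardsC1 ?card_ord //; exact: pair_inj. Qed.

(** Chernoff bound with parameter [1 / 2]: since [expR (1 / 2) <= 2] the moment is at most exp(n p),
    against the factor exp(-2 n p) from the deviation. *)
Lemma Pr_deg_large n (v : 'I_n) :
  PrG p (fun G => 4 * (n%:R * p n) <= #|nbrs G v|%:R) <= expR (- (n%:R * p n)).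
Proof.
have [p0 p1] := andP (p01 n).
pose D0 := [set [set v; y] | y in [set~ v]].
apply: (@le_trans _ _ (Ex (p n) (vpairs n) (fun G => expR (- (2 * (n%:R * p n))) *
    expR (1 / 2 * #|G :&: D0|%:R)))).
  apply: le_Ex => // G GV; rewrite (card_nbrs _ GV) -/D0.
  case: (boolP (4 * (n%:R * p n) <= _)) => [h|_]; last by rewrite mulr_ge0 ?expR_ge0.
  rewrite -expRD -[leLHS]expR0 ler_expR; move: h; lra.
rewrite ExZ Ex_expR_card ?star_vpairs // card_star.
have e2 : expR (1 / 2) <= 2 :> R.
  rewrite -[expR _]invrK -expRN -[leRHS]invrK lef_pV2 ?posrE ?invr_gt0 ?expR_gt0 //.
  by apply: le_trans (expR_ge1Dx _); lra.
have : (1 - p n + p n * expR (1 / 2)) ^+ n.-1 <= expR (n%:R * p n).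
  apply: (@le_trans _ _ ((1 + p n) ^+ n.-1)).
    apply: lerXn2r; rewrite ?nnegrE; first by rewrite addr_ge0 ?mulr_ge0 ?expR_ge0 ?subr_ge0.
      by rewrite addr_ge0.
    nra.
  apply: (@le_trans _ _ ((1 + p n) ^+ n)).
    by apply: ler_weXn2l; [lra|exact: leq_pred].
  rewrite expRM_natl; apply: lerXn2r; rewrite ?nnegrE ?expR_ge0 ?addr_ge0 //.
  exact: expR_ge1Dx.
move=> H; apply: le_trans (ler_wpM2l (expR_ge0 _) H) _.
by rewrite -expRD ler_expR; lra.
Qed.

(** Chernoff bound with parameter [-1]: since [expR (-1) <= 1 / 2] the moment is at most exp(-p (n -
    1) / 2), hence at most exp(-n p / 4), and the deviation gives back exp(n p / 8). *)
Lemma Pr_deg_small n (v : 'I_n) : (2 <= n)%N ->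
  PrG p (fun G => #|nbrs G v|%:R <= n%:R * p n / 8) <= expR (- (n%:R * p n / 8)).
Proof.
move=> n2; have [p0 p1] := andP (p01 n).
pose D0 := [set [set v; y] | y in [set~ v]].
apply: (@le_trans _ _ (Ex (p n) (vpairs n) (fun G => expR (n%:R * p n / 8) *
    expR (-1 * #|G :&: D0|%:R)))).
  apply: le_Ex => // G GV; rewrite (card_nbrs _ GV) -/D0.
  case: (boolP (_ <= n%:R * p n / 8)) => [h|_]; last by rewrite mulr_ge0 ?expR_ge0.
  rewrite -expRD -[leLHS]expR0 ler_expR; move: h; lra.
rewrite ExZ Ex_expR_card ?star_vpairs // card_star.
have e2 : expR (-1) <= 1 / 2 :> R.
  rewrite expRN -[leRHS]invrK lef_pV2 ?posrE ?expR_gt0 //.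
  by apply: le_trans (expR_ge1Dx _); lra.
have : (1 - p n + p n * expR (-1)) ^+ n.-1 <= expR (- (p n / 2 * n.-1%:R)).
  apply: le_trans (expr_onem_le_expR _ _); last lra.
  apply: lerXn2r; rewrite ?nnegrE; [|lra|nra].
  by rewrite addr_ge0 ?mulr_ge0 ?expR_ge0 ?subr_ge0.
move=> H; apply: le_trans (ler_wpM2l (expR_ge0 _) H) _.
rewrite -expRD ler_expR.
have : n%:R <= 2 * n.-1%:R :> R by rewrite -natrM ler_nat; lia.
nra.
Qed.

Hypothesis alpha_lt1 : alpha < 1.

Lemma np_powR n : (0 < n)%N -> n%:R * p n = n%:R `^ (1 - alpha).
Proof. by move=> n0; rewrite -{1}[n%:R]powRr1 // powR_natN0. Qed.

Definition typical n (S : {set 'I_n}) :=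
  (n%:R * p n / 8 < #|S|%:R) && (#|S|%:R < 4 * (n%:R * p n)).

(** Union bound over [v]. Atypical degrees have probability exponentially small in n^(1 - alpha), so
    all that remains is to bound the event for a fixed typical neighbourhood by some [eps] of order
    o(1/n). *)
Lemma negl_nbrs (B : forall n, 'I_n -> {set 'I_n} -> pred {set {set 'I_n}}) (eps : R^nat) :
  (forall n (v : 'I_n) (S : {set 'I_n}), v \notin S -> depends_on (~: star v) (B n v S)) ->
  (\forall n \near \oo, forall v (S : {set 'I_n}), v \notin S -> typical S ->
    PrG p (B n v S) <= eps n) ->
  (n%:R * eps n) @[n --> \oo] --> (0 : R) -> (forall n, 0 <= eps n) ->
  negl p (fun n G => [exists v, B n v (nbrs G v) G]).
Proof.
move=> dB leB eps0 epsge.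
have s0 : 0 < 1 - alpha by rewrite subr_gt0.
apply: (@negl_le _ _ p01 _ (fun n => n%:R ^+ 1 * expR (- (8^-1 * n%:R `^ (1 - alpha))) +
   (n%:R ^+ 1 * expR (- (1 * n%:R `^ (1 - alpha))) + n%:R * eps n))); last first.
  rewrite -[0](addr0 (0 : R)); apply: cvgD; first exact: powR_expR_cvg0.
  by rewrite -[0](addr0 (0 : R)); apply: cvgD => //; exact: powR_expR_cvg0.
near=> n.
have n2 : (2 <= n)%N by near: n; exact: nbhs_infty_ge.
apply: le_trans (@Pr_exists _ _ _ (p01 n) _ _ predT _) _.
rewrite !expr1 -!mulrDr.
apply: (@le_trans _ _ (\sum_(v in 'I_n) (expR (- (8^-1 * n%:R `^ (1 - alpha))) +
   (expR (- (1 * n%:R `^ (1 - alpha))) + eps n)))); last by rewrite sumr_const card_ord mulr_natl.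
apply: ler_sum => v _.
apply: le_trans (@Pr_cond_nbrs n v (B n v) (@typical n) (eps n) _ _ _) _ => //.
- by move=> S vS _; exact: dB.
- by move: v; near: n; apply: filterS leB => n H v S vS QS; exact: H.
rewrite addrA lerD2r -np_powR ?mul1r; last exact: ltnW.
apply: le_trans (_ : PrG p (fun G => #|nbrs G v|%:R <= n%:R * p n / 8) +
   PrG p (fun G => 4 * (n%:R * p n) <= #|nbrs G v|%:R) <= _).
  apply: le_trans (Pr_or _ _ _ _) => //; apply: le_Pr => // G _.
  by rewrite negb_and -!leNgt.
by apply: lerD; [rewrite (mulrC 8^-1); exact: Pr_deg_small|exact: Pr_deg_large].
Unshelve. all: by end_near. Qed.

End Neighbourhoods.

Lemma edges_between_disjoint (T : finType) (A S : {set T}) (x y : T) :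
  [disjoint A & S] -> x \in A -> y \in A -> x != y ->
  [disjoint [set [set x; z] | z in S] & [set [set y; z] | z in S]].
Proof.
move=> AS xA yA xy; rewrite -setI_eq0; apply/eqP/setP => e; rewrite !inE.
apply/negbTE/negP => /andP[/imsetP[z zS ->] /imsetP[w wS E]].
have : x \in [set y; w] by rewrite -E !inE eqxx.
rewrite !inE (negbTE xy) /= => /eqP xw.
by move: (disjointFr AS xA); rewrite xw wS.
Qed.

Lemma subset_of_card (T : finType) (S : {set T}) k : (k <= #|S|)%N ->
  exists2 B : {set T}, B \subset S & #|B| = k.
Proof.
move=> kS; exists [set x in take k (enum S)].
  by apply/subsetP => x; rewrite inE => /mem_take; rewrite mem_enum.
rewrite cardsE; have /card_uniqP -> : uniq (take k (enum S)) by rewrite take_uniq ?enum_uniq.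
by rewrite size_takel // -cardE.
Qed.

Lemma disjoint_blocks (T : finType) (S : {set T}) l K : (K * l <= #|S|)%N ->
  exists B : 'I_K -> {set T}, [/\ forall i, B i \subset S, forall i, #|B i| = l &
    forall i j, i != j -> [disjoint B i & B j]].
Proof.
elim: K S => [|K IH] S h; first by exists (fun=> set0); split=> -[].
have [|B0 B0S cB0] := @subset_of_card _ S l; first by apply: leq_trans h; rewrite mulSn leq_addr.
have [|B [BS cB dB]] := IH (S :\: B0).
  by rewrite cardsD (setIidPr B0S) cB0 leq_subRL -?mulSn // (leq_trans _ h) // mulSn leq_addr.
have BB i : B i \subset S by apply: subset_trans (BS i) (subsetDl _ _).
have B0B i : [disjoint B0 & B i].
  by rewrite disjoint_sym disjoints_subset; apply: subset_trans (BS i) _; rewrite setDE subsetIr.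
exists (fun i => if unlift ord0 i is Some j then B j else B0); split.
- by move=> i; case: unliftP.
- by move=> i; case: unliftP.
- move=> i j; case: unliftP => [i' ->|->]; case: unliftP => [j' ->|->] //.
    by rewrite (inj_eq lift_inj); exact: dB.
  by move=> _; rewrite disjoint_sym.
Qed.

(** * Edges inside and outside a neighbourhood *)

Definition pairs_in n (S : {set 'I_n}) := [set e : {set 'I_n} | (e \subset S) && (#|e| == 2)].

Lemma card_pairs_in n (S : {set 'I_n}) : #|pairs_in S| = 'C(#|S|, 2).
Proof. by rewrite -cards_draws. Qed.

Lemma pairs_in_vpairs n (S : {set 'I_n}) : pairs_in S \subset vpairs n.
Proof. by apply/subsetP => e; rewrite !inE => /andP[]. Qed.

Section NeighbourhoodEvents.
Variables (R : realType) (alpha : R).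
Hypothesis alpha_gt0 : 0 < alpha.
Let p (n : nat) : R := n%:R `^ (- alpha).
Let p01 n : 0 <= p n <= 1 := pw01 n alpha_gt0.

(** Meant for [S = nbrs G v]: then the failure of [dominating] yields a non-neighbour of [v] without
    common neighbour with [v], the failure of [no_isolated] a neighbour without one, and the failure
    of [independent] a triangle at [v]. *)
Definition dominating n (v : 'I_n) (S : {set 'I_n}) (G : {set {set 'I_n}}) :=
  [forall x in ~: (v |: S), [exists y in S, adj_of G x y]].

Definition no_isolated n (v : 'I_n) (S : {set 'I_n}) (G : {set {set 'I_n}}) :=
  [forall x in S, [exists y in S, adj_of G x y]].

Definition independent n (v : 'I_n) (S : {set 'I_n}) (G : {set {set 'I_n}}) :=
  [forall x in S, forall y in S, ~~ adj_of G x y].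

Lemma adj_avoid n (v x y : 'I_n) (G : {set {set 'I_n}}) : x != v -> y != v ->
  adj_of (G :&: ~: star v) x y = adj_of G x y.
Proof.
by move=> xv yv; rewrite /adj_of !inE negb_or (eq_sym v x) xv (eq_sym v y) yv !andbT.
Qed.

Lemma neq_notin (T : finType) (x v : T) (S : {set T}) : v \notin S -> x \in S -> x != v.
Proof. by move=> vS xS; apply: contraNneq vS => <-. Qed.

Lemma dominating_dep n (v : 'I_n) (S : {set 'I_n}) : v \notin S ->
  depends_on (~: star v) (dominating v S).
Proof.
move=> vS G; apply: eq_forallb_in => x; rewrite !inE negb_or => /andP[xv _].
by apply: eq_existsb_in => y yS; rewrite adj_avoid // (neq_notin vS).
Qed.

Lemma no_isolated_dep n (v : 'I_n) (S : {set 'I_n}) : v \notin S ->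
  depends_on (~: star v) (no_isolated v S).
Proof.
move=> vS G; apply: eq_forallb_in => x xS.
by apply: eq_existsb_in => y yS; rewrite adj_avoid // (neq_notin vS).
Qed.

Lemma independent_dep n (v : 'I_n) (S : {set 'I_n}) : v \notin S ->
  depends_on (~: star v) (independent v S).
Proof.
move=> vS G; apply: eq_forallb_in => x xS.
by apply: eq_forallb_in => y yS; rewrite adj_avoid // (neq_notin vS).
Qed.

Lemma Pr_all_meet n (A S : {set 'I_n}) : [disjoint A & S] ->
  PrG p (fun G => [forall x in A, [exists y in S, adj_of G x y]]) =
  (1 - (1 - p n) ^+ #|S|) ^+ #|A|.
Proof.
move=> AS; pose E (x : 'I_n) := [set [set x; z] | z in S].
rewrite (_ : PrG _ _ = Pr (p n) (vpairs n) (fun G => [forall y in A, G :&: E y != set0])).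
  rewrite Pr_avoid.
  - rewrite (eq_bigr (fun=> 1 - (1 - p n) ^+ #|S|)) ?prodr_const //.
    move=> y _; rewrite cards0 expr0 mul1r setD0 card_imset //; exact: pair_inj.
  - move=> y yA; apply/subsetP => e /imsetP[z zS ->]; rewrite pair_vpairs.
    by apply: contraTneq zS => <-; rewrite (disjointFr AS yA).
  - by move=> y _; exact: sub0set.
  - by move=> x y xA yA xy; exact: edges_between_disjoint AS xA yA xy.
apply: eq_Pr => G _; apply: eq_forallb_in => x xA; apply/exists_inP/set0Pn.
  by move=> [y yS xy]; exists [set x; y]; rewrite inE [_ \in G]xy; apply/imsetP; exists y.
by move=> [e]; rewrite inE => /andP[eG /imsetP[y yS ey]]; exists y; rewrite // /adj_of -ey.
Qed.

Lemma Pr_independent n (v : 'I_n) (S : {set 'I_n}) :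
  PrG p (independent v S) <= (1 - p n) ^+ 'C(#|S|, 2).
Proof.
apply: (@le_trans _ _ (Pr (p n) (vpairs n) (fun G => G :&: pairs_in S == set0))); last first.
  rewrite Pr_trace ?sub0set ?pairs_in_vpairs //.
  by rewrite cards0 expr0 mul1r setD0 card_pairs_in.
apply: le_Pr => // G _ /forall_inP H; apply/eqP/setP => e; rewrite !inE.
apply/negbTE/negP => /and3P[eG eS /cards2P[x [y [xy exy]]]].
have xS : x \in S by apply: (subsetP eS); rewrite exy !inE eqxx.
have yS : y \in S by apply: (subsetP eS); rewrite exy !inE eqxx orbT.
by move/forall_inP: (H x xS) => /(_ y yS)/negP[]; rewrite /adj_of -exy.
Qed.

(* Split [K] blocks of size [l] off [S]. Blocks span edges independently of each
   other, and in a block without edges every vertex needs a neighbour in the rest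
   of [S], again independently. *)
Lemma Pr_no_isolated n (v : 'I_n) (S : {set 'I_n}) K l : (K * l <= #|S|)%N ->
  PrG p (no_isolated v S) <= (l%:R ^+ 2 * p n) ^+ K +
     K%:R * (1 - (1 - p n) ^+ (#|S| - l)) ^+ l.
Proof.
move=> KS; have [B [BS cB dB]] := disjoint_blocks KS.
have [p0 p1] := andP (p01 n).
apply: (@le_trans _ _ (PrG p (fun G => [forall i in 'I_K, G :&: pairs_in (B i) != set0]) +
  \sum_(i in 'I_K) PrG p (fun G =>
     [forall x in B i, [exists y in S :\: B i, adj_of G x y]]))).
  apply: le_trans (lerD (lexx _) (@Pr_exists _ _ _ (p01 n) _ _ _ _)).
  apply: le_trans (Pr_or _ _ _ _) => //; apply: le_Pr => // G GV /forall_inP H /=.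
  rewrite -implyNb; apply/implyP; rewrite negb_forall => /existsP[i]; rewrite negbK => Bi.
  apply/existsP; exists i; apply/forall_inP => x xB.
  have /exists_inP[y yS xy] := H x (subsetP (BS i) x xB).
  apply/exists_inP; exists y => //; rewrite inE yS andbT; apply/negP => yB.
  move/eqP/setP: Bi => /(_ [set x; y]); rewrite !inE [_ \in G]xy /= cards2.
  rewrite (_ : x != y) ?andbT; last by apply: contraTneq xy => ->; rewrite adj_of_irr.
  by rewrite subUset !sub1set xB yB.
apply: lerD.
  pose Y := [set: 'I_K].
  rewrite (_ : PrG _ _ = Pr (p n) (vpairs n)
      (fun G => [forall i in Y, G :&: pairs_in (B i) != set0])); last first.
    by apply: eq_Pr => G _; apply: eq_forallb => i; rewrite !inE.
  rewrite Pr_avoid; first last.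
  - move=> i j _ _ ij; rewrite -setI_eq0; apply/eqP/setP => e; rewrite !inE; apply/negbTE/negP.
    move=> /andP[/andP[eBi /cards2P[x [y [xy exy]]]] /andP[eBj _]].
    have xe : x \in e by rewrite exy !inE eqxx.
    by move: (disjointFr (dB _ _ ij) (subsetP eBi _ xe)); rewrite (subsetP eBj _ xe).
  - by move=> i _; exact: sub0set.
  - by move=> i _; exact: pairs_in_vpairs.
  apply: (@le_trans _ _ (\prod_(i in Y) (l%:R ^+ 2 * p n))); last first.
    by rewrite prodr_const cardsT card_ord.
  apply: ler_prod => i _; rewrite cards0 expr0 mul1r setD0 card_pairs_in cB.
  rewrite subr_ge0 exprn_ile1 ?subr_ge0 ?gerBl //=.
  apply: (le_trans (onem_expr_onem_le _ (p01 n))); rewrite ler_wpM2r // -natrX ler_nat.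
  by rewrite bin2 -divn2 (leq_trans (leq_div _ _)) // expnS expn1 leq_mul ?leq_pred.
rewrite (eq_bigr (fun=> (1 - (1 - p n) ^+ (#|S| - l)) ^+ l)) ?sumr_const ?card_ord ?mulr_natl //.
move=> i _; rewrite Pr_all_meet ?cB //.
  by rewrite cardsD (setIidPr (BS i)) cB.
by rewrite -setI_eq0; apply/eqP/setP => x; rewrite !inE; case: (x \in B i).
Qed.

Hypothesis alpha_lt1 : alpha < 1.

(** A neighbourhood of order n p contains of order p (n p)^2 = n^(2 - 3 alpha) edges on average,
    which grows for [alpha < 2 / 3]. The constant [256] is [8 ^ 2] from the lower bound on the
    degree times [4] from [C2]. *)
Lemma negl_independent : alpha < 2 / 3 ->
  negl p (fun n G => [exists v, independent v (nbrs G v) G]).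
Proof.
move=> a23; have s0 : 0 < 2 - 3 * alpha by lra.
have s1 : 0 < 1 - alpha by lra.
pose eps n : R := expR (- (256^-1 * n%:R `^ (2 - 3 * alpha))).
apply: (@negl_nbrs _ _ alpha_gt0 alpha_lt1 _ eps).
- by move=> n v S vS; exact: independent_dep.
- near=> n => v S vS /andP[lo _]; rewrite -/(p n) in lo; apply: le_trans (Pr_independent _ _) _.
  have n0 : (0 < n)%N by near: n; exact: nbhs_infty_gt.
  have [p0 p1] := andP (p01 n).
  apply: le_trans (expr_onem_le_expR _ p1) _; rewrite ler_expR lerN2.
  have np : 16 <= n%:R * p n.
    by rewrite np_powR //; near: n; exact: near_powR_ge.
  rewrite (_ : n%:R `^ _ = p n * (n%:R * p n) ^+ 2); last first.
    rewrite np_powR // powR_natX /p powR_natN0 //; congr (_ `^ _); ring.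
  have S2 : (2 <= #|S|)%N.
    by rewrite -(ler_nat R); apply: ltW; apply: le_lt_trans lo; rewrite -/(p n); lra.
  have C2 : #|S|%:R ^+ 2 <= 4 * 'C(#|S|, 2)%:R :> R.
    rewrite -natrX -natrM ler_nat bin2.
    have := odd_double_half (#|S| * #|S|.-1); rewrite -muln2.
    have -> : odd (#|S| * #|S|.-1) = false by case: #|S| => // k; rewrite oddM /= andNb.
    move: S2; case: #|S| => // k; rewrite /= expnS expn1; nia.
  have : (n%:R * p n) ^+ 2 <= 64 * #|S|%:R ^+ 2.
    rewrite (_ : 64 * _ = (8 * #|S|%:R) ^+ 2); last by ring.
    by apply: lerXn2r; rewrite ?nnegrE; [lra|rewrite mulr_ge0|lra].
  nra.
- under eq_fun do rewrite -[n in n * _]expr1.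
  by apply: powR_expR_cvg0 => //; lra.
- by move=> n; exact: expR_ge0.
Unshelve. all: by end_near. Qed.

Hypothesis alpha_ge : 1 / 2 <= alpha.

(** For [1 / 2 <= alpha] one has n p^2 <= 1, hence [2 * p n * d <= 8]: a vertex misses a set of
    typical size with probability bounded below. This is the origin of [expR (-8)] in the next two
    lemmas. *)
Lemma onem_pow_ge n d : (0 < n)%N -> p n <= 1 / 2 -> d%:R < 4 * (n%:R * p n) ->
  expR (-8) <= (1 - p n) ^+ d.
Proof.
move=> n0 p2 hd; have [p0 p1] := andP (p01 n).
apply: le_trans (expr_onem_ge_expR _ p0 p2); rewrite ler_expR lerN2.
have : n%:R * p n * p n <= 1.
  rewrite np_powR // /p powR_natN0 // -[leRHS](powRr0 n%:R) ler_powR_nat //.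
  by have := alpha_ge; lra.
nra.
Qed.

Lemma negl_dominating : negl p (fun n G => [exists v, dominating v (nbrs G v) G]).
Proof.
have a1 := alpha_lt1; have a2 := alpha_ge; have s1 : 0 < 1 - alpha by lra.
(* At least [n / 2] vertices lie outside [v |: S], and each misses [S] with probability at least
   [expR (-8)], independently. *)
pose eps n : R := expR (- (expR (-8) / 2 * n%:R `^ 1)).
apply: (@negl_nbrs _ _ alpha_gt0 alpha_lt1 _ eps).
- by move=> n v S vS; exact: dominating_dep.
- near=> n => v S vS /andP[_ hi]; rewrite -/(p n) in hi.
  have n0 : (0 < n)%N by near: n; exact: nbhs_infty_gt.
  have n4 : (4 <= n)%N by near: n; exact: nbhs_infty_ge.
  have p2 : p n <= 1 / 16 by near: n; apply: near_pw_le => //; lra.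
  have [p0 p1] := andP (p01 n).
  rewrite /dominating Pr_all_meet; last first.
    by rewrite -setI_eq0; apply/eqP/setP => x; rewrite !inE; case: (x \in S); rewrite ?orbT ?andbF.
  have -> : #|~: (v |: S)| = (n - (true + #|S|))%N by rewrite cardsCs setCK cardsU1 vS card_ord.
  apply: (@le_trans _ _ ((1 - expR (-8)) ^+ (n - (true + #|S|)))).
    apply: lerXn2r; rewrite ?nnegrE ?subr_ge0.
    + by rewrite exprn_ile1 ?subr_ge0 ?gerBl.
    + by rewrite -[leRHS]expR0 ler_expR; lra.
    + by rewrite lerD2l lerN2; apply: onem_pow_ge => //; lra.
  apply: le_trans (expr_onem_le_expR _ _) _.
    by rewrite -[leRHS]expR0 ler_expR; lra.
  rewrite ler_expR lerN2 powRr1 // -mulrA ler_wpM2l ?expR_ge0 //.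
  have n4R : 4 <= n%:R :> R by rewrite (ler_nat R 4).
  have nb : #|S|%:R < n%:R / 4 :> R by nra.
  have : n%:R <= (n - (true + #|S|))%:R + 1 + #|S|%:R :> R.
    by rewrite -addrA nat1r -natrD ler_nat addnC -leq_subLR.
  lra.
- under eq_fun do rewrite -[n in n * _]expr1.
  by apply: powR_expR_cvg0 => //; rewrite divr_gt0 ?expR_gt0.
- by move=> n; exact: expR_ge0.
Unshelve. all: by end_near. Qed.

Lemma negl_no_isolated : negl p (fun n G => [exists v, no_isolated v (nbrs G v) G]).
Proof.
have a1 := alpha_lt1; have a2 := alpha_ge; have s1 : 0 < 1 - alpha by lra.
(* Blocks of size l about n^d contain an edge with probability at most l^2 p <= n^(2 d - alpha) <=
   n^(-1/4), as [1 / 2 <= alpha]. Five of them bring this down to n^(-5/4), which is o(1/n), and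
   they fit into [S] since n p = n^(4 d). *)
pose d := (1 - alpha) / 4; have d0 : 0 < d by rewrite divr_gt0.
pose l n := Num.truncn (n%:R `^ d : R).
(* The factor [expR (expR (-8))] makes up for rounding n^d down to the integer [l n]. *)
pose eps n : R := n%:R `^ (- (5 / 4)) + 5 * (expR (expR (-8)) * expR (- (expR (-8) * n%:R `^ d))).
apply: (@negl_nbrs _ _ alpha_gt0 alpha_lt1 _ eps).
- by move=> n v S vS; exact: no_isolated_dep.
- near=> n => v S vS /andP[lo hi]; rewrite -/(p n) in lo hi.
  have n0 : (0 < n)%N by near: n; exact: nbhs_infty_gt.
  have p2 : p n <= 1 / 16 by near: n; apply: near_pw_le => //; lra.
  have [p0 p1] := andP (p01 n).
  have le1 : (l n)%:R <= n%:R `^ d :> R by rewrite truncn_le // powR_ge0.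
  have le2 : n%:R `^ d < (l n)%:R + 1 :> R by rewrite natr1; exact: truncnS_gt.
  have h40 : 40 <= n%:R `^ (3 * d) by near: n; apply: near_powR_ge; lra.
  have lS : (5 * l n <= #|S|)%N.
    rewrite -(ler_nat R); apply: ltW; apply: le_lt_trans lo; rewrite natrM.
    have -> : n%:R * p n = n%:R `^ d * n%:R `^ (3 * d).
      by rewrite np_powR // powR_natN0 //; congr (_ `^ _); rewrite /d; field.
    have : 0 <= n%:R `^ d :> R by exact: powR_ge0.
    nra.
  apply: le_trans (Pr_no_isolated v lS) _; apply: lerD.
    apply: (@le_trans _ _ ((n%:R `^ (- (1 / 4))) ^+ 5)); last first.
      by rewrite powR_natX ler_powR_nat //; lra.
    apply: lerXn2r; rewrite ?nnegrE ?powR_ge0 //; first by rewrite mulr_ge0 ?exprn_ge0.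
    apply: (@le_trans _ _ ((n%:R `^ d) ^+ 2 * p n)).
      by rewrite ler_wpM2r //; apply: lerXn2r; rewrite ?nnegrE ?powR_ge0.
    by rewrite powR_natX /p powR_natN0 // ler_powR_nat // /d; lra.
  rewrite ler_wpM2l //.
  apply: (@le_trans _ _ ((1 - expR (-8)) ^+ l n)).
    apply: lerXn2r; rewrite ?nnegrE ?subr_ge0.
    + by rewrite exprn_ile1 ?subr_ge0 ?gerBl.
    + by rewrite -[leRHS]expR0 ler_expR; lra.
    + rewrite lerD2l lerN2; apply: onem_pow_ge => //; first by lra.
      by apply: le_lt_trans hi; rewrite ler_nat leq_subr.
  apply: le_trans (expr_onem_le_expR _ _) _.
    by rewrite -[leRHS]expR0 ler_expR; lra.
  rewrite -expRD ler_expR.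
  have : 0 < expR (-8) :> R by exact: expR_gt0.
  nra.
- under eq_fun do rewrite mulrDr.
  rewrite -[0](addr0 (0 : R)); apply: cvgD.
    apply: (squeeze_cvgr _ (cvg_cst 0) (@cvg_powRN _ (1 / 4) _)); last by lra.
    near=> n; have n0 : (0 < n)%N by near: n; exact: nbhs_infty_gt.
    rewrite mulr_ge0 ?powR_ge0 //= -{1}[n%:R]powRr1 // powR_natN0 // ler_powR_nat //; lra.
  rewrite (_ : (fun n : nat => _) = (fun n : nat => 5 * expR (expR (-8)) *
     (n%:R ^+ 1 * expR (- (expR (-8) * n%:R `^ d))))); last first.
    by apply/funext => n; rewrite expr1; ring.
  rewrite -[0](mulr0 (5 * expR (expR (-8)) : R)); apply: cvgM; first exact: cvg_cst.
  by apply: powR_expR_cvg0 => //; rewrite expR_gt0.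
- by move=> n; rewrite addr_ge0 ?powR_ge0 // mulr_ge0 // mulr_ge0 ?expR_ge0.
Unshelve. all: by end_near. Qed.

End NeighbourhoodEvents.

(** * Triangles *)

(** The bit [a] is adjacency to [y] and [c] tells whether [x] and [y] have a common neighbour, so
    the type [true true] means that [x] lies in a triangle. *)
Definition has_nbr_type (V : finType) (adj : rel V) (x : V) (a c : bool) :=
  [exists y, [&& y != x, adj x y == a & pattern adj x y true true == c]].

Lemma adj_sub_pairs n (G : {set {set 'I_n}}) (A : {set 'I_n}) x y :
  pairs_in A \subset G -> x \in A -> y \in A -> x != y -> adj_of G x y.
Proof.
by move=> AG xA yA xy; apply: (subsetP AG); rewrite inE subUset !sub1set xA yA cards2 xy.
Qed.

Lemma in_triangle n (G : {set {set 'I_n}}) (A : {set 'I_n}) v :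
  pairs_in A \subset G -> #|A| = 3 -> v \in A -> has_nbr_type (adj_of G) v true true.
Proof.
move=> AG A3 vA; have /eqP/cards2P[y [z [yz Ayz]]] : #|A :\ v| = 2.
  by move: A3; rewrite (cardsD1 v) vA => -[].
have : y \in A :\ v by rewrite Ayz !inE eqxx.
have : z \in A :\ v by rewrite Ayz !inE eqxx orbT.
rewrite !inE => /andP[zv zA] /andP[yv yA].
have vy : adj_of G v y by apply: adj_sub_pairs AG _ _ _; rewrite // eq_sym.
apply/existsP; exists y; rewrite yv vy eqxx /=.
apply/eqP/existsP; exists z; rewrite zv (eq_sym z) yz /=.
by rewrite !(adj_sub_pairs AG) // eq_sym.
Qed.

Lemma in_triangleP n (G : {set {set 'I_n}}) v : G \subset vpairs n ->
  has_nbr_type (adj_of G) v true true ->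
  exists A : {set 'I_n}, [/\ pairs_in A \subset G, #|A| = 3 & v \in A].
Proof.
move=> GV /existsP[y /and3P[yv /eqP vy /eqP/existsP[z /and4P[zv zy /eqP zv' /eqP zy']]]].
exists [set v; y; z]; split; last by rewrite !inE eqxx.
  apply/subsetP => e; rewrite inE => /andP[eA /cards2P[a [b [ab eab]]]].
  have : a \in [set v; y; z] by apply: (subsetP eA); rewrite eab !inE eqxx.
  have : b \in [set v; y; z] by apply: (subsetP eA); rewrite eab !inE eqxx orbT.
  rewrite eab -[_ \in G]/(adj_of G a b) !inE.
  move=> /orP[/orP[]|] /eqP eb /orP[/orP[]|] /eqP ea; move: ab; rewrite ea eb ?eqxx // => _;
    by rewrite // adj_of_sym.
by rewrite (setUC [set v; y]) cardsU1 !inE negb_or zv zy cards2 eq_sym yv.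
Qed.

Definition triangles n (G : {set {set 'I_n}}) :=
  [set A : {set 'I_n} | (#|A| == 3) && (pairs_in A \subset G)].

Lemma card_triangles (R : realType) n (G : {set {set 'I_n}}) :
  #|triangles G|%:R = \sum_(A : {set 'I_n} | #|A| == 3) (pairs_in A \subset G)%:R :> R.
Proof.
rewrite -sum1_card natr_sum (eq_bigl (fun A : {set 'I_n} => (#|A| == 3) && (pairs_in A \subset G))).
  by rewrite big_mkcondr; apply: eq_bigr => A _; case: (_ \subset _).
by move=> A; rewrite inE.
Qed.

(** Such a [B] arises from [A] by exchanging one of its three vertices for another vertex. *)
Lemma card_meet2 n (A : {set 'I_n}) : #|A| = 3 ->
  (#|[set B : {set 'I_n} | (#|B| == 3%N) && (#|A :&: B| == 2%N)]| <= 3 * n)%N.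
Proof.
move=> A3.
apply: (@leq_trans #|[set ab.2 |: (A :\ ab.1) | ab in setX A [set: 'I_n]]|); last first.
  by apply: leq_trans (leq_imset_card _ _) _; rewrite cardsX A3 cardsT card_ord.
apply/subset_leq_card/subsetP => B; rewrite inE => /andP[/eqP B3 /eqP AB].
have /cards1P[a Aa] : #|A :\: B| == 1%N by rewrite cardsD AB A3.
have /cards1P[b Bb] : #|B :\: A| == 1%N by rewrite cardsD setIC AB B3.
have aA : a \in A by have : a \in A :\: B; [rewrite Aa inE | rewrite inE => /andP[]].
apply/imsetP; exists (a, b); first by rewrite !inE aA.
apply/setP => x /=; move/setP: Aa => /(_ x); move/setP: Bb => /(_ x); rewrite !inE.
by case: (x \in A); case: (x \in B) => /= <- <-.
Qed.

Section Triangles.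
Variables (R : realType) (n : nat) (p : R).
Hypothesis p01 : 0 <= p <= 1.
Let mu : R := 'C(n, 3)%:R * p ^+ 3.
Let X (G : {set {set 'I_n}}) : R := #|triangles G|%:R.

Lemma Ex_triangles : Ex p (vpairs n) X = mu.
Proof.
rewrite (eq_Ex _ (fun G _ => card_triangles R G)) Ex_sum.
rewrite (eq_bigr (fun=> p ^+ 3)) => [|A /eqP A3]; last first.
  by rewrite -/(Pr _ _ _) Pr_sub ?pairs_in_vpairs // card_pairs_in A3.
rewrite (eq_bigl (fun A => A \in [set A : {set 'I_n} | #|A| == 3%N])) => [|A]; last by rewrite inE.
by rewrite sumr_const card_draws card_ord -mulr_natl.
Qed.

(** Two triples that meet in i vertices span 6 - C(i,2) pairs. Disjoint or nearly disjoint ones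
    reproduce the squared mean, equal ones contribute [mu], and those with a common edge at most
    [3 * n] terms [p ^+ 5] for each [A]. *)
Lemma Ex_triangles2 :
  Ex p (vpairs n) (fun G => X G ^+ 2) <= mu ^+ 2 + mu * (1 + 3 * n%:R * p ^+ 2).
Proof.
have [p0 p1] := andP p01.
rewrite (@eq_Ex _ _ p _ _ (fun G => \sum_(A : {set 'I_n} | #|A| == 3) \sum_(B : {set 'I_n} | #|B| == 3)
    (pairs_in A :|: pairs_in B \subset G)%:R)); last first.
  move=> G _; rewrite /X card_triangles expr2 big_distrlr /=.
  by apply: eq_bigr => A _; apply: eq_bigr => B _; rewrite subUset -natrM mulnb.
rewrite Ex_sum.
apply: (@le_trans _ _ (\sum_(A : {set 'I_n} | #|A| == 3) (p ^+ 3 * mu + (p ^+ 3 + 3 * n%:R * p ^+ 5)))).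
  apply: ler_sum => A /eqP A3; rewrite Ex_sum.
  apply: (@le_trans _ _ (\sum_(B : {set 'I_n} | #|B| == 3) (p ^+ 6 +
     ((B == A)%:R * p ^+ 3 + (#|A :&: B| == 2)%:R * p ^+ 5)))).
    apply: ler_sum => B /eqP B3.
    rewrite -/(Pr _ _ _) Pr_sub ?subUset ?pairs_in_vpairs //.
    have -> : #|pairs_in A :|: pairs_in B| = (6 - 'C(#|A :&: B|, 2))%N.
      rewrite cardsU !card_pairs_in A3 B3; congr (_ - _)%N; rewrite -card_pairs_in.
      apply: eq_card => e; rewrite !inE subsetI.
      by case: (_ \subset A); case: (_ \subset B); case: (_ == _).
    have := subset_leq_card (subsetIl A B); rewrite A3.
    have e0 k : 0 <= p ^+ k by exact: exprn_ge0.
    have := e0 6%N; have := e0 5%N; have := e0 3%N.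
    move=> q3 q5 q6.
    case AB : #|A :&: B| => [|[|[|[|//]]]] _ /=.
    - by rewrite subn0 mul0r addr0 lerDl mulr_ge0.
    - by rewrite subn0 mul0r addr0 lerDl mulr_ge0.
    - by rewrite /= mul1r -[leLHS]add0r lerD // -[leLHS]add0r lerD // mulr_ge0.
    - have -> : B == A.
        rewrite eq_sym eqEcard A3 B3 leqnn andbT; apply/setIidPl/eqP.
        by rewrite eqEcard subsetIl AB A3.
      by rewrite mul1r mul0r addr0 -[leLHS]add0r lerD.
  rewrite !big_split /= -!mulr_suml.
  rewrite (eq_bigl (fun A => A \in [set A : {set 'I_n} | #|A| == 3%N])) => [|B]; last by rewrite inE.
  rewrite sumr_const card_draws card_ord -[_ *+ _]mulr_natl.
  apply: lerD; first by rewrite /mu le_eqVlt; apply/orP; left; apply/eqP; ring.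
  apply: lerD.
    rewrite (bigD1 A) /= ?A3 // eqxx big1 ?addr0 ?mul1r // => B /andP[_ /negbTE ->] //.
  rewrite ler_wpM2r ?exprn_ge0 // -natr_sum -natrM ler_nat.
  apply: leq_trans (card_meet2 A3); rewrite -sum1_card big_mkcond [leqRHS]big_mkcond /=.
  by apply: leq_sum => B _; rewrite inE; case: (#|B| == _); case: (_ == _).
rewrite (eq_bigl (fun A => A \in [set A : {set 'I_n} | #|A| == 3%N])) => [|B]; last by rewrite inE.
rewrite sumr_const card_draws card_ord -[_ *+ _]mulr_natl /mu.
by rewrite le_eqVlt; apply/orP; left; apply/eqP; ring.
Qed.

End Triangles.

Lemma bin3_ge (R : realType) n : (6 <= n)%N -> n%:R ^+ 3 <= 24 * 'C(n, 3)%:R :> R.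
Proof.
move=> n6; rewrite -natrX -natrM ler_nat.
have := bin_ffact n 3; rewrite !ffactnS ffactn0 muln1 (_ : 3`! = 6)%N //.
move: n6; case: n => [|[|[|[|[|[|n]]]]]] // _ /=.
rewrite (_ : 24 = 4 * 6)%N // -mulnA [(6 * _)%N]mulnC => ->.
rewrite !expnS expn0; nia.
Qed.

Lemma bin3_le (R : realType) n : 6 * 'C(n, 3)%:R <= n%:R ^+ 3 :> R.
Proof.
rewrite -natrX -natrM ler_nat mulnC.
have := bin_ffact n 3; rewrite (_ : 3`! = 6)%N // => ->.
rewrite !ffactnS ffactn0 muln1 !expnS expn0 muln1.
by rewrite !leq_mul // !(leq_trans (leq_pred _)).
Qed.

Section TriangleThreshold.
Variables (R : realType) (alpha : R).
Hypothesis alpha_gt0 : 0 < alpha.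
Let p (n : nat) : R := n%:R `^ (- alpha).
Let p01 n : 0 <= p n <= 1 := pw01 n alpha_gt0.

(** This quotient bounds the variance over the squared mean. From [bin3_ge] the mean is at least (n
    p)^3 / 24, and n p^2 / (n p)^3 = n^(-(2 - alpha)). *)
Lemma triangle_ratio n : (6 <= n)%N ->
  let mu := 'C(n, 3)%:R * p n ^+ 3 in
  0 < mu /\ (1 + 3 * n%:R * p n ^+ 2) / mu <=
    24 * n%:R `^ (- (3 * (1 - alpha))) + 72 * n%:R `^ (- (2 - alpha)).
Proof.
move=> n6 mu; have n0 : (0 < n)%N by apply: leq_trans n6.
have N0 : 0 < n%:R :> R by rewrite ltr0n.
have P0 : 0 < p n by exact: powR_gt0.
have b := bin3_ge R n6.
have p3 : 0 < p n ^+ 3 by exact: exprn_gt0.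
have low : n%:R ^+ 3 * p n ^+ 3 <= 24 * mu by rewrite /mu mulrA; apply: ler_wpM2r => //; exact: ltW.
have np3 : 0 < n%:R ^+ 3 * p n ^+ 3 by rewrite mulr_gt0 ?exprn_gt0.
have mu0 : 0 < mu by lra.
split=> //; rewrite ler_pdivrMr //.
have E1 : n%:R `^ (- (3 * (1 - alpha))) = (n%:R ^+ 3 * p n ^+ 3)^-1.
  by rewrite powRN -exprMn np_powR // powR_natX mulrC.
have E2 : n%:R `^ (- (2 - alpha)) = n%:R * p n ^+ 2 / (n%:R ^+ 3 * p n ^+ 3).
  have -> : n%:R * p n ^+ 2 / (n%:R ^+ 3 * p n ^+ 3) = (n%:R ^+ 2 * p n)^-1 by field; rewrite !gt_eqF.
  by rewrite powRN; congr (_^-1); rewrite -powR_mulrn // /p powR_natN0.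
rewrite E1 E2; set Q := n%:R ^+ 3 * p n ^+ 3 in low np3 *.
have : 1 <= 24 * mu / Q by rewrite ler_pdivlMr // mul1r.
have : 0 <= n%:R * p n ^+ 2 by rewrite mulr_ge0 ?exprn_ge0 ?ltW.
set w := n%:R * _; rewrite -(mulrA 3) -/w => w0 h.
rewrite (_ : _ * mu = (1 + 3 * w) * (24 * mu / Q)); last by ring.
nra.
Qed.

(** One use of Chebyshev's inequality gives both bounds, since having no triangle and having twice
    the mean both deviate from the mean by at least [mu]. *)
Lemma whp_triangles : alpha < 1 -> whp p (fun n G =>
   (0 < #|triangles G|)%N && (#|triangles G|%:R < 2 * ('C(n, 3)%:R * p n ^+ 3))).
Proof.
move=> a1.
apply: (@negl_le _ _ p01 _ (fun n => 24 * n%:R `^ (- (3 * (1 - alpha))) + 72 * n%:R `^ (- (2 - alpha)))); last first.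
  by rewrite -[0](addr0 (0 : R)); apply: cvgD; apply: cvg_powRN_scale; lra.
near=> n.
have n6 : (6 <= n)%N by near: n; exact: nbhs_infty_ge.
have [mu0 r] := triangle_ratio n6; apply: le_trans r.
set mu := _ * _ in mu0 *.
apply: (@le_trans _ _ (PrG p (fun G : {set {set 'I_n}} => mu <= `|#|triangles G|%:R - mu|))).
  apply: le_Pr => // G _; rewrite negb_and -leqNgt -leNgt leqn0 => /orP[/eqP ->|h].
    by rewrite sub0r normrN ger0_norm // ltW.
  by apply: le_trans (ler_norm _); rewrite -/mu in h; lra.
apply: le_trans (@chebyshev_upper R _ (p n) (p01 n) (vpairs n) (fun G => #|triangles G|%:R)
  mu mu mu0 (esym (@Ex_triangles R n (p n)))) _.
rewrite ler_pdivrMr ?exprn_gt0 // lerBlDl.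
apply: le_trans (Ex_triangles2 _ (p01 n)) _; rewrite -/mu lerD2l.
by rewrite le_eqVlt; apply/orP; left; apply/eqP; field; rewrite gt_eqF.
Unshelve. all: by end_near. Qed.

(** At [alpha = 1] the quotient in [triangle_ratio] is at most 24 + 72 = 96, so the second moment is
    at most [97] times the squared mean; the Paley-Zygmund inequality at [0] does the rest. *)
Lemma Pr_triangle_ge n : alpha = 1 -> (6 <= n)%N ->
  97^-1 <= PrG p (fun G : {set {set 'I_n}} => (0 < #|triangles G|)%N).
Proof.
move=> a1 n6; have [mu0 r] := triangle_ratio n6.
have n0 : (0 < n)%N by apply: leq_trans n6.
have r2 : (1 + 3 * n%:R * p n ^+ 2) / ('C(n, 3)%:R * p n ^+ 3) <= 96.
  apply: le_trans r _; rewrite a1 subrr mulr0 oppr0 powRr0.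
  suff : n%:R `^ (- (2 - 1)) <= 1 :> R by lra.
  by rewrite -[leRHS](powRr0 n%:R) ler_powR_nat //; lra.
move: mu0 r2; set mu := 'C(n, 3)%:R * _ => mu0 r2.
have PZ := @paley_zygmund _ _ _ (p01 n) (vpairs n) (fun G => #|triangles G|%:R) (0 : R) (lexx _).
have := PZ; rewrite Ex_triangles -/mu subr0 => /(_ mu0) {}PZ.
have {PZ} := PZ (fun G => ler0n _ _).
rewrite (_ : Pr _ _ (fun G => 0 < _) = PrG p (fun G : {set {set 'I_n}} => (0 < #|triangles G|)%N)); last first.
  by apply: eq_Pr => G _; rewrite ltr0n.
have := Ex_triangles2 n (p01 n); rewrite -/mu.
set E2 := Ex _ _ _; set P := PrG _ _ => h1 h2.
have P0 : 0 <= P by exact: Pr_ge0.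
rewrite ler_pdivrMr // in r2.
have : mu ^+ 2 <= mu ^+ 2 * 97 * P.
  apply: (le_trans h2); rewrite ler_wpM2r //; apply: (le_trans h1); nra.
rewrite -mulrA -{1}[mu ^+ 2]mulr1 ler_pM2l ?exprn_gt0 // => h.
by rewrite -[_^-1]mul1r ler_pdivrMr // mulrC.
Qed.

End TriangleThreshold.

(** * The law for alpha < 1 *)

Lemma patternC (V : finType) (adj : rel V) x y a b :
  pattern adj x y a b = pattern adj y x b a.
Proof.
by apply: eq_existsb => z; case: (z != x); case: (z != y); rewrite //= andbC.
Qed.

Definition rich n (G : {set {set 'I_n}}) :=
  [&& (1 < n)%N, has_pattern true false G & has_pattern false false G].

Lemma exists_other n (x : 'I_n) : (1 < n)%N -> exists y : 'I_n, x != y.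
Proof.
move=> n1; have : (0 < #|[set~ x]|)%N by rewrite cardsC1 card_ord -subn1 subn_gt0.
by case/card_gt0P => y; rewrite !inE eq_sym; exists y.
Qed.

Section Rich.
Variables (n : nat) (G : {set {set 'I_n}}).
Hypotheses (GV : G \subset vpairs n) (rG : rich G).
Let adj := adj_of G.

Lemma rich_pattern x y a b : x != y -> ~~ (a && b) -> pattern adj x y a b.
Proof.
move=> xy; have [_ /forallP h10 /forallP h00] := and3P rG.
have yx : y != x by rewrite eq_sym.
case: a b => [] [] // _; last by have /forallP/(_ y)/implyP := h00 x; apply.
  by have /forallP/(_ y)/implyP := h10 x; apply.
by rewrite patternC; have /forallP/(_ x)/implyP := h10 y; apply.
Qed.

(** This serves the plays in which the second move repeats the first vertex. *)
Lemma rich_diag x a b : pattern adj x x a b = (a == b).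
Proof.
have [n1 _ _] := and3P rG; have [y xy] := exists_other x n1.
apply/existsP/eqP => [[z /and4P[_ _ /eqP <- /eqP <-]]//|<-].
have /existsP[z /and4P[zx zy /eqP zxa _]] : pattern adj x y a false.
  by apply: rich_pattern; rewrite ?andbF.
by exists z; rewrite zx zxa eqxx.
Qed.

(** Take a neighbour [u] of [x], and a neighbour [y] of [u] that is not adjacent to [x]. *)
Lemma rich_dist2 x : has_nbr_type adj x false true.
Proof.
have [n1 _ _] := and3P rG; have [w xw] := exists_other x n1.
have /existsP[u /and4P[ux uw /eqP uxa _]] : pattern adj x w true false by apply: rich_pattern.
have /existsP[y /and4P[yu yx /eqP yua /eqP yxa]] : pattern adj u x true false by apply: rich_pattern.
apply/existsP; exists y; rewrite yx /adj adj_of_sym -/adj yxa eqxx /=.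
by apply/eqP/existsP; exists u; rewrite ux (eq_sym u) yu uxa /adj adj_of_sym -/adj yua.
Qed.

Lemma rich_nbr x a : exists2 y, y != x & adj x y = a.
Proof.
have [n1 _ _] := and3P rG; have [w xw] := exists_other x n1.
have /existsP[u /and4P[ux uw /eqP uxa _]] : pattern adj x w a false.
  by apply: rich_pattern; rewrite ?andbF.
by exists u; rewrite // /adj adj_of_sym.
Qed.

End Rich.

(** In a rich graph two distinct vertices realize every pattern except perhaps a common neighbour. A
    pair is therefore described by two bits, and a vertex by the combinations that occur at it,
    which is what [has_nbr_type] lists. *)
Lemma rich_sim2 n (G : {set {set 'I_n}}) n' (G' : {set {set 'I_n'}}) x x' :
  G \subset vpairs n -> G' \subset vpairs n' -> rich G -> rich G' ->
  (forall a c, has_nbr_type (adj_of G) x a c = has_nbr_type (adj_of G') x' a c) ->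
  sim2 (adj_of G) (adj_of G') x x'.
Proof.
have main k (H : {set {set 'I_k}}) k' (H' : {set {set 'I_k'}}) z z' :
  H \subset vpairs k -> H' \subset vpairs k' -> rich H -> rich H' ->
  (forall a c, has_nbr_type (adj_of H) z a c = has_nbr_type (adj_of H') z' a c) ->
  forall y, exists y', sim1 (adj_of H) (adj_of H') z y z' y'.
  move=> HV HV' rH rH' E y; have [<-|zy] := eqVneq z y.
    by exists z'; split=> [||a b]; rewrite ?eqxx ?adj_of_irr // !rich_diag.
  have : has_nbr_type (adj_of H) z (adj_of H z y) (pattern (adj_of H) z y true true).
    by apply/existsP; exists y; rewrite eq_sym zy !eqxx.
  rewrite E => /existsP[y' /and3P[y'z /eqP a /eqP c]].
  exists y'; split; [by rewrite (negbTE zy) eq_sym (negbTE y'z)|by rewrite a|].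
  move=> a' b'; case: (boolP (a' && b')) => [/andP[-> ->]//|nab].
  by rewrite !rich_pattern // eq_sym.
move=> GV GV' rG rG' E; split; first exact: main.
move=> y'; have [y s] := main _ _ _ _ x' x GV' GV rG' rG (fun a c => esym (E a c)) y'.
by exists y; exact: sim1_sym.
Qed.

Section DenseLaw.
Variables (R : realType) (alpha : R).
Hypothesis alpha_gt0 : 0 < alpha.
Hypothesis alpha_lt1 : alpha < 1.
Let p (n : nat) : R := n%:R `^ (- alpha).
Let p01 n : 0 <= p n <= 1 := pw01 n alpha_gt0.

Lemma whp_rich : whp p rich.
Proof.
apply: whp_and => //.
  apply: whp_mono (whp_true p) => //; near=> n => G _ _; near: n; exact: nbhs_infty_gt.
by apply: whp_and => //; apply: whp_pattern => //=; rewrite ?mulr1 // mulr0 ltr01.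
Unshelve. all: by end_near. Qed.

Lemma zero_one_lt_half : alpha < 1 / 2 -> zero_one_law p 3.
Proof.
move=> a2; apply: (zero_one_of_whp p01 (A := fun n G => rich G && has_pattern true true G)).
  apply: whp_and => //; first exact: whp_rich.
  by apply: whp_pattern => //=; lra.
move=> n G n' G' GV GV' /andP[rG hG] /andP[rG' hG'] x.
(* All vertices have the same type here, so vertex [0] serves as the counterpart. *)
have [n1' _ _] := and3P rG'; exists (Ordinal (ltnW n1')).
have E k (H : {set {set 'I_k}}) z a c : H \subset vpairs k -> rich H -> has_pattern true true H ->
    has_nbr_type (adj_of H) z a c = c.
  move=> HV rH hH; apply/existsP/idP => [[y /and3P[yz _ /eqP <-]]|->].
    by have /forallP/(_ y)/implyP := (forallP hH) z; apply; rewrite eq_sym.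
  have [y yz ya] := rich_nbr rH z a; exists y; rewrite yz ya eqxx /=; apply/eqP.
  by have /forallP/(_ y)/implyP := (forallP hH) z; apply; rewrite eq_sym.
by apply: rich_sim2 => // a c; rewrite !E.
Qed.

Definition common_free n (G : {set {set 'I_n}}) :=
  ~~ [exists v, dominating v (nbrs G v) G] && ~~ [exists v, no_isolated v (nbrs G v) G].

Lemma common_free_type n (G : {set {set 'I_n}}) x a :
  G \subset vpairs n -> common_free G -> has_nbr_type (adj_of G) x a false.
Proof.
move=> GV /andP[]; rewrite !negb_exists => /forallP/(_ x) h1 /forallP/(_ x) h2.
have no z : [forall y, (y \in nbrs G x) ==> ~~ adj_of G z y] ->
    pattern (adj_of G) x z true true = false.
  move=> /forall_inP h; apply/negbTE/negP => /existsP[w /and4P[_ _ /eqP wx /eqP wz]].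
  by have := h w; rewrite inE (adj_of_sym G x) wx (adj_of_sym G z) wz => /(_ isT).
case: a.
  move: h2; rewrite negb_forall => /existsP[z]; rewrite negb_imply negb_exists.
  move=> /andP[xz /forallP h]; apply/existsP; exists z.
  move: (xz); rewrite inE => ->; rewrite no ?eqxx ?andbT.
    by apply: contraTneq xz => ->; rewrite nbrs_irr.
  by apply/forallP => y; move: (h y); rewrite negb_and implybE.
move: h1; rewrite negb_forall => /existsP[z]; rewrite negb_imply negb_exists.
move=> /andP[xz /forallP h]; apply/existsP; exists z.
move: xz; rewrite !inE negb_or => /andP[-> /negbTE ->]; rewrite no ?eqxx //.
by apply/forallP => y; move: (h y); rewrite negb_and implybE.
Qed.

Lemma zero_one_ge_half : 1 / 2 <= alpha -> zero_one_law p 3.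
Proof.
move=> a2.
pose tri n (G : {set {set 'I_n}}) := if alpha < 2 / 3 then ~~ [exists v, independent v (nbrs G v) G]
  else [exists x, has_nbr_type (adj_of G) x true true] &&
       [exists x, ~~ has_nbr_type (adj_of G) x true true].
have wtri : whp p tri.
  rewrite /tri; case: (boolP (alpha < 2 / 3)) => [a23|]; rewrite -?leNgt.
    by apply: whpN => //; exact: negl_independent.
  move=> a23; apply: whp_mono (whp_triangles alpha_gt0 alpha_lt1) => //.
  near=> n => G GV /andP[/card_gt0P[A]].
  have n0 : (0 < n)%N by near: n; exact: nbhs_infty_gt.
  rewrite inE => /andP[/eqP A3 AG] h; apply/andP; split.
    have /card_gt0P[v vA] : (0 < #|A|)%N by rewrite A3.
    by apply/existsP; exists v; exact: in_triangle AG A3 vA.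
  (* If every vertex is in a triangle then [n <= 3 X], while [X < 2 E X <= n / 3]. *)
  rewrite -negb_forall; apply/negP => /forallP all3.
  have : (n <= 3 * #|triangles G|)%N.
    rewrite -{1}[n]card_ord -cardsT.
    apply: (@leq_trans #|cover (triangles G)|).
      apply/subset_leq_card/subsetP => v _.
      have [B [BG B3 vB]] := in_triangleP GV (all3 v).
      by apply/bigcupP; exists B; rewrite // inE B3 BG.
    apply: leq_trans (leq_card_cover _) _.
    rewrite (eq_bigr (fun=> 3)) => [|B]; last by rewrite inE => /andP[/eqP].
    by rewrite sum_nat_const mulnC.
  rewrite -(ler_nat R) natrM.
  (* Here [2 / 3 <= alpha] enters, as (n p)^3 = n^(3 - 3 alpha) <= n. At [alpha = 2 / 3] the
     contradiction still holds because the bound on the number of triangles is strict. *)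
  have e : 3 * (2 * ('C(n, 3)%:R * p n ^+ 3)) <= n%:R :> R.
    apply: (@le_trans _ _ (n%:R ^+ 3 * p n ^+ 3)).
      have b := bin3_le R n; have : 0 <= p n ^+ 3 by rewrite exprn_ge0 ?powR_ge0.
      move: b; set Q := p n ^+ 3; nra.
    rewrite -exprMn np_powR // powR_natX -[leRHS]powRr1 // ler_powR_nat //.
    lra.
  rewrite -/(p n) in h; move: h e; move: ('C(n, 3)%:R * p n ^+ 3) => c; lra.
apply: (zero_one_of_whp p01 (A := fun n G => [&& rich G, common_free G & tri n G])).
  apply: whp_and => //; first exact: whp_rich.
  apply: whp_and => //; apply: whp_and => //.
    by apply: whpN => //; exact: negl_dominating.
  by apply: whpN => //; exact: negl_no_isolated.
move=> n G n' G' GV GV' /and3P[rG cG AG] /and3P[rG' cG' AG'] x.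
(* Three of the four combinations occur at every vertex, by [common_free_type] and [rich_dist2];
   only membership in a triangle can vary. *)
suff [x' E] : exists x', has_nbr_type (adj_of G) x true true = has_nbr_type (adj_of G') x' true true.
  exists x'; apply: rich_sim2 => // -[] [] //; rewrite ?common_free_type //.
  by rewrite !rich_dist2.
move: AG AG'; rewrite /tri; case: (alpha < 2 / 3).
  have T k (H : {set {set 'I_k}}) z : H \subset vpairs k ->
      ~~ [exists v, independent v (nbrs H v) H] -> has_nbr_type (adj_of H) z true true.
    move=> HV; rewrite negb_exists => /forallP/(_ z); rewrite negb_forall => /existsP[y].
    rewrite negb_imply negb_forall => /andP[zy /existsP[w]]; rewrite negb_imply negbK => /andP[zw yw].
    apply/existsP; exists y; rewrite (neq_notin (nbrs_irr z HV) zy).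
    move: (zy); rewrite inE => -> /=; apply/eqP/existsP; exists w.
    rewrite (neq_notin (nbrs_irr z HV) zw) (adj_of_sym H w y) yw.
    move: zw; rewrite inE adj_of_sym => ->; rewrite eqxx !andbT.
    by apply: contraTneq yw => ->; rewrite adj_of_irr.
  move=> AG AG'; have [n1' _ _] := and3P rG'; exists (Ordinal (ltnW n1')).
  by rewrite !T.
move=> _ /andP[/existsP[y hy] /existsP[z hz]].
case: (has_nbr_type (adj_of G) x true true); [by exists y; rewrite hy|by exists z; rewrite (negbTE hz)].
Unshelve. all: by end_near. Qed.

Lemma zero_one_dense : zero_one_law p 3.
Proof. by case: (ltP alpha (1 / 2)) => h; [exact: zero_one_lt_half|exact: zero_one_ge_half]. Qed.

End DenseLaw.

(** * Copies of small graphs *)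

(** Small graphs are concrete lists of pairs i < j of vertices among 0, ..., k, which lets their
    signatures be computed. *)
Definition Hadj (H : seq (nat * nat)) i j := ((i, j) \in H) || ((j, i) \in H).

Definition wf_graph k (H : seq (nat * nat)) :=
  uniq H && all (fun ij => (ij.1 < ij.2) && (ij.2 < k.+1))%N H.

(* This only asks each vertex [i > 0] for a smaller neighbour, which implies
   that [H] is connected. *)
Definition connected_graph k (H : seq (nat * nat)) :=
  all (fun i => has (Hadj H i) (iota 0 i)) (iota 1 k).

Section Copies.
Variables (k : nat) (H : seq (nat * nat)).
Hypothesis wfH : wf_graph k H.

Definition edges n (phi : {ffun 'I_k.+1 -> 'I_n}) : {set {set 'I_n}} :=
  [set e in [seq [set phi (inord ij.1); phi (inord ij.2)] | ij <- H]].

Definition touch n (phi : {ffun 'I_k.+1 -> 'I_n}) : {set {set 'I_n}} :=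
  [set e in vpairs n | [exists i, phi i \in e]].

Definition subcopy n (G : {set {set 'I_n}}) (phi : {ffun 'I_k.+1 -> 'I_n}) :=
  injectiveb phi && (edges phi \subset G).

(* [phi] is an isomorphism from [H] onto a union of components of [G]. *)
Definition compcopy n (G : {set {set 'I_n}}) (phi : {ffun 'I_k.+1 -> 'I_n}) :=
  injectiveb phi && (G :&: touch phi == edges phi).

Lemma inord_inj i j : (i < k.+1)%N -> (j < k.+1)%N ->
  inord i = inord j :> 'I_k.+1 -> i = j.
Proof. by move=> ik jk E; rewrite -(inordK ik) E inordK. Qed.

Lemma wf_bound i j : (i, j) \in H -> [/\ (i < j)%N, (j < k.+1)%N & (i < k.+1)%N].
Proof.
move=> ijH; have /andP[_ /allP/(_ _ ijH)/andP[/= ij jk]] := wfH.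
by split=> //; exact: ltn_trans jk.
Qed.

Lemma card_edges n (phi : {ffun 'I_k.+1 -> 'I_n}) : injective phi -> #|edges phi| = size H.
Proof.
move=> inj; have /andP[uH _] := wfH.
rewrite cardsE -(size_map (fun ij => [set phi (inord ij.1); phi (inord ij.2)]) H).
apply/card_uniqP; rewrite map_inj_in_uniq // => -[i j] [i' j'] ijH ijH' /= E.
have [ij jk ik] := wf_bound ijH; have [ij' jk' ik'] := wf_bound ijH'.
have mem a b c d : [set phi (inord a); phi (inord b)] = [set phi (inord c); phi (inord d)] ->
   (a < k.+1)%N -> (c < k.+1)%N -> (d < k.+1)%N -> a = c \/ a = d.
  move=> F ak ck dk; have : phi (inord a) \in [set phi (inord c); phi (inord d)].
    by rewrite -F !inE eqxx.
  by rewrite !inE !(inj_eq inj) => /orP[] /eqP/inord_inj ->; auto.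
have := mem _ _ _ _ E ik ik' jk'; have := mem _ _ _ _ (esym E) ik' ik jk.
rewrite setUC in E; have := mem _ _ _ _ E jk ik' jk'.
by move=> h1 h2 h3; congr (_, _); lia.
Qed.

Lemma edges_touch n (phi : {ffun 'I_k.+1 -> 'I_n}) : injective phi -> edges phi \subset touch phi.
Proof.
move=> inj; apply/subsetP => e; rewrite !inE => /mapP[[i j] ijH ->] /=.
have [ij jk ik] := wf_bound ijH; apply/andP; split; last first.
  by apply/existsP; exists (inord i); rewrite !inE eqxx.
rewrite cards2 (inj_eq inj) (_ : _ != _) //.
by apply/eqP => /inord_inj E; move: ij; rewrite E ?ltnn.
Qed.

Lemma touch_vpairs n (phi : {ffun 'I_k.+1 -> 'I_n}) : touch phi \subset vpairs n.
Proof. by apply/subsetP => e; rewrite inE => /andP[]. Qed.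

Lemma edges_vpairs n (phi : {ffun 'I_k.+1 -> 'I_n}) : injective phi -> edges phi \subset vpairs n.
Proof. by move=> /edges_touch h; exact: subset_trans h (touch_vpairs _). Qed.

Lemma pair_of_mem n (e : {set 'I_n}) x y : e \in vpairs n -> x \in e -> y \in e -> x != y ->
  e = [set x; y].
Proof.
rewrite inE => /eqP e2 xe ye xy; apply/esym/eqP; rewrite eqEcard subUset !sub1set xe ye e2.
by rewrite cards2 xy.
Qed.

Lemma card_touch_le n (phi : {ffun 'I_k.+1 -> 'I_n}) : (#|touch phi| <= k.+1 * n)%N.
Proof.
apply: (@leq_trans #|[set [set phi iy.1; iy.2] | iy in [set: 'I_k.+1 * 'I_n]]|); last first.
  by apply: leq_trans (leq_imset_card _ _) _; rewrite cardsT card_prod !card_ord.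
apply/subset_leq_card/subsetP => e; rewrite inE => /andP[ev /existsP[i ie]].
have : (0 < #|e :\ phi i|)%N.
  by move: ev; rewrite inE (cardsD1 (phi i)) ie add1n eqSS => /eqP ->.
case/card_gt0P => y; rewrite !inE => /andP[yi ye].
apply/imsetP; exists (i, y); rewrite ?inE //=.
by apply: pair_of_mem; rewrite // eq_sym.
Qed.

Lemma card_touchI_le n (phi psi : {ffun 'I_k.+1 -> 'I_n}) : (forall i j, phi i != psi j) ->
  (#|touch phi :&: touch psi| <= k.+1 ^ 2)%N.
Proof.
move=> dis.
apply: (@leq_trans #|[set [set phi ij.1; psi ij.2] | ij in [set: 'I_k.+1 * 'I_k.+1]]|); last first.
  by apply: leq_trans (leq_imset_card _ _) _; rewrite cardsT card_prod !card_ord expnS expn1.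
apply/subset_leq_card/subsetP => e; rewrite !inE => /andP[/andP[ev /existsP[i ie]] /andP[_ /existsP[j je]]].
by apply/imsetP; exists (i, j); rewrite ?inE //=; apply: pair_of_mem; rewrite ?inE.
Qed.

Lemma card_injections n : (2 * k.+1 <= n)%N ->
  ((n./2) ^ k.+1 <= #|[pred phi : {ffun 'I_k.+1 -> 'I_n} | injectiveb phi]|)%N.
Proof.
move=> kn; have := card_inj_ffuns 'I_k.+1 'I_n; rewrite cardsE => ->; rewrite !card_ord.
have : (k.+1 <= k.+1)%N by []; elim: {1 3 4}k.+1 => [|i IH] ik; first by rewrite expn0 ffactn0.
rewrite expnSr ffactnSr leq_mul ?IH //; first exact: ltnW.
rewrite leq_subRL; last by lia.
by have := odd_double_half n; lia.
Qed.

Section Prob.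
Variables (R : realType) (n : nat) (p : R).
Hypothesis p01 : 0 <= p <= 1.
Notation P := (Pr p (vpairs n)).

Lemma Pr_subcopy_le :
  P (fun G => [exists phi, subcopy G phi]) <= n%:R ^+ k.+1 * p ^+ size H.
Proof.
have [p0 p1] := andP p01.
apply: le_trans (@Pr_exists _ _ _ p01 _ _ predT _) _.
apply: (@le_trans _ _ (\sum_(phi : {ffun 'I_k.+1 -> 'I_n}) p ^+ size H)).
  apply: ler_sum => phi _; case: (boolP (injectiveb phi)) => [/injectiveP inj|ninj].
    rewrite -(card_edges inj) -(Pr_sub p (edges_vpairs inj)).
    by apply: le_Pr => // G _ /andP[].
  rewrite (_ : P _ = 0) ?exprn_ge0 // -[RHS](Ex_const p (vpairs n)); exact: eq_Ex.
by rewrite sumr_const card_ffun !card_ord -natrX mulr_natl.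
Qed.

(** Overlapping placements are dependent, but Harris' inequality bounds the probability below by
    that of independent ones, of which there are at most [n ^ k.+1]. *)
Lemma Pr_nosubcopy_ge :
  (1 - p ^+ size H) ^+ (n ^ k.+1) <= P (fun G => ~~ [exists phi, subcopy G phi]).
Proof.
have [p0 p1] := andP p01.
(* [harris_none] asks for [F y \subset D] at every index, hence the value [set0] at maps that are
   not injective; [Y] leaves them out of the product. *)
pose F (phi : {ffun 'I_k.+1 -> 'I_n}) := if injectiveb phi then edges phi else set0.
pose Y := [set phi : {ffun 'I_k.+1 -> 'I_n} | injectiveb phi].
have FD phi : F phi \subset vpairs n.
  by rewrite /F; case: injectiveP => [/edges_vpairs//|_]; rewrite sub0set.
apply: (@le_trans _ _ (\prod_(phi in Y) (1 - p ^+ #|F phi|))); last first.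
  apply: le_trans (harris_none p01 Y FD) _; apply: le_Pr => // G _ /forall_inP h.
  rewrite negb_exists; apply/forallP => phi; rewrite /subcopy.
  case inj: (injectiveb phi) => //=.
  by have := h phi; rewrite inE /F inj; apply.
rewrite (eq_bigr (fun=> 1 - p ^+ size H)); last first.
  by move=> phi; rewrite inE /F => inj; rewrite inj card_edges //; exact/injectiveP.
rewrite prodr_const; apply: ler_wiXn2l.
- by rewrite subr_ge0 exprn_ile1.
- by rewrite gerBl exprn_ge0.
- by apply: leq_trans (max_card _) _; rewrite card_ffun !card_ord.
Qed.

Definition copies (G : {set {set 'I_n}}) := [set phi | compcopy G phi].

Let X (G : {set {set 'I_n}}) : R := #|copies G|%:R.

Lemma card_copies (G : {set {set 'I_n}}) :
  X G = \sum_(phi : {ffun 'I_k.+1 -> 'I_n} | injectiveb phi) (G :&: touch phi == edges phi)%:R.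
Proof.
rewrite /X -sum1_card natr_sum big_mkcond [RHS]big_mkcond /=; apply: eq_bigr => phi _.
by rewrite inE /compcopy; case: injectiveb => //=; case: (_ == _).
Qed.

Definition pcopy (phi : {ffun 'I_k.+1 -> 'I_n}) : R :=
  p ^+ size H * (1 - p) ^+ (#|touch phi| - size H).

Lemma Pr_compcopy (phi : {ffun 'I_k.+1 -> 'I_n}) : injective phi -> P (fun G => G :&: touch phi == edges phi) = pcopy phi.
Proof.
move=> inj; rewrite Pr_trace ?touch_vpairs ?edges_touch // card_edges //.
by rewrite cardsD (setIidPr (edges_touch inj)) card_edges.
Qed.

Lemma Ex_copies : Ex p (vpairs n) X = \sum_(phi : {ffun 'I_k.+1 -> 'I_n} | injectiveb phi) pcopy phi.
Proof.
rewrite (@eq_Ex _ _ p _ _ _ (fun G _ => card_copies G)) Ex_sum; apply: eq_bigr => phi /injectiveP inj.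
exact: Pr_compcopy.
Qed.

Lemma Ex_copies_ge : (2 * k.+1 <= n)%N ->
  (n./2)%:R ^+ k.+1 * (p ^+ size H * (1 - p) ^+ (k.+1 * n)) <= Ex p (vpairs n) X.
Proof.
have [p0 p1] := andP p01; have q0 : 0 <= 1 - p by rewrite subr_ge0.
move=> kn; rewrite Ex_copies.
apply: (@le_trans _ _ (\sum_(phi : {ffun 'I_k.+1 -> 'I_n} | injectiveb phi)
   (p ^+ size H * (1 - p) ^+ (k.+1 * n)))).
  rewrite sumr_const -[leRHS]mulr_natl ler_wpM2r ?mulr_ge0 ?exprn_ge0 // -natrX ler_nat.
  exact: card_injections.
apply: ler_sum => phi _; rewrite ler_wpM2l ?exprn_ge0 //; apply: ler_wiXn2l => //.
  by rewrite gerBl.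
exact: leq_trans (leq_subr _ _) (card_touch_le _).
Qed.

Hypothesis conH : connected_graph k H.

Lemma compcopy_closed (G : {set {set 'I_n}}) (phi : {ffun 'I_k.+1 -> 'I_n}) i y :
  G \subset vpairs n -> G :&: touch phi = edges phi -> adj_of G (phi i) y ->
  exists j, y = phi j.
Proof.
move=> GV E iy; have : [set phi i; y] \in edges phi.
  rewrite -E inE [_ \in G]iy inE (subsetP GV) //=.
  by apply/existsP; exists i; rewrite !inE eqxx.
rewrite inE => /mapP[[a b] _ /= F]; have : y \in [set phi i; y] by rewrite !inE eqxx orbT.
by rewrite F !inE => /orP[] /eqP ->; [exists (inord a)|exists (inord b)].
Qed.

(** No edge leaves the image of [phi], so membership in it spreads along the edges of [psi]. Every
    index is linked to [0] through ever smaller neighbours: go down from [j] to [0], then up to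
    [j']. *)
Lemma compcopy_overlap (G : {set {set 'I_n}}) (phi psi : {ffun 'I_k.+1 -> 'I_n}) i j :
  G \subset vpairs n -> G :&: touch phi = edges phi -> G :&: touch psi = edges psi ->
  phi i = psi j -> forall j', psi j' \in [set phi a | a in 'I_k.+1].
Proof.
move=> GV Ephi Epsi eij; set S := [set phi a | a in 'I_k.+1].
have psi_adj a b : Hadj H a b -> adj_of G (psi (inord a)) (psi (inord b)).
  move=> ab; suff : [set psi (inord a); psi (inord b)] \in edges psi.
    by rewrite -Epsi inE => /andP[].
  by rewrite inE; case/orP: ab => ab; apply/mapP; [exists (a, b)|exists (b, a); rewrite 1?setUC].
have step a b : Hadj H a b -> psi (inord a) \in S -> psi (inord b) \in S.
  move=> /psi_adj ab /imsetP[c _ ac]; rewrite ac in ab.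
  by have [d ->] := compcopy_closed GV Ephi ab; apply/imsetP; exists d.
have HadjC a b : Hadj H a b = Hadj H b a by rewrite /Hadj orbC.
have parent a : (0 < a <= k)%N -> exists2 b, (b < a)%N & Hadj H a b.
  move=> ak; have /allP/(_ a) := conH; rewrite mem_iota add1n ltnS ak => /(_ isT)/hasP[b].
  by rewrite mem_iota add0n => ba ab; exists b.
have down a : (a <= k)%N -> psi (inord a) \in S -> psi (inord 0) \in S.
  have [N] := ubnP a; elim: N a => // N IH a; rewrite ltnS => aN ak aS.
  have [a0|a0] := eqVneq a 0%N; first by rewrite -a0.
  have [|b ba ab] := parent a; first by rewrite lt0n a0.
  apply: (IH b); [exact: leq_trans ba aN|exact: leq_trans (ltnW ba) ak|exact: step ab aS].
have up a : (a <= k)%N -> psi (inord 0) \in S -> psi (inord a) \in S.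
  have [N] := ubnP a; elim: N a => // N IH a; rewrite ltnS => aN ak zS.
  have [->//|a0] := eqVneq a 0%N.
  have [|b ba ab] := parent a; first by rewrite lt0n a0.
  apply: (step b); first by rewrite HadjC.
  apply: IH => //; [exact: leq_trans ba aN|exact: leq_trans (ltnW ba) ak].
move=> j'; rewrite -(inord_val j'); apply: up; first by rewrite -ltnS ltn_ord.
apply: (down j); first by rewrite -ltnS ltn_ord.
by rewrite inord_val -eij; apply/imsetP; exists i.
Qed.

(* Component copies of a connected graph that meet have the same vertices, and
   disjoint ones are independent up to the [k.+1 ^ 2] pairs between them. *)
Lemma Pr_pair (phi psi : {ffun 'I_k.+1 -> 'I_n}) : injective phi -> injective psi ->
  (1 - p) ^+ (k.+1 ^ 2) *
    P (fun G => (G :&: touch phi == edges phi) && (G :&: touch psi == edges psi)) <=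
  pcopy phi * pcopy psi + (psi \in ffun_on (mem [set phi a | a in 'I_k.+1]))%:R * pcopy phi.
Proof.
move=> iphi ipsi; have [p0 p1] := andP p01; have q0 : 0 <= 1 - p by rewrite subr_ge0.
have pc0 f : 0 <= pcopy f by rewrite mulr_ge0 ?exprn_ge0.
have [/existsP[i /existsP[j /eqP eij]]|] := boolP [exists i, [exists j, phi i == psi j]].
  case: (boolP (psi \in _)) => [_|ns].
    apply: (@le_trans _ _ (P (fun G => G :&: touch phi == edges phi))); last first.
      by rewrite Pr_compcopy // mul1r lerDr mulr_ge0.
    rewrite -[leRHS]mul1r; apply: ler_pM; rewrite ?exprn_ge0 ?Pr_ge0 //.
      by rewrite exprn_ile1 // gerBl.
    by apply: le_Pr => // G _ /andP[].
  rewrite mul0r addr0 (_ : P _ = 0); first by rewrite mulr0; exact: mulr_ge0.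
  rewrite -[RHS](Ex_const p (vpairs n)); apply: eq_Ex => G GV.
  case: andP => // -[/eqP E1 /eqP E2]; case/negP: ns.
  by apply/ffun_onP => j'; exact: compcopy_overlap GV E1 E2 eij j'.
rewrite negb_exists => /forallP dis.
have {}dis i j : phi i != psi j by have := dis i; rewrite negb_exists => /forallP/(_ j).
rewrite -[leLHS]addr0 lerD //; last by rewrite mulr_ge0.
have De : [disjoint edges phi & edges psi].
  rewrite -setI_eq0; apply/eqP/setP => e; rewrite !inE; apply/negbTE/negP.
  move=> /andP[/mapP[[a b] _ ->] /mapP[[c d] _ /= E]].
  have : phi (inord a) \in [set psi (inord c); psi (inord d)] by rewrite -E !inE eqxx.
  by rewrite !inE !(negbTE (dis _ _)).
have cF : #|edges phi :|: edges psi| = (size H + size H)%N.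
  by rewrite cardsU (eqP (_ : _ :&: _ == set0)) ?setI_eq0 // cards0 subn0 !card_edges.
have FD : edges phi :|: edges psi \subset touch phi :|: touch psi.
  by rewrite setUSS ?edges_touch.
have le1 : P (fun G => (G :&: touch phi == edges phi) && (G :&: touch psi == edges psi)) <=
   p ^+ (size H + size H) * (1 - p) ^+ (#|touch phi :|: touch psi| - (size H + size H)).
  have -> : p ^+ (size H + size H) * (1 - p) ^+ (#|touch phi :|: touch psi| - (size H + size H)) =
     P (fun G => G :&: (touch phi :|: touch psi) == edges phi :|: edges psi).
    by rewrite Pr_trace // ?subUset ?touch_vpairs // cF cardsD (setIidPr FD) cF.
  by apply: le_Pr => // G _ /andP[/eqP E1 /eqP E2]; rewrite setIUr E1 E2.
apply: (le_trans (ler_wpM2l (exprn_ge0 _ q0) le1)).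
(* Only the exponents of [1 - p] are left to compare. The two separate exponents count twice the
   pairs touching both images, and the extra [k.+1 ^ 2] covers them. *)
rewrite /pcopy mulrACA -!exprD mulrCA ler_wpM2l ?exprn_ge0 // -exprD.
apply: ler_wiXn2l => //; first by rewrite gerBl.
have h := card_touchI_le dis.
have h1 := subset_leq_card (edges_touch iphi); have h2 := subset_leq_card (edges_touch ipsi).
rewrite !card_edges // in h1 h2; rewrite cardsU.
have h3 := subset_leq_card (subsetIl (touch phi) (touch psi)).
move: h h1 h2 h3; clear.
move: #|touch phi| #|touch psi| #|touch phi :&: touch psi| (size H) (k.+1 ^ 2)%N; lia.
Qed.

(** The component copies meeting a given one take their values in its image, so there are at most
    [k.+1 ^ k.+1] of them; they make up the linear term. *)
Lemma Ex_copies2 :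
  (1 - p) ^+ (k.+1 ^ 2) * Ex p (vpairs n) (fun G => X G ^+ 2) <=
  Ex p (vpairs n) X ^+ 2 + (k.+1 ^ k.+1)%:R * Ex p (vpairs n) X.
Proof.
have [p0 p1] := andP p01; have q0 : 0 <= 1 - p by rewrite subr_ge0.
have pc0 f : 0 <= pcopy f by rewrite mulr_ge0 ?exprn_ge0.
rewrite (@eq_Ex _ _ p _ _ (fun G => \sum_(phi : {ffun 'I_k.+1 -> 'I_n} | injectiveb phi) \sum_(psi : {ffun 'I_k.+1 -> 'I_n} | injectiveb psi)
    ((G :&: touch phi == edges phi) && (G :&: touch psi == edges psi))%:R)); last first.
  move=> G _; rewrite card_copies expr2 big_distrlr /=.
  by apply: eq_bigr => a _; apply: eq_bigr => b _; rewrite -natrM mulnb.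
rewrite Ex_sum Ex_copies mulr_sumr expr2 big_distrlr /= [in leRHS]mulr_sumr -big_split /=.
apply: ler_sum => phi /injectiveP iphi; rewrite Ex_sum mulr_sumr.
apply: (@le_trans _ _ (\sum_(psi : {ffun 'I_k.+1 -> 'I_n} | injectiveb psi) (pcopy phi * pcopy psi +
    (psi \in ffun_on (mem [set phi a | a in 'I_k.+1]))%:R * pcopy phi))).
  by apply: ler_sum => psi /injectiveP ipsi; exact: Pr_pair.
rewrite big_split /= lerD2l -mulr_suml ler_wpM2r // -natr_sum ler_nat.
apply: (@leq_trans #|ffun_on (mem [set phi a | a in 'I_k.+1])|).
  rewrite -sum1_card big_mkcond [leqRHS]big_mkcond /=.
  by apply: leq_sum => psi _; case: injectiveb; case: (_ \in _).
rewrite card_ffun_on card_ord leq_exp2r // (leq_trans (leq_imset_card _ _)) //.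
by rewrite card_ord.
Qed.

Lemma Pr_copies_ge (t : R) : 0 <= t -> t < Ex p (vpairs n) X ->
  (1 - p) ^+ (k.+1 ^ 2) * (Ex p (vpairs n) X - t) ^+ 2 <=
  (Ex p (vpairs n) X ^+ 2 + (k.+1 ^ k.+1)%:R * Ex p (vpairs n) X) * P (fun G => t < X G).
Proof.
move=> t0 tX; have [p0 p1] := andP p01; have q0 : 0 <= 1 - p by rewrite subr_ge0.
have := paley_zygmund p01 t0 tX (fun G => ler0n _ _) => PZ.
apply: le_trans (ler_wpM2l (exprn_ge0 _ q0) PZ) _.
by rewrite mulrA ler_wpM2r ?Pr_ge0 // Ex_copies2.
Qed.

End Prob.
End Copies.

Section CopyThresholds.
Variables (R : realType) (alpha : R) (k : nat) (H : seq (nat * nat)).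
Hypothesis wfH : wf_graph k H.
Hypothesis alpha_gt0 : 0 < alpha.
Let p (n : nat) : R := n%:R `^ (- alpha).
Let p01 n : 0 <= p n <= 1 := pw01 n alpha_gt0.

Lemma first_moment_powR n : (0 < n)%N ->
  n%:R ^+ k.+1 * p n ^+ size H = n%:R `^ (k.+1%:R - alpha * (size H)%:R).
Proof.
by move=> n0; rewrite /p powR_natX -powR_mulrn // powR_natN0 // mulNr.
Qed.

Lemma negl_subcopy : k.+1%:R < alpha * (size H)%:R ->
  negl p (fun n G => [exists phi, subcopy (k := k) H G phi]).
Proof.
move=> h; pose d := alpha * (size H)%:R - k.+1%:R.
apply: (@negl_le _ _ p01 _ (fun n => n%:R `^ (- d))); last first.
  by apply: cvg_powRN; rewrite subr_gt0.
near=> n; have n0 : (0 < n)%N by near: n; exact: nbhs_infty_gt.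
by rewrite /d opprB -first_moment_powR //; exact: Pr_subcopy_le.
Unshelve. all: by end_near. Qed.

(** On this line n^(k+1) q = 1 with [q] the probability of one placement, and (1 - q)^(1/q) is at
    least exp(-2) once [q <= 1 / 2]. *)
Lemma nosubcopy_pos : alpha * (size H)%:R = k.+1%:R ->
  \forall n \near \oo, expR (-2) <= PrG p (fun G : {set {set 'I_n}} => ~~ [exists phi, subcopy (k := k) H G phi]).
Proof.
move=> h; near=> n; have n2 : (2 <= n)%N by near: n; exact: nbhs_infty_ge.
have n0 : (0 < n)%N by apply: ltnW.
apply: le_trans (Pr_nosubcopy_ge wfH n (p01 n)).
have E : n%:R ^+ k.+1 * p n ^+ size H = 1 by rewrite first_moment_powR // h subrr powRr0.
have N1 : 2 <= n%:R ^+ k.+1 :> R.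
  rewrite -natrX ler_nat; apply: leq_trans n2 _; rewrite -{1}[n]expn1 leq_pexp2l //.
have q0 : 0 <= p n ^+ size H by rewrite exprn_ge0 ?powR_ge0.
have q2 : p n ^+ size H <= 1 / 2 by nra.
apply: le_trans (expr_onem_ge_expR _ q0 q2); rewrite ler_expR natrX.
by move: E; set a := n%:R ^+ _; set b := _ ^+ _; lra.
Unshelve. all: by end_near. Qed.

Hypothesis conH : connected_graph k H.
Hypothesis alpha_ge1 : 1 <= alpha.

(** The [4] comes from [n./2 >= n / 4]. The exponential is the price for having no further edge at
    the copy, bounded because n p <= 1 for [1 <= alpha]. *)
Lemma Ex_copies_powR : \forall n \near \oo,
  4 ^- k.+1 * expR (- (2 * k.+1%:R)) * n%:R `^ (k.+1%:R - alpha * (size H)%:R) <=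
  Ex (p n) (vpairs n) (fun G => #|copies k H G|%:R).
Proof.
near=> n.
have n2 : (2 * k.+1 <= n)%N by near: n; exact: nbhs_infty_ge.
have p2 : p n <= 1 / 2 by near: n; apply: near_pw_le => //; lra.
have n0 : (0 < n)%N by apply: leq_trans n2.
have [p0 p1] := andP (p01 n).
apply: le_trans (Ex_copies_ge wfH (p01 n) n2).
rewrite -first_moment_powR //.
have h1 : (n%:R / 4) ^+ k.+1 <= (n./2)%:R ^+ k.+1 :> R.
  apply: lerXn2r; rewrite ?nnegrE ?divr_ge0 // ler_pdivrMr // -natrM ler_nat.
  have : (2 <= n)%N by apply: leq_trans n2; rewrite leq_pmulr.
  by have := odd_double_half n; clear; lia.
have h2 : expR (- (2 * k.+1%:R)) <= (1 - p n) ^+ (k.+1 * n).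
  apply: le_trans (expr_onem_ge_expR _ p0 p2); rewrite ler_expR lerN2 natrM.
  have np1 : n%:R * p n <= 1.
    rewrite np_powR // -[leRHS](powRr0 n%:R) ler_powR_nat //; have := alpha_ge1; lra.
  have : 0 <= k.+1%:R :> R by [].
  move: np1; set K := k.+1%:R; set N := n%:R; nra.
have -> : 4 ^- k.+1 * expR (- (2 * k.+1%:R)) * (n%:R ^+ k.+1 * p n ^+ size H) =
  (n%:R / 4) ^+ k.+1 * (p n ^+ size H * expR (- (2 * k.+1%:R))).
  by rewrite exprMn exprVn; ring.
apply: ler_pM => //; first by rewrite mulr_ge0 ?expR_ge0 ?exprn_ge0.
by rewrite ler_wpM2l ?exprn_ge0.
Unshelve. all: by end_near. Qed.

Lemma Pr_few_copies n (t : R) : let a := Ex (p n) (vpairs n) (fun G => #|copies k H G|%:R) in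
  0 <= t -> t < a ->
  PrG p (fun G : {set {set 'I_n}} => ~~ (t < #|copies k H G|%:R)) <=
  (2 * t + (k.+1 ^ k.+1)%:R) / a + (k.+1 ^ 2)%:R * p n.
Proof.
move=> a t0 ta; have := Pr_copies_ge wfH (p01 n) conH t0 ta; rewrite -/a.
set P := Pr _ _ _ => h.
rewrite [leLHS](_ : _ = 1 - P); last by rewrite /PrG -PrC.
have P0 : 0 <= P by exact: Pr_ge0.
have P1 : P <= 1 by exact: Pr_le1.
have a0 : 0 < a by apply: le_lt_trans ta.
have := onem_expr_onem_le (k.+1 ^ 2) (p01 n); move: h.
set w := (1 - p n) ^+ _; set M := (k.+1 ^ k.+1)%:R; set z := (k.+1 ^ 2)%:R * p n.
have w0 : 0 <= w by rewrite exprn_ge0 // subr_ge0; have /andP[] := p01 n.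
have w1 : w <= 1 by rewrite exprn_ile1 ?subr_ge0 ?gerBl //; have /andP[] := p01 n.
have M0 : 0 <= M by [].
move=> h hz; rewrite lerBlDr -lerBlDl.
(* Dividing by the squared mean leaves [u = t / a] and [v = M / a]. Then [w >= 1 - z],
   [(1 - u) ^+ 2 >= 1 - 2 * u] and [(1 + v) * P <= P + v] linearize the inequality. *)
have {}h : w * (1 - t / a) ^+ 2 <= (1 + M / a) * P.
  rewrite -(@ler_pM2l _ (a ^+ 2)) ?exprn_gt0 //.
  have -> : a ^+ 2 * (w * (1 - t / a) ^+ 2) = w * (a - t) ^+ 2 by field; rewrite gt_eqF.
  have -> // : a ^+ 2 * ((1 + M / a) * P) = (a ^+ 2 + M * a) * P by field; rewrite gt_eqF.
rewrite mulrDl -!mulrA; set u := t / a in h *; set v := M / a in h *.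
have u0 : 0 <= u by rewrite divr_ge0 // ltW.
have u1 : u <= 1 by rewrite ler_pdivrMr // mul1r ltW.
have v0 : 0 <= v by rewrite divr_ge0 // ltW.
have e1 : 1 - z - 2 * u <= w * (1 - u) ^+ 2.
  have : (1 - z) * (1 - u) ^+ 2 <= w * (1 - u) ^+ 2 by rewrite ler_wpM2r ?sqr_ge0; lra.
  nra.
have e2 : (1 + v) * P <= P + v by nra.
lra.
Qed.

Lemma whp_copies (t : R) : 0 <= t -> alpha * (size H)%:R < k.+1%:R ->
  whp p (fun n G => t < #|copies k H G|%:R).
Proof.
move=> t0 h; pose d := k.+1%:R - alpha * (size H)%:R; have d0 : 0 < d by rewrite subr_gt0.
pose c : R := 4 ^- k.+1 * expR (- (2 * k.+1%:R)).
have c0 : 0 < c by rewrite mulr_gt0 ?expR_gt0 // invr_gt0 exprn_gt0.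
apply: (@negl_le _ _ p01 _ (fun n => (2 * t + (k.+1 ^ k.+1)%:R) / c * n%:R `^ (- d) +
   (k.+1 ^ 2)%:R * n%:R `^ (- alpha))); last first.
  by rewrite -[0](addr0 (0 : R)); apply: cvgD; apply: cvg_powRN_scale.
near=> n.
have n0 : (0 < n)%N by near: n; exact: nbhs_infty_gt.
have ge : c * n%:R `^ d <= Ex (p n) (vpairs n) (fun G => #|copies k H G|%:R).
  by near: n; exact: Ex_copies_powR.
have tn : t / c + 1 <= n%:R `^ d by near: n; exact: near_powR_ge.
have tc : t < c * n%:R `^ d.
  rewrite -ltr_pdivrMl // mulrC; lra.
apply: le_trans (Pr_few_copies t0 (lt_le_trans tc ge)) _; rewrite lerD2r.
rewrite -mulrA ler_wpM2l ?addr_ge0 ?mulr_ge0 // powRN -invfM lef_pV2 ?posrE //.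
  by apply: lt_le_trans ge; rewrite mulr_gt0 // powR_gt0 // ltr0n.
by rewrite mulr_gt0 // powR_gt0 // ltr0n.
Unshelve. all: by end_near. Qed.

(** On the threshold the mean [a] is only known to be at least [c]. The Paley-Zygmund inequality at
    [0] gives [w <= (1 + M / a) * P], and [w >= 1 / 2] for large [n]. *)
Lemma copies_pos : alpha * (size H)%:R = k.+1%:R -> exists2 c : R, 0 < c &
  \forall n \near \oo, c <= PrG p (fun G : {set {set 'I_n}} => (0 < #|copies k H G|)%N).
Proof.
move=> h; pose c : R := 4 ^- k.+1 * expR (- (2 * k.+1%:R)).
have c0 : 0 < c by rewrite mulr_gt0 ?expR_gt0 // invr_gt0 exprn_gt0.
pose M : R := (k.+1 ^ k.+1)%:R.
have M0 : 0 <= M by [].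
have d0 : 0 < 2 * (1 + M / c) by rewrite mulr_gt0 // addr_gt0 // divr_gt0 // ltr0n expn_gt0.
exists (2 * (1 + M / c))^-1; first by rewrite invr_gt0.
near=> n.
have : c * n%:R `^ (k.+1%:R - alpha * (size H)%:R) <= Ex (p n) (vpairs n) (fun G => #|copies k H G|%:R).
  by near: n; exact: Ex_copies_powR.
rewrite h subrr powRr0 mulr1; set a := Ex _ _ _ => ca.
have a0 : 0 < a by apply: lt_le_trans ca.
have := Pr_copies_ge wfH (p01 n) conH (lexx (0 : R)) a0; rewrite -/a -/M subr0.
rewrite (_ : Pr _ _ (fun G => 0 < _) = PrG p (fun G : {set {set 'I_n}} => (0 < #|copies k H G|)%N)); last first.
  by apply: eq_Pr => G _; rewrite ltr0n.
set P := PrG _ _ => hP.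
have P0 : 0 <= P by exact: Pr_ge0.
have small : p n <= (2 * (k.+1 ^ 2)%:R)^-1.
  by near: n; apply: near_pw_le => //; rewrite invr_gt0 mulr_gt0 // ltr0n expn_gt0.
have := onem_expr_onem_le (k.+1 ^ 2) (p01 n); move: hP.
set w := (1 - p n) ^+ _ => hP hw.
have w2 : 1 / 2 <= w.
  have : (k.+1 ^ 2)%:R * p n <= 1 / 2.
    rewrite mulrC -ler_pdivlMr ?ltr0n ?expn_gt0 //; apply: le_trans small _.
    by rewrite invfM mul1r.
  lra.
have {}hP : w <= (1 + M / a) * P.
  rewrite -(@ler_pM2l _ (a ^+ 2)) ?exprn_gt0 // mulrC.
  have -> // : a ^+ 2 * ((1 + M / a) * P) = (a ^+ 2 + M * a) * P by field; rewrite gt_eqF.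
have Ma : M / a <= M / c by rewrite ler_wpM2l // lef_pV2 ?posrE.
rewrite -[_^-1]mul1r ler_pdivrMr //.
move: Ma d0; set x := M / a in hP *; set y := M / c; nra.
Unshelve. all: by end_near. Qed.

End CopyThresholds.

(** * Signatures of vertices *)

Section Signature.
Variables (V : eqType) (s : seq V) (adj : rel V).

(** Quantification over a list serves two purposes: [enum 'I_n] for the random graph, and
    [iota 0 k.+1] for trees, where the signature is obtained by computation. *)
Definition two_nbrs x := has (fun y => adj x y && has (fun z => adj x z && (y != z)) s) s.
Definition leaf_nbr x := has (fun y => adj x y && all (fun z => adj y z ==> (z == x)) s) s.
Definition inner_nbr x := has (fun y => adj x y && has (fun z => adj y z && (z != x)) s) s.
Definition dist2 x y := [&& y != x, ~~ adj x y & has (fun z => adj x z && adj y z) s].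
(** Without 4-cycles such a [y] has just one neighbour, since two of them would both be adjacent to
    [x] as well. *)
Definition leaf2 x := has (fun y => dist2 x y && all (fun z => adj y z ==> adj x z) s) s.
Definition inner2 x := has (fun y => dist2 x y && has (fun z => adj y z && ~~ adj x z) s) s.

(* In a graph without triangles and 4-cycles this determines the depth 2 type of
   [x], up to the vertices far from [x]. *)
Definition sig x := (two_nbrs x, leaf_nbr x, inner_nbr x, leaf2 x, inner2 x).

End Signature.

Notation sigT := (bool * bool * bool * bool * bool)%type.

Notation gsig G := (sig (enum 'I__) (adj_of G)).

Definition realizes n (G : {set {set 'I_n}}) (c : sigT) := has (fun x => gsig G x == c) (enum 'I_n).

(** * Signatures as formulae *)

Section Formula.
(** The digit counts the quantifiers entered after [x], so the same vertex is [x1] in [fo 2] and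
    [x2] in [fo 3]. *)
Let x1 : 'I_2 := lift ord0 (ord0 : 'I_1).
Let y1 : 'I_2 := ord0.
Let x2 : 'I_3 := lift ord0 (lift ord0 (ord0 : 'I_1) : 'I_2).
Let y2 : 'I_3 := lift ord0 (ord0 : 'I_2).
Let z2 : 'I_3 := ord0.

Definition two_nbrs_f : fo 1 :=
  FEx (FAnd (FAdj x1 y1) (FEx (FAnd (FAdj x2 z2) (FNot (FEq y2 z2))))).
Definition leaf_nbr_f : fo 1 :=
  FEx (FAnd (FAdj x1 y1) (FAll (FImp (FAdj y2 z2) (FEq z2 x2)))).
Definition inner_nbr_f : fo 1 :=
  FEx (FAnd (FAdj x1 y1) (FEx (FAnd (FAdj y2 z2) (FNot (FEq z2 x2))))).
Definition dist2_f : fo 2 :=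
  FAnd (FNot (FEq y1 x1)) (FAnd (FNot (FAdj x1 y1)) (FEx (FAnd (FAdj x2 z2) (FAdj y2 z2)))).
Definition leaf2_f : fo 1 := FEx (FAnd dist2_f (FAll (FImp (FAdj y2 z2) (FAdj x2 z2)))).
Definition inner2_f : fo 1 := FEx (FAnd dist2_f (FEx (FAnd (FAdj y2 z2) (FNot (FAdj x2 z2))))).

Definition lit (b : bool) (f : fo 1) := if b then f else FNot f.

Definition realizes_f (c : sigT) : sentence :=
  let: (b1, b2, b3, b4, b5) := c in
  FEx (FAnd (lit b1 two_nbrs_f) (FAnd (lit b2 leaf_nbr_f) (FAnd (lit b3 inner_nbr_f)
      (FAnd (lit b4 leaf2_f) (lit b5 inner2_f))))).

Lemma realizes_f_depth c : qdepth (realizes_f c) = 3.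
Proof. by case: c => [[[[[] []] []] []] []]. Qed.

Lemma extend0 (T : Type) m (x : T) (v : 'I_m -> T) : extend x v ord0 = x.
Proof. by rewrite /extend unlift_none. Qed.

Lemma extendS (T : Type) m (x : T) (v : 'I_m -> T) (i : 'I_m) : extend x v (lift ord0 i) = v i.
Proof. by have := @liftK m.+1 ord0 i; rewrite /extend => ->. Qed.

Lemma has_existsb (T : finType) (P : pred T) : has P (enum T) = [exists x, P x].
Proof.
by apply/hasP/existsP => [[x _ Px]|[x Px]]; exists x; rewrite ?mem_enum.
Qed.

Lemma all_forallb (T : finType) (P : pred T) : all P (enum T) = [forall x, P x].
Proof.
by apply/allP/forallP => [h x|h x _]; [apply: h; rewrite mem_enum|exact: h].
Qed.

Lemma realizes_fP n (G : {set {set 'I_n}}) c : holds (adj_of G) (realizes_f c) = realizes G c.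
Proof.
rewrite /realizes has_existsb; case: c => [[[[b1 b2] b3] b4] b5].
rewrite /holds /=; apply: eq_existsb => x.
set v := extend x _.
have vx : v ord0 = x by rewrite /v extend0.
have litE b f : Defs.eval (adj_of G) (lit b f) v = (Defs.eval (adj_of G) f v == b).
  by case: b; rewrite /= ?eqb_id // eqbF_neg.
have E1 : Defs.eval (adj_of G) two_nbrs_f v = two_nbrs (enum 'I_n) (adj_of G) x.
  rewrite /two_nbrs has_existsb /=; apply: eq_existsb => y.
  rewrite has_existsb extendS extend0 vx; congr (_ && _); apply: eq_existsb => z.
  by rewrite !extendS !extend0 vx.
have E2 : Defs.eval (adj_of G) leaf_nbr_f v = leaf_nbr (enum 'I_n) (adj_of G) x.
  rewrite /leaf_nbr has_existsb /=; apply: eq_existsb => y.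
  rewrite all_forallb extendS extend0 vx; congr (_ && _); apply: eq_forallb => z.
  by rewrite !extendS !extend0 vx.
have E3 : Defs.eval (adj_of G) inner_nbr_f v = inner_nbr (enum 'I_n) (adj_of G) x.
  rewrite /inner_nbr has_existsb /=; apply: eq_existsb => y.
  rewrite has_existsb extendS extend0 vx; congr (_ && _); apply: eq_existsb => z.
  by rewrite !extendS !extend0 vx.
have Ed y : Defs.eval (adj_of G) dist2_f (extend y v) = dist2 (enum 'I_n) (adj_of G) x y.
  rewrite /dist2 has_existsb /= !extendS !extend0 vx; congr (_ && (_ && _)).
  by apply: eq_existsb => z; rewrite !extendS !extend0 vx.
have E4 : Defs.eval (adj_of G) leaf2_f v = leaf2 (enum 'I_n) (adj_of G) x.
  rewrite /leaf2 has_existsb; apply: eq_existsb => y; rewrite -Ed all_forallb.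
  congr (_ && _); apply: eq_forallb => z.
  by rewrite /= !extendS !extend0 vx.
have E5 : Defs.eval (adj_of G) inner2_f v = inner2 (enum 'I_n) (adj_of G) x.
  rewrite /inner2 has_existsb; apply: eq_existsb => y; rewrite -Ed has_existsb.
  congr (_ && _); apply: eq_existsb => z.
  by rewrite /= !extendS !extend0 vx.
by rewrite !litE E1 E2 E3 E4 E5 /sig !xpair_eqE -!andbA.
Qed.

End Formula.

(** * Signatures inside a component copy *)

Section Transfer.
Variables (n k : nat) (H : seq (nat * nat)) (G : {set {set 'I_n}}) (phi : {ffun 'I_k.+1 -> 'I_n}).
Hypotheses (wfH : wf_graph k H) (GV : G \subset vpairs n) (cp : compcopy H G phi).
Let f i := phi (inord i).
Let I := iota 0 k.+1.

Lemma copy_inj i j : i \in I -> j \in I -> (f i == f j) = (i == j).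
Proof.
rewrite !mem_iota /= !add0n => ik jk; apply/eqP/eqP => [|->//].
by have /andP[/injectiveP inj _] := cp => /inj/inord_inj; apply.
Qed.

Lemma copy_adj i j : i \in I -> j \in I -> adj_of G (f i) (f j) = Hadj H i j.
Proof.
move=> iI jI; have /andP[/injectiveP inj /eqP E] := cp.
have -> : adj_of G (f i) (f j) = ([set f i; f j] \in edges H phi).
  rewrite -E inE /adj_of; case: (boolP (_ \in G)) => //= h.
  by rewrite inE (subsetP GV) //=; apply/esym/existsP; exists (inord i); rewrite !inE eqxx.
rewrite inE; apply/mapP/orP => [[[a b] abH /= F]|[ij|ji]]; last 2 first.
- by exists (i, j).
- by exists (j, i); rewrite //= setUC.
have [_ bk ak] := wf_bound wfH abH.
have aI : a \in I by rewrite mem_iota.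
have bI : b \in I by rewrite mem_iota.
have [/eqP ia|ia] := boolP (i == a).
  by left; rewrite ia in F *; move/pair_inj/eqP: F; rewrite (copy_inj jI bI) => /eqP ->.
have : f i \in [set f a; f b] by rewrite -F !inE eqxx.
rewrite !inE !copy_inj // (negbTE ia) /= => /eqP ib.
right; rewrite ib in F *; rewrite (setUC [set f a]) in F.
by move/pair_inj/eqP: F; rewrite (copy_inj jI aI) => /eqP ->.
Qed.

Lemma copy_nbr i y : adj_of G (f i) y -> exists2 j, j \in I & y = f j.
Proof.
move=> iy; have /andP[_ /eqP E] := cp.
have [j ->] := compcopy_closed GV E iy; exists (nat_of_ord j); rewrite ?mem_iota //=.
by rewrite /f inord_val.
Qed.

Lemma has_range (Q : pred 'I_n) : (forall y, Q y -> exists2 j, j \in I & y = f j) ->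
  has Q (enum 'I_n) = has (fun j => Q (f j)) I.
Proof.
move=> h; apply/hasP/hasP => [[y _ Qy]|[j jI Qj]].
  by have [j jI E] := h y Qy; exists j; rewrite -?E.
by exists (f j); rewrite ?mem_enum.
Qed.

Lemma has_nbr_copy i (Q : pred 'I_n) : i \in I ->
  has (fun y => adj_of G (f i) y && Q y) (enum 'I_n) = has (fun j => Hadj H i j && Q (f j)) I.
Proof.
move=> iI; rewrite has_range => [|y /andP[/copy_nbr]//].
by apply: eq_in_has => j jI; rewrite copy_adj.
Qed.

Lemma all_nbr_copy i (Q : pred 'I_n) : i \in I ->
  all (fun y => adj_of G (f i) y ==> Q y) (enum 'I_n) = all (fun j => Hadj H i j ==> Q (f j)) I.
Proof.
move=> iI; apply: negb_inj; rewrite -!has_predC.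
transitivity (has (fun y => adj_of G (f i) y && ~~ Q y) (enum 'I_n)).
  by apply: eq_has => y /=; rewrite negb_imply.
by rewrite has_nbr_copy //; apply: eq_has => y /=; rewrite negb_imply.
Qed.

Lemma dist2_copy i j : i \in I -> j \in I ->
  dist2 (enum 'I_n) (adj_of G) (f i) (f j) = dist2 I (Hadj H) i j.
Proof.
move=> iI jI; rewrite /dist2 copy_inj // copy_adj // has_nbr_copy //; congr (_ && (_ && _)).
by apply: eq_in_has => z zI; rewrite copy_adj.
Qed.

Lemma dist2_range i y : dist2 (enum 'I_n) (adj_of G) (f i) y -> exists2 j, j \in I & y = f j.
Proof.
move=> /and3P[_ _ /hasP[z _ /andP[/copy_nbr[j jI ->]]]].
by rewrite adj_of_sym => /copy_nbr.
Qed.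

(** Every quantifier ranges over vertices adjacent to a vertex of the copy or at distance 2 from it.
    These stay in the copy, so the quantifier can be restricted to [I]. *)
Lemma sig_copy i : i \in I -> gsig G (f i) = sig I (Hadj H) i.
Proof.
move=> iI; rewrite /sig; congr (_, _, _, _, _).
- rewrite /two_nbrs has_nbr_copy //; apply: eq_in_has => y yI; congr (_ && _).
  by rewrite has_nbr_copy //; apply: eq_in_has => z zI; rewrite copy_inj.
- rewrite /leaf_nbr has_nbr_copy //; apply: eq_in_has => y yI; congr (_ && _).
  by rewrite all_nbr_copy //; apply: eq_in_all => z zI; rewrite copy_inj.
- rewrite /inner_nbr has_nbr_copy //; apply: eq_in_has => y yI; congr (_ && _).
  by rewrite has_nbr_copy //; apply: eq_in_has => z zI; rewrite copy_inj.
- rewrite /leaf2 has_range => [|y /andP[/dist2_range]//]; apply: eq_in_has => y yI.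
  rewrite dist2_copy //; congr (_ && _).
  by rewrite all_nbr_copy //; apply: eq_in_all => z zI; rewrite copy_adj.
- rewrite /inner2 has_range => [|y /andP[/dist2_range]//]; apply: eq_in_has => y yI.
  rewrite dist2_copy //; congr (_ && _).
  by rewrite has_nbr_copy //; apply: eq_in_has => z zI; rewrite copy_adj.
Qed.

End Transfer.

Lemma copies_realizes n k H (G : {set {set 'I_n}}) i c :
  wf_graph k H -> G \subset vpairs n -> (i < k.+1)%N ->
  sig (iota 0 k.+1) (Hadj H) i = c -> (0 < #|copies k H G|)%N -> realizes G c.
Proof.
move=> wfH GV ik <- /card_gt0P[phi]; rewrite inE => cp.
have iI : i \in iota 0 k.+1 by rewrite mem_iota.
apply/hasP; exists (phi (inord i)); rewrite ?mem_enum //; apply/eqP.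
exact: (sig_copy wfH GV cp iI).
Qed.

(** * The twelve signatures and their trees *)

Definition path_graph k := [seq (i, i.+1) | i <- iota 0 k].
(** The chair has its centre at [1], with legs of lengths 1, 1, 2; the spider below has its centre
    at [0], with legs of lengths 2, 2, 1. *)
Definition chair_graph := [:: (0, 1); (1, 2); (1, 3); (3, 4)]%N.
Definition spider_graph := [:: (0, 1); (1, 2); (0, 3); (3, 4); (0, 5)]%N.

(* Each row lists the signature, the number of edges of its smallest tree, that
   tree, and a vertex of the tree with this signature. *)
Definition sig_table : seq (sigT * nat * seq (nat * nat) * nat) :=
  [:: (false, false, false, false, false, 0, path_graph 0, 0);
      (false, true,  false, false, false, 1, path_graph 1, 0);
      (false, false, true,  true,  false, 2, path_graph 2, 0);
      (true,  true,  false, false, false, 2, path_graph 2, 1);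
      (false, false, true,  false, true,  3, path_graph 3, 0);
      (true,  true,  true,  true,  false, 3, path_graph 3, 1);
      (true,  false, true,  true,  false, 4, path_graph 4, 2);
      (true,  true,  true,  false, true,  4, path_graph 4, 1);
      (false, false, true,  true,  true,  4, chair_graph, 0);
      (true,  false, true,  true,  true,  5, path_graph 5, 2);
      (true,  true,  true,  true,  true,  5, spider_graph, 1);
      (true,  false, true,  false, true,  6, path_graph 6, 3)]%N.

Lemma sig_table_ok : all (fun row : sigT * nat * seq (nat * nat) * nat =>
  let: (c, k, H, i) := row in
  [&& wf_graph k H, connected_graph k H, size H == k, (i < k.+1)%N &
      sig (iota 0 k.+1) (Hadj H) i == c]) sig_table.
Proof. by vm_compute. Qed.

(** * Trees forced by signatures *)

Section TreeExtraction.
Variables (V : finType) (adj : rel V).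
Hypotheses (sym : symmetric adj) (irr : irreflexive adj).
Hypothesis no3 : forall a b c, adj a b -> adj b c -> adj c a -> False.
Hypothesis no4 : forall a b c d, adj a b -> adj b c -> adj c d -> adj d a ->
  a != c -> b != d -> False.
Hypothesis no5 : forall a b c d e, adj a b -> adj b c -> adj c d -> adj d e -> adj e a -> False.
Hypothesis no6 : forall a b c d e f, adj a b -> adj b c -> adj c d -> adj d e -> adj e f ->
  adj f a -> a != c -> c != e -> a != e -> b != d -> d != f -> b != f -> False.

Definition tree_in k (H : seq (nat * nat)) := exists s : seq V,
  [/\ size s = k.+1, uniq s & forall x0, all (fun ij => adj (nth x0 s ij.1) (nth x0 s ij.2)) H].

Ltac saturate := repeat match goal with
  | h : is_true (adj ?a ?b) |- _ => match goal with
    | _ : is_true (adj b a) |- _ => fail 1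
    | _ => have ? : adj b a by rewrite sym
    end
  | h : is_true (?a != ?b) |- _ => match goal with
    | _ : is_true (b != a) |- _ => fail 1
    | _ => have ? : b != a by rewrite eq_sym
    end
  end.

(** Identifying two vertices of the tree would create a loop, contradict a recorded non-adjacency or
    inequality, or close a cycle of length 3, 4 or 5; after [saturate] the offending facts are among
    the hypotheses. *)
Ltac distinct := match goal with |- is_true (?a != ?b) =>
    solve [ assumption | (apply/negP => /eqP ?; subst;
      match goal with
      | h : is_true (adj ?x ?x) |- _ => by rewrite irr in h
      | h : is_true (?x != ?x) |- _ => by rewrite eqxx in h
      | h : is_true (adj ?x ?y), h' : is_true (~~ adj ?x ?y) |- _ => by rewrite h in h'
      | h : is_true (adj ?x ?y), h' : is_true (adj ?y ?z), h'' : is_true (adj ?z ?x) |- _ =>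
          case: (no3 h h' h'')
      | h1 : is_true (adj ?x ?y), h2 : is_true (adj ?y ?z), h3 : is_true (adj ?z ?t),
        h4 : is_true (adj ?t ?x), n1 : is_true (?x != ?z), n2 : is_true (?y != ?t) |- _ =>
          case: (no4 h1 h2 h3 h4 n1 n2)
      | h1 : is_true (adj ?x ?y), h2 : is_true (adj ?y ?z), h3 : is_true (adj ?z ?t),
        h4 : is_true (adj ?t ?u), h5 : is_true (adj ?u ?x) |- _ =>
          case: (no5 h1 h2 h3 h4 h5)
      end) ]
  end.

Ltac tree s := exists s; split=> //=;
  [saturate; rewrite ?inE ?negb_or; repeat (apply/andP; split) => //; distinct
  |by move=> x0; repeat (apply/andP; split) => //; rewrite sym].

Lemma leafP (s := enum V) x : reflect (exists2 y, adj x y & forall z, adj y z -> z = x) (leaf_nbr s adj x).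
Proof.
rewrite /leaf_nbr /s has_existsb; apply: (iffP existsP) => [[y /andP[xy /allP h]]|[y xy h]].
  by exists y => // z yz; apply/eqP; have := h z; rewrite mem_enum yz; apply.
by exists y; rewrite xy; apply/allP => z _; apply/implyP => /h ->.
Qed.

Lemma innerP (s := enum V) x :
  reflect (exists y z, [/\ adj x y, adj y z & z != x]) (inner_nbr s adj x).
Proof.
rewrite /inner_nbr /s; apply: (iffP hasP) => [[y _ /andP[xy /hasP[z _ /andP[yz zx]]]]|[y [z [xy yz zx]]]].
  by exists y, z.
by exists y; rewrite ?mem_enum // xy; apply/hasP; exists z; rewrite ?mem_enum // yz.
Qed.

Lemma twoP (s := enum V) x : reflect (exists y z, [/\ adj x y, adj x z & y != z]) (two_nbrs s adj x).
Proof.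
rewrite /two_nbrs /s; apply: (iffP hasP) => [[y _ /andP[xy /hasP[z _ /andP[yz zx]]]]|[y [z [xy yz zx]]]].
  by exists y, z.
by exists y; rewrite ?mem_enum // xy; apply/hasP; exists z; rewrite ?mem_enum // yz.
Qed.

Lemma dist2P (s := enum V) x y :
  reflect (exists z, [/\ y != x, ~~ adj x y, adj x z & adj y z]) (dist2 s adj x y).
Proof.
rewrite /dist2; apply: (iffP and3P) => [[yx nxy /hasP[z _ /andP[xz yz]]]|[z [yx nxy xz yz]]].
  by exists z.
by split=> //; apply/hasP; exists z; rewrite ?mem_enum // xz.
Qed.

Lemma leaf2P (s := enum V) x : reflect (exists y z, [/\ y != x, ~~ adj x y, adj x z, adj y z &
  forall w, adj y w -> adj x w]) (leaf2 s adj x).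
Proof.
apply: (iffP hasP) => [[y _ /andP[/dist2P[z [yx nxy xz yz]] /allP h]]|[y [z [yx nxy xz yz h]]]].
  by exists y, z; split=> // w yw; have := h w; rewrite mem_enum yw; apply.
exists y; rewrite ?mem_enum //; apply/andP; split; first by apply/dist2P; exists z.
by apply/allP => w _; apply/implyP; exact: h.
Qed.

Lemma inner2P (s := enum V) x : reflect (exists y z w, [/\ y != x, ~~ adj x y, adj x z & adj y z] /\
  (adj y w /\ ~~ adj x w)) (inner2 s adj x).
Proof.
apply: (iffP hasP) => [[y _ /andP[/dist2P[z [yx nxy xz yz]] /hasP[w _ /andP[yw xw]]]]|].
  by exists y, z, w.
move=> [y [z [w [[yx nxy xz yz] [yw xw]]]]].
exists y; rewrite ?mem_enum //; apply/andP; split; first by apply/dist2P; exists z.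
by apply/hasP; exists w; rewrite ?mem_enum // yw.
Qed.

(** Three constraints reduce the 32 vectors to 12. A leaf and an inner neighbour are two neighbours;
    two neighbours include a leaf or an inner one; and an inner neighbour amounts to a vertex at
    distance 2, which is of one of the two kinds. *)
Lemma sig_valid x : sig (enum V) adj x \in [seq row.1.1.1 | row <- sig_table].
Proof.
have i1 : leaf_nbr (enum V) adj x -> inner_nbr (enum V) adj x -> two_nbrs (enum V) adj x.
  move=> /leafP[y xy hy] /innerP[a [b [xa ab bx]]]; apply/twoP; exists y, a; split=> //.
  by apply: contraNneq bx => E; apply/eqP/hy; rewrite E.
have i2 : two_nbrs (enum V) adj x -> leaf_nbr (enum V) adj x || inner_nbr (enum V) adj x.
  move=> /twoP[y [_ [xy _ _]]]; rewrite orbC -implyNb; apply/implyP => /innerP ni.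
  apply/leafP; exists y => // z yz; apply/eqP; apply: contra_notT ni => zx.
  by exists y, z.
have i3 : inner_nbr (enum V) adj x = leaf2 (enum V) adj x || inner2 (enum V) adj x.
  apply/innerP/orP => [[a [b [xa ab bx]]]|].
    have nxb : ~~ adj x b by apply/negP => xb; apply: (no3 xa ab); rewrite sym.
    have [/existsP[w /andP[bw xw]]|nw] := boolP [exists w, adj b w && ~~ adj x w].
      by right; apply/inner2P; exists b, a, w; do !split=> //; rewrite sym.
    left; apply/leaf2P; exists b, a; split=> //; first by rewrite sym.
    move=> w bw; apply: contraNT nw => nxw; apply/existsP; exists w; exact/andP.
  by case=> [/leaf2P[y [z [yx _ xz yz _]]]|/inner2P[y [z [w [[yx _ xz yz] _]]]]];
    exists z, y; rewrite sym in yz.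
rewrite /sig; move: i1 i2 i3.
case: two_nbrs; case: leaf_nbr; case: inner_nbr; case: leaf2; case: inner2 => //= h1 h2 h3;
  by [|have := h1 isT isT|have := h2 isT].
Qed.

Lemma not_leaf_nbr x y : leaf_nbr (enum V) adj x = false -> adj x y -> exists2 z, adj y z & z != x.
Proof.
move=> /negbT nl xy; have [/existsP[z /andP[yz zx]]|h] := boolP [exists z, adj y z && (z != x)].
  by exists z.
case/leafP: nl; exists y => // z yz; apply/eqP; apply: contraNT h => zx.
by apply/existsP; exists z; rewrite yz.
Qed.

Lemma not_leaf2 x y z : leaf2 (enum V) adj x = false -> adj x y -> adj y z -> z != x ->
  exists2 w, adj z w & ~~ adj x w.
Proof.
move=> /negbT nl xy yz zx; have [/existsP[w /andP[zw xw]]|h] := boolP [exists w, adj z w && ~~ adj x w].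
  by exists w.
case/leaf2P: nl; exists z, y; split=> //; last first.
- by move=> w zw; apply: contraNT h => xw; apply/existsP; exists w; rewrite zw.
- by rewrite sym.
- by apply/negP => xz; apply: (no3 xy yz); rewrite sym.
Qed.

Lemma path1_in (x : V) : tree_in 0 (path_graph 0).
Proof. by exists [:: x]. Qed.

Lemma path2_in x : leaf_nbr (enum V) adj x -> tree_in 1 (path_graph 1).
Proof. by move=> /leafP[y xy _]; tree [:: x; y]. Qed.

Lemma path3_in x : inner_nbr (enum V) adj x || two_nbrs (enum V) adj x -> tree_in 2 (path_graph 2).
Proof.
case/orP => [/innerP[y [z [xy yz zx]]]|/twoP[y [z [xy xz yz]]]]; first by tree [:: x; y; z].
by tree [:: y; x; z].
Qed.

Lemma path4_in_end x : inner2 (enum V) adj x -> tree_in 3 (path_graph 3).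
Proof. by move=> /inner2P[y [z [w [[yx nxy xz yz] [yw xw]]]]]; tree [:: x; z; y; w]. Qed.

Lemma leaf_neq x y a b : (forall z, adj y z -> z = x) -> adj a b -> b != x -> y != a.
Proof. by move=> h ab bx; apply: contraNneq bx => E; apply/eqP/h; rewrite E. Qed.

Lemma path4_in_inner x : leaf_nbr (enum V) adj x -> inner_nbr (enum V) adj x -> tree_in 3 (path_graph 3).
Proof.
move=> /leafP[y xy hy] /innerP[a [b [xa ab bx]]].
have ya := leaf_neq hy ab bx.
have yb : y != b by apply: (leaf_neq hy (b := a)); [rewrite sym|apply: contraTneq xa => ->; rewrite irr].
by tree [:: y; x; a; b].
Qed.

Lemma path5_in_center x : two_nbrs (enum V) adj x -> leaf_nbr (enum V) adj x = false ->
  tree_in 4 (path_graph 4).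
Proof.
move=> /twoP[a [b [xa xb ab]]] nl.
have [a' aa' a'x] := not_leaf_nbr nl xa; have [b' bb' b'x] := not_leaf_nbr nl xb.
by tree [:: a'; a; x; b; b'].
Qed.

Lemma path5_in_second x : leaf_nbr (enum V) adj x -> inner2 (enum V) adj x -> tree_in 4 (path_graph 4).
Proof.
move=> /leafP[y xy hy] /inner2P[u [z [w [[ux nxu xz uz] [uw xw]]]]].
have yz : y != z by apply: (leaf_neq hy (b := u)); rewrite // sym.
by tree [:: y; x; z; u; w].
Qed.

(** As [x] does not have two neighbours, both vertices at distance 2 hang on the same [z], the
    centre of the chair. *)
Lemma chair_in x : two_nbrs (enum V) adj x = false -> leaf2 (enum V) adj x ->
  inner2 (enum V) adj x -> tree_in 4 chair_graph.
Proof.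
move=> n2 /leaf2P[u [z [ux nxu xz uz hu]]] /inner2P[v [z' [w [[vx nxv xz' vz'] [vw xw]]]]].
have zz : z' = z.
  by apply/eqP; apply: contraFT n2 => zz; apply/twoP; exists z', z.
subst z'.
have uv : u != v by apply: contraNneq xw => E; apply: hu; rewrite E.
have uw : u != w by apply: contraNneq nxv => E; apply: hu; rewrite E sym.
by tree [:: x; z; u; v; w].
Qed.

(** The inner vertex at distance 2 gives an arm of three edges at [x]. Some neighbour of [x] is off
    this arm, and not being a leaf it starts a second arm of two edges. *)
Lemma path6_in x : two_nbrs (enum V) adj x -> leaf_nbr (enum V) adj x = false ->
  inner2 (enum V) adj x -> tree_in 5 (path_graph 5).
Proof.
move=> /twoP[a0 [b0 [xa0 xb0 ab0]]] nl /inner2P[u [z [w [[ux nxu xz uz] [uw xw]]]]].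
have [b xb bz] : exists2 b, adj x b & b != z.
  have [E|h] := eqVneq a0 z; last by exists a0.
  by exists b0; rewrite // -E eq_sym.
have [a ba ax] := not_leaf_nbr nl xb.
by tree [:: a; b; x; z; u; w].
Qed.

Lemma spider_in x : leaf_nbr (enum V) adj x -> leaf2 (enum V) adj x ->
  inner2 (enum V) adj x -> tree_in 5 spider_graph.
Proof.
move=> /leafP[y xy hy] /leaf2P[u [z [ux nxu xz uz hu]]] /inner2P[v [z' [w [[vx nxv xz' vz'] [vw xw]]]]].
have uv : u != v by apply: contraNneq xw => E; apply: hu; rewrite E.
have uw : u != w by apply: contraNneq nxv => E; apply: hu; rewrite E sym.
have yz : y != z by apply: (leaf_neq hy (b := u)); rewrite // sym.
have yz' : y != z' by apply: (leaf_neq hy (b := v)); rewrite // sym.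
(* Both shapes contain the spider: its centre is [z] if the leaf and the inner vertex at distance 2
   hang on the same neighbour, and [x] otherwise. *)
have [E|zz] := eqVneq z' z.
  by subst z'; tree [:: z; x; y; v; w; u].
by tree [:: x; z; u; z'; v; y].
Qed.

Lemma path7_in x : two_nbrs (enum V) adj x -> leaf_nbr (enum V) adj x = false ->
  leaf2 (enum V) adj x = false -> tree_in 6 (path_graph 6).
Proof.
move=> /twoP[a [b [xa xb ab]]] nl n2.
have [a' aa' a'x] := not_leaf_nbr nl xa; have [b' bb' b'x] := not_leaf_nbr nl xb.
have [a2 a'a2 xa2] := not_leaf2 n2 xa aa' a'x; have [b2 b'b2 xb2] := not_leaf2 n2 xb bb' b'x.
have nxa' : ~~ adj x a' by apply/negP => h; apply: (no3 xa aa'); rewrite sym.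
have nxb' : ~~ adj x b' by apply/negP => h; apply: (no3 xb bb'); rewrite sym.
have a'b' : a' != b' by saturate; distinct.
have aa2 : a != a2 by apply: contraNneq xa2 => <-.
have bb2 : b != b2 by apply: contraNneq xb2 => <-.
have ba2 : b != a2 by apply: contraNneq xa2 => <-.
(* The two arms of three edges at [x] could meet at their ends, which would close a 6-cycle; this is
   the reason for excluding that length. *)
have a2b2 : a2 != b2.
  apply/negP => /eqP E; subst b2.
  by apply: (@no6 x a a' a2 b' b); rewrite // 1?sym // 1?eq_sym // sym.
by tree [:: a2; a'; a; x; b; b'; b2].
Qed.

End TreeExtraction.

(** * Graphs without short cycles *)

(** The length is [k.+1]. With as many edges as vertices, such cycles are absent with high
    probability as soon as alpha > 1. *)
Definition cycle_graph k := (0%N, k) :: path_graph k.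

Definition has_copy k H n (G : {set {set 'I_n}}) :=
  [exists phi : {ffun 'I_k.+1 -> 'I_n}, subcopy H G phi].

(* Only the cycles of length 3 to 6 matter for sentences of depth 3. *)
Definition acyclic n (G : {set {set 'I_n}}) :=
  all (fun k => ~~ has_copy k (cycle_graph k) G) [:: 2; 3; 4; 5]%N.

Lemma tree_has_copy k H n (G : {set {set 'I_n}}) : wf_graph k H ->
  tree_in (adj_of G) k H -> has_copy k H G.
Proof.
move=> wfH [s [ss us /(_ _)]]; case: s ss us => // x0 s ss us /(_ x0)/allP h.
apply/existsP; exists [ffun i : 'I_k.+1 => nth x0 (x0 :: s) i]; apply/andP; split.
  apply/injectiveP => i j; rewrite !ffunE => /eqP.
  by rewrite nth_uniq ?ss // => /eqP/val_inj.
apply/subsetP => e; rewrite inE => /mapP[[i j] ijH ->]; rewrite !ffunE /=.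
have [ij jk ik] := wf_bound wfH ijH.
by rewrite !inordK //; exact: h ijH.
Qed.

Section AcyclicGraph.
Variables (n : nat) (G : {set {set 'I_n}}).
Hypotheses (GV : G \subset vpairs n) (acy : acyclic G).
Let adj := adj_of G.
Let sym : symmetric adj := adj_of_sym G.
Let irr : irreflexive adj := adj_of_irr GV.

Lemma adj_neq a b : adj a b -> a != b.
Proof. by move=> ab; apply: contraTneq ab => ->; rewrite irr. Qed.

Lemma no_cycle k : k \in [:: 2; 3; 4; 5]%N -> tree_in adj k (cycle_graph k) -> False.
Proof.
move=> k25; move/allP: acy => /(_ k k25)/negP nc h; apply: nc; apply: tree_has_copy h.
by move: k25; rewrite !inE => /or4P[] /eqP ->.
Qed.

Lemma acyclic3 a b c : adj a b -> adj b c -> adj c a -> False.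
Proof.
move=> ab bc ca; apply: (@no_cycle 2) => //; exists [:: a; b; c]; split=> //=.
  by rewrite !inE negb_or !adj_neq // sym.
by move=> _; rewrite (sym a c) ca ab bc.
Qed.

Lemma acyclic4 a b c d : adj a b -> adj b c -> adj c d -> adj d a -> a != c -> b != d -> False.
Proof.
move=> ab bc cd da ac bd; apply: (@no_cycle 3) => //; exists [:: a; b; c; d]; split=> //=.
  by rewrite !inE !negb_or ac bd !adj_neq // sym.
by move=> _; rewrite (sym a d) da ab bc cd.
Qed.

Lemma acyclic5 a b c d e : adj a b -> adj b c -> adj c d -> adj d e -> adj e a -> False.
Proof.
move=> ab bc cd de ea; apply: (@no_cycle 4) => //; exists [:: a; b; c; d; e]; split=> //=.
  have ac : a != c by apply/eqP => E; subst c; exact: acyclic3 cd de ea.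
  have ad : a != d by apply/eqP => E; subst d; exact: acyclic3 ab bc cd.
  have bd : b != d by apply/eqP => E; subst d; exact: acyclic3 de ea ab.
  have be : b != e by apply/eqP => E; subst e; exact: acyclic3 bc cd de.
  have ce : c != e by apply/eqP => E; subst e; exact: acyclic3 ea ab bc.
  by rewrite !inE !negb_or ac ad bd be ce !adj_neq // sym.
by move=> _; rewrite (sym a e) ea ab bc cd de.
Qed.

Lemma acyclic6 a b c d e f : adj a b -> adj b c -> adj c d -> adj d e -> adj e f ->
  adj f a -> a != c -> c != e -> a != e -> b != d -> d != f -> b != f -> False.
Proof.
move=> ab bc cd de ef fa ac ce ae bd df bf.
apply: (@no_cycle 5) => //; exists [:: a; b; c; d; e; f]; split=> //=.
  have ad : a != d by apply/eqP => E; subst d; exact: acyclic3 ab bc cd.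
  have be : b != e by apply/eqP => E; subst e; exact: acyclic3 bc cd de.
  have cf : c != f by apply/eqP => E; subst f; exact: acyclic3 cd de ef.
  by rewrite !inE !negb_or ac ce ae bd df bf ad be cf !adj_neq // sym.
by move=> _; rewrite (sym a f) fa ab bc cd de ef.
Qed.

Lemma realizes_has_copy c k H i : (c, k, H, i) \in sig_table -> realizes G c -> has_copy k H G.
Proof.
move=> row; have /allP/(_ _ row)/and5P[wfH _ _ _ _] := sig_table_ok.
move=> /hasP[x _ /eqP E]; apply: tree_has_copy wfH _; move: row E.
rewrite /sig_table !inE.
do ?[case/orP]; move=> /eqP[-> -> -> _] /= -[e1 e2 e3 e4 e5].
- exact: path1_in x.
- exact: (path2_in sym irr (x := x)).
- by apply: (path3_in sym irr (x := x)); rewrite e3.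
- by apply: (path3_in sym irr (x := x)); rewrite e1 orbT.
- exact: (path4_in_end sym irr (x := x)).
- exact: (path4_in_inner sym irr (x := x)).
- exact: (path5_in_center sym irr acyclic3 acyclic4 e1 e2).
- exact: (path5_in_second sym irr e2 e5).
- exact: (chair_in sym irr e1 e4 e5).
- exact: (path6_in sym irr acyclic3 acyclic4 acyclic5 e1 e2 e5).
- exact: (spider_in sym irr e2 e4 e5).
- exact: (path7_in sym irr acyclic3 acyclic4 acyclic5 acyclic6 e1 e2 e4).
Qed.

Lemma realizes_table c : realizes G c -> c \in [seq row.1.1.1 | row <- sig_table].
Proof.
by move=> /hasP[x _ /eqP <-]; apply: sig_valid => //; exact: acyclic3.
Qed.

Definition has_nbr x := [exists z, adj x z].

Lemma has_nbrE x : has_nbr x = leaf_nbr (enum 'I_n) adj x || inner_nbr (enum 'I_n) adj x.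
Proof.
apply/existsP/orP => [[y xy]|[/leafP[y xy _]|/innerP[y [_ [xy _ _]]]]]; try by exists y.
have [|nl] := boolP (leaf_nbr (enum 'I_n) adj x); first by left.
have [z yz zx] := not_leaf_nbr (negbTE nl) xy.
by right; apply/innerP; exists y, z.
Qed.

Hypothesis non_nbr : forall x y, pattern adj x y false false.

(** This and the next three lemmas treat [y] equal to [x], adjacent to it, at distance 2, and
    farther away. In each case the patterns depend on the signature of [x] and at most one bit about
    [y]. *)
Lemma pattern_eq x a b : pattern adj x x a b = if a then b && has_nbr x else ~~ b.
Proof.
case: a b => [] [] /=; try exact: non_nbr.
- apply/existsP/existsP => [[z /and4P[_ _ /eqP zx _]]|[z xz]]; exists z; first by rewrite sym.
  by rewrite eq_sym adj_neq // sym xz.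
- by apply/negbTE/negP => /existsP[z /and4P[_ _ /eqP -> /eqP]].
- by apply/negbTE/negP => /existsP[z /and4P[_ _ /eqP -> /eqP]].
Qed.

Lemma pattern_adj x y a b : adj x y -> pattern adj x y a b =
  if a then ~~ b && two_nbrs (enum 'I_n) adj x
  else b ==> [exists z, adj y z && (z != x)].
Proof.
move=> xy; case: a b => [] [] /=; try exact: non_nbr.
- apply/negbTE/negP => /existsP[z /and4P[_ _ /eqP zx /eqP zy]].
  by apply: (acyclic3 xy _ zx); rewrite sym.
- apply/existsP/twoP => [[z /and4P[zx zy /eqP azx _]]|[u [v [xu xv uv]]]].
    by exists y, z; split=> //; [rewrite sym|rewrite eq_sym].
  have [z xz zy] : exists2 z, adj x z & z != y.
    have [E|h] := eqVneq u y; last by exists u.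
    by exists v; rewrite // -E eq_sym.
  exists z; rewrite zy (eq_sym z) adj_neq //= sym xz /=; apply/eqP/negbTE/negP => zy'.
  by apply: (acyclic3 xy _ (_ : adj z x)); rewrite sym.
- apply/existsP/existsP => [[z /and4P[zx zy /eqP azx /eqP azy]]|[z /andP[yz zx]]].
    by exists z; rewrite zx andbT sym.
  exists z; rewrite zx (eq_sym z) adj_neq //= (sym z y) yz eqxx andbT.
  apply/eqP/negbTE/negP => zx'; exact: acyclic3 xy yz zx'.
Qed.

Lemma pattern_dist2 x y a b : dist2 (enum 'I_n) adj x y -> pattern adj x y a b =
  if a then b || two_nbrs (enum 'I_n) adj x
  else b ==> [exists z, adj y z && ~~ adj x z].
Proof.
move=> /dist2P[u [yx nxy xu yu]]; case: a b => [] [] /=; try exact: non_nbr.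
- by apply/existsP; exists u; rewrite !(eq_sym u) !adj_neq //= !(sym u) xu yu.
- apply/existsP/twoP => [[z /and4P[zx zy /eqP azx /eqP azy]]|[v [w [xv xw vw]]]].
    exists u, z; split=> //; first by rewrite sym.
    by apply: contraFneq azy => <-; rewrite sym.
  have [z xz zu] : exists2 z, adj x z & z != u.
    have [E|h] := eqVneq v u; last by exists v.
    by exists w; rewrite // -E eq_sym.
  exists z; rewrite (eq_sym z x) adj_neq //= (sym z x) xz /=; apply/andP; split.
    by apply: contraNneq nxy => <-.
  apply/eqP/negbTE/negP => zy; apply: (acyclic4 xz zy yu); rewrite 1?sym // eq_sym //.
- apply/existsP/existsP => [[z /and4P[zx zy /eqP azx /eqP azy]]|[z /andP[yz xz]]].
    by exists z; rewrite (sym y) azy (sym x) azx.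
  exists z; rewrite (eq_sym z y) (adj_neq yz) /= (sym z y) yz (sym z x) (negbTE xz) /= andbT.
  by apply: contraTneq yz => ->; rewrite sym.
Qed.

Lemma pattern_far x y a b : y != x -> ~~ adj x y -> dist2 (enum 'I_n) adj x y = false ->
  pattern adj x y a b = if a then ~~ b && has_nbr x else b ==> has_nbr y.
Proof.
move=> yx nxy nd.
have nc z : adj x z -> adj y z -> False.
  by move=> xz yz; move/negbT/dist2P: nd; apply; exists z.
case: a b => [] [] /=; try exact: non_nbr.
- apply/negbTE/negP => /existsP[z /and4P[_ _ /eqP zx /eqP zy]].
  by apply: (nc z); rewrite sym.
- apply/existsP/existsP => [[z /and4P[zx zy /eqP azx /eqP azy]]|[z xz]].
    by exists z; rewrite sym.
  exists z; rewrite (eq_sym z x) adj_neq //= (sym z x) xz /=; apply/andP; split.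
    by apply: contraNneq nxy => <-.
  by apply/eqP/negbTE/negP => zy; apply: (nc z) => //; rewrite sym.
- apply/existsP/existsP => [[z /and4P[zx zy /eqP azx /eqP azy]]|[z yz]].
    by exists z; rewrite sym.
  exists z; rewrite (eq_sym z y) (adj_neq yz) /= (sym z y) yz /= andbT; apply/andP; split.
    by apply: contraNneq nxy => <-; rewrite sym.
  by apply/eqP/negbTE/negP => zx; apply: (nc z) => //; rewrite sym.
Qed.

End AcyclicGraph.

(** * Vertices far from a given one *)

(** Three isolated vertices leave one that avoids any two given vertices. *)
Definition isolates n (G : {set {set 'I_n}}) := (2 < #|copies 0 (path_graph 0) G|)%N.
(** [copies] counts an isolated edge once for each orientation. More than two copies therefore mean
    at least two edges, one of which avoids a given vertex. *)
Definition lone_edges n (G : {set {set 'I_n}}) := (2 < #|copies 1 (path_graph 1) G|)%N.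
Definition nice n (G : {set {set 'I_n}}) := [&& acyclic G, isolates G & lone_edges G].

Lemma isolates_avoid n (G : {set {set 'I_n}}) : G \subset vpairs n -> isolates G ->
  forall x y, exists z, [/\ z != x, z != y & forall w, ~~ adj_of G z w].
Proof.
move=> GV iso x y.
have [/existsP[phi /and3P[cp px py]]|h] :=
  boolP [exists phi in copies 0 (path_graph 0) G, (phi ord0 != x) && (phi ord0 != y)].
  exists (phi ord0); split=> // w; apply/negP => zw.
  move: cp; rewrite inE => /andP[_ /eqP E]; have [j F] := compcopy_closed GV E zw.
  by move: zw; rewrite F (ord1 j) adj_of_irr.
move: iso; rewrite /isolates ltnNge; case/negP.
apply: (@leq_trans #|[set ([ffun=> v] : {ffun 'I_1 -> 'I_n}) | v in [set x; y]]|); last first.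
  by apply: leq_trans (leq_imset_card _ _) _; rewrite cards2; case: (_ != _).
apply/subset_leq_card/subsetP => phi cp; apply/imsetP; exists (phi ord0).
  move: h; rewrite negb_exists => /forallP/(_ phi); rewrite cp /= negb_and !negbK.
  by rewrite !inE.
by apply/ffunP => i; rewrite ffunE (ord1 i).
Qed.

Lemma lone_edge_far n (G : {set {set 'I_n}}) : G \subset vpairs n -> lone_edges G ->
  forall x, exists y, [/\ y != x, ~~ adj_of G x y, dist2 (enum 'I_n) (adj_of G) x y = false &
    [exists z, adj_of G y z]].
Proof.
move=> GV lone x.
have adj01 (phi : {ffun 'I_2 -> 'I_n}) : compcopy (path_graph 1) G phi -> adj_of G (phi ord0) (phi (lift ord0 ord0)).
  move=> /andP[_ /eqP E]; suff : [set phi ord0; phi (lift ord0 ord0)] \in edges (path_graph 1) phi.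
    by rewrite -E inE => /andP[].
  rewrite inE /= inE; apply/eqP; congr [set phi _; phi _]; apply/val_inj; rewrite /= inordK //.
have I2 (i : 'I_2) : i = ord0 \/ i = lift ord0 ord0.
  by case: (unliftP ord0 i) => [j ->|->]; [right; rewrite (ord1 j)|left].
have [/existsP[phi /and3P[cp px py]]|h] :=
  boolP [exists phi in copies 1 (path_graph 1) G, (phi ord0 != x) && (phi (lift ord0 ord0) != x)].
  rewrite inE in cp; have [_ /eqP E] := andP cp.
  have far i : ~~ adj_of G (phi i) x.
    apply/negP => ix; have [j F] := compcopy_closed GV E ix.
    by case: (I2 j) => J; rewrite F J eqxx in px py.
  exists (phi ord0); split=> //.
  - by rewrite adj_of_sym.
  - apply/negbTE/dist2P => -[z [_ _ xz yz]]; have [j F] := compcopy_closed GV E yz.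
    by move: (far j); rewrite -F adj_of_sym xz.
  - by apply/existsP; exists (phi (lift ord0 ord0)); exact: adj01.
(* If every copy met [x], it would be determined by which of its two ends is [x], so there would be
   at most two copies. *)
move: lone; rewrite /lone_edges ltnNge; case/negP.
rewrite -(@card_in_imset _ _ (fun phi : {ffun 'I_2 -> 'I_n} => phi ord0 == x)).
  by apply: leq_trans (max_card _) _; rewrite card_bool.
move=> phi psi cphi cpsi E0.
have hx (f : {ffun 'I_2 -> 'I_n}) : f \in copies 1 (path_graph 1) G -> f ord0 = x \/ f (lift ord0 ord0) = x.
  move=> cf; move: h; rewrite negb_exists => /forallP/(_ f); rewrite cf /= negb_and !negbK.
  by case/orP => /eqP; auto.
have := hx _ cphi; have := hx _ cpsi.
rewrite !inE in cphi cpsi; have a1 := adj01 _ cphi; have a2 := adj01 _ cpsi.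
have [_ /eqP E] := andP cphi.
have n1 := adj_neq GV a1; have n2 := adj_neq GV a2.
have key i j : phi i = psi j -> forall j', adj_of G (psi j) (psi j') -> exists2 i', psi j' = phi i' & i' != i.
  move=> ij j'; rewrite -ij => aj; have [i' F] := compcopy_closed GV E aj.
  by exists i' => //; apply: contraTneq aj => I; rewrite F I adj_of_irr.
case=> [psi0|psi1]; case=> [phi0|phi1].
- have [i' F ni] := key ord0 ord0 (etrans phi0 (esym psi0)) _ a2.
  apply/ffunP => i; case: (I2 i) => ->; first by rewrite phi0 psi0.
  by case: (I2 i') ni F => -> //; rewrite eqxx.
- by move: E0; rewrite psi0 eqxx => /eqP F; move: n1; rewrite F phi1 eqxx.
- by move: E0; rewrite phi0 eqxx => /esym/eqP F; move: n2; rewrite F psi1 eqxx.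
- rewrite adj_of_sym in a2.
  have [i' F ni] := key (lift ord0 ord0) (lift ord0 ord0) (etrans phi1 (esym psi1)) _ a2.
  apply/ffunP => i; case: (I2 i) => ->; last by rewrite phi1 psi1.
  by case: (I2 i') ni F => -> //; rewrite eqxx.
Qed.

Lemma nice_non_nbr n (G : {set {set 'I_n}}) : G \subset vpairs n -> isolates G ->
  forall x y, pattern (adj_of G) x y false false.
Proof.
move=> GV iso x y; have [z [zx zy h]] := isolates_avoid GV iso x y.
by apply/existsP; exists z; rewrite zx zy !(negbTE (h _)).
Qed.

(** The answer keeps the position relative to [x]. The remaining bit about [y] is matched by a leaf
    or inner vertex of the same kind when [y] is near, and by an isolated vertex or an isolated
    edge, present in every nice graph, when [y] is far. *)
Lemma nice_sim1 n (G : {set {set 'I_n}}) n' (G' : {set {set 'I_n'}}) x x' :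
  G \subset vpairs n -> G' \subset vpairs n' -> nice G -> nice G' ->
  gsig G x = gsig G' x' -> forall y, exists y', sim1 (adj_of G) (adj_of G') x y x' y'.
Proof.
move=> GV GV' /and3P[acy iso lone] /and3P[acy' iso' lone'] [e1 e2 e3 e4 e5] y.
have nn := nice_non_nbr GV iso; have nn' := nice_non_nbr GV' iso'.
have hn : has_nbr G x = has_nbr G' x' by rewrite !has_nbrE // e2 e3.
have [<-|xy] := eqVneq x y.
  by exists x'; split=> [||a b]; rewrite ?eqxx ?adj_of_irr // !pattern_eq // hn.
have [axy|naxy] := boolP (adj_of G x y).
  suff [y' axy' E] : exists2 y', adj_of G' x' y' &
      [exists z, adj_of G' y' z && (z != x')] = [exists z, adj_of G y z && (z != x)].
    exists y'; split=> [||a b]; rewrite ?axy ?axy' //.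
      by rewrite (negbTE xy) (negbTE (adj_neq GV' axy')).
    by rewrite !pattern_adj // E e1.
  have [/existsP[z /andP[yz zx]]|nz] := boolP [exists z, adj_of G y z && (z != x)].
    have : inner_nbr (enum 'I_n) (adj_of G) x by apply/innerP; exists y, z.
    rewrite e3 => /innerP[y' [z' [xy' yz' zx']]]; exists y' => //.
    by apply/existsP; exists z'; rewrite yz'.
  have : leaf_nbr (enum 'I_n) (adj_of G) x.
    apply/leafP; exists y => // z yz; apply/eqP; apply: contraNT nz => zx.
    by apply/existsP; exists z; rewrite yz.
  rewrite e2 => /leafP[y' xy' hy']; exists y' => //.
  by apply/negbTE/negP => /existsP[z /andP[/hy' ->]]; rewrite eqxx.
have [d2|nd2] := boolP (dist2 (enum 'I_n) (adj_of G) x y).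
  suff [y' d2' E] : exists2 y', dist2 (enum 'I_n') (adj_of G') x' y' &
      [exists z, adj_of G' y' z && ~~ adj_of G' x' z] = [exists z, adj_of G y z && ~~ adj_of G x z].
    have [z' [yx' nxy' _ _]] := dist2P _ _ _ d2'.
    exists y'; split=> [||a b]; rewrite ?(negbTE naxy) ?(negbTE nxy') //.
      by rewrite (negbTE xy) eq_sym (negbTE yx').
    by rewrite !pattern_dist2 // E e1.
  have [/existsP[z /andP[yz zx]]|nz] := boolP [exists z, adj_of G y z && ~~ adj_of G x z].
    have : inner2 (enum 'I_n) (adj_of G) x.
      by apply/hasP; exists y; rewrite ?mem_enum // d2; apply/hasP; exists z; rewrite ?mem_enum // yz.
    rewrite e5 => /hasP[y' _ /andP[d2' /hasP[z' _ yz']]]; exists y' => //.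
    by apply/existsP; exists z'.
  have : leaf2 (enum 'I_n) (adj_of G) x.
    apply/hasP; exists y; rewrite ?mem_enum // d2; apply/allP => z _; apply/implyP => yz.
    by apply: contraNT nz => zx; apply/existsP; exists z; rewrite yz.
  rewrite e4 => /hasP[y' _ /andP[d2' /allP h]]; exists y' => //.
  by apply/negbTE/negP => /existsP[z /andP[yz]]; have := h z; rewrite mem_enum yz /= => /(_ isT) ->.
suff [y' [yx' nxy' nd' E]] : exists y', [/\ y' != x', ~~ adj_of G' x' y',
    dist2 (enum 'I_n') (adj_of G') x' y' = false & has_nbr G' y' = has_nbr G y].
  exists y'; split=> [||a b]; rewrite ?(negbTE naxy) ?(negbTE nxy') //.
    by rewrite (negbTE xy) eq_sym (negbTE yx').
  by rewrite !pattern_far ?hn ?E // 1?eq_sym //; exact/negbTE.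
have [hy|nhy] := boolP (has_nbr G y).
  by have [y' [a b c d]] := lone_edge_far GV' lone' x'; exists y'.
have [y' [yx' _ h]] := isolates_avoid GV' iso' x' x'.
exists y'; split=> //; first by rewrite adj_of_sym.
  by apply/negbTE/dist2P => -[z [_ _ _ yz]]; move: (h z); rewrite yz.
by apply/negbTE/negP => /existsP[z yz]; move: (h z); rewrite yz.
Qed.

Lemma nice_sim2 n (G : {set {set 'I_n}}) n' (G' : {set {set 'I_n'}}) x x' :
  G \subset vpairs n -> G' \subset vpairs n' -> nice G -> nice G' ->
  gsig G x = gsig G' x' -> sim2 (adj_of G) (adj_of G') x x'.
Proof.
move=> GV GV' nG nG' E; split; first exact: nice_sim1.
by move=> y'; have [y s] := nice_sim1 GV' GV nG' nG (esym E) y'; exists y; exact: sim1_sym.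
Qed.

(** * The law for alpha > 1, and its failure at the thresholds *)

Section SparseLaw.
Variables (R : realType) (alpha : R).
Hypothesis alpha_gt1 : 1 < alpha.
Let alpha_gt0 : 0 < alpha := lt_trans ltr01 alpha_gt1.
Let p (n : nat) : R := n%:R `^ (- alpha).
Let p01 n : 0 <= p n <= 1 := pw01 n alpha_gt0.

Lemma whp_acyclic : whp p acyclic.
Proof.
apply: (whp_all p01) => k k25; apply: whpN => //; apply: negl_subcopy => //.
  by move: k25; rewrite !inE => /or4P[] /eqP ->.
by rewrite /= /path_graph size_map size_iota -[ltLHS]mul1r ltr_pM2r.
Qed.

Lemma zero_one_gt2 : 2 < alpha -> zero_one_law p 3.
Proof.
move=> a2; apply: (zero_one_of_whp p01 (A := fun n G => (2 < n)%N && ~~ has_copy 1 (path_graph 1) G)).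
  apply: whp_and => //.
    apply: whp_mono (whp_true p) => //; near=> n => G _ _; near: n; exact: nbhs_infty_gt.
  by apply: whpN => //; apply: negl_subcopy => //=; rewrite mulr1.
move=> n G n' G' GV GV' /andP[n2 nG] /andP[n2' nG'] x.
have empty m (F : {set {set 'I_m}}) : F \subset vpairs m -> ~~ has_copy 1 (path_graph 1) F ->
    forall u v, adj_of F u v = false.
  move=> FV nF u v; apply/negbTE; apply: contra nF => uv; apply: tree_has_copy => //.
  exists [:: u; v]; split=> //=; last by rewrite uv.
  by rewrite inE andbT; exact: adj_neq uv.
have pat m (F : {set {set 'I_m}}) : (2 < m)%N -> F \subset vpairs m -> ~~ has_copy 1 (path_graph 1) F ->
    forall u v a b, pattern (adj_of F) u v a b = ~~ a && ~~ b.
  move=> m2 FV nF u v a b; apply/existsP/idP => [[z]|].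
    by rewrite !empty // ![false == _]eq_sym !eqbF_neg => /and4P[_ _ -> ->].
  move=> /andP[/negbTE -> /negbTE ->].
  have /card_gt0P[z] : (0 < #|~: [set u; v]|)%N.
    by rewrite cardsCs setCK card_ord subn_gt0 (leq_ltn_trans _ m2) // cards2; case: (_ != _).
  by rewrite !inE negb_or => /andP[zu zv]; exists z; rewrite zu zv !empty.
have s1 m (F : {set {set 'I_m}}) m' (F' : {set {set 'I_m'}}) : (2 < m)%N -> (2 < m')%N ->
    F \subset vpairs m -> F' \subset vpairs m' -> ~~ has_copy 1 (path_graph 1) F ->
    ~~ has_copy 1 (path_graph 1) F' -> forall u u' v, exists v', sim1 (adj_of F) (adj_of F') u v u' v'.
  move=> m2 m2' FV FV' nF nF' u u' v; have [->|uv] := eqVneq u v.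
    by exists u'; split=> [||a b]; rewrite ?eqxx ?empty // !pat.
  have [v' uv'] := exists_other u' (ltnW m2').
  exists v'; split=> [||a b]; rewrite ?empty ?pat //.
  by rewrite (negbTE uv) (negbTE uv').
exists (Ordinal (ltnW (ltnW n2'))); split=> y; first exact: s1.
by have [y' s] := s1 _ _ _ _ n2' n2 GV' GV nG' nG (Ordinal (ltnW (ltnW n2'))) x y; exists y'; exact: sim1_sym.
Unshelve. all: by end_near. Qed.

Lemma row_ok c k H i : (c, k, H, i) \in sig_table ->
  [/\ wf_graph k H, connected_graph k H, size H = k, (i < k.+1)%N &
      sig (iota 0 k.+1) (Hadj H) i = c].
Proof.
move=> row; have /allP/(_ _ row)/and5P[? ? /eqP ? ? /eqP ?] := sig_table_ok.
by split.
Qed.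

Lemma realizes_dichotomy c :
  (forall k : nat, (k <= 6)%N -> alpha * k%:R != k.+1%:R) ->
  whp p (fun n G => realizes G c) \/ whp p (fun n G => ~~ realizes G c).
Proof.
move=> gen; have [/mapP[[[[c' k] H] i] row /= ->]|nc] := boolP (c \in [seq row.1.1.1 | row <- sig_table]).
  have [wfH conH sH ik sg] := row_ok row.
  have k6 : (k <= 6)%N.
    by have /allP/(_ _ row) : all (fun row : sigT * nat * seq (nat * nat) * nat => row.1.1.2 <= 6)%N sig_table.
  have := gen _ k6; rewrite neq_lt => /orP[h|h].
    left; apply: whp_mono (whp_copies wfH alpha_gt0 conH (ltW alpha_gt1) (lexx 0) _) => //; last by rewrite sH.
    near=> n => G GV; rewrite ltr0n; exact: copies_realizes wfH GV ik sg.
  right; apply: whp_mono (whp_and p01 whp_acyclic (whpN p01 (negl_subcopy wfH alpha_gt0 _))) => //; last by rewrite sH.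
  near=> n => G GV /andP[acy]; apply: contra; exact: realizes_has_copy row.
right; apply: whp_mono whp_acyclic => //; near=> n => G GV acy.
by apply: contra nc; exact: realizes_table.
Unshelve. all: by end_near. Qed.

Lemma zero_one_sparse : alpha < 2 -> (forall k : nat, (k <= 6)%N -> alpha * k%:R != k.+1%:R) ->
  zero_one_law p 3.
Proof.
(* [r] records which signatures occur in the limit, so that the event prescribes the whole set of
   realized signatures. *)
move=> a2 gen; pose r c := `[< whp p (fun n G => realizes G c) >].
apply: (zero_one_of_whp p01 (A := fun n G =>
   nice G && all (fun c => realizes G c == r c) (enum {: sigT}))).
  apply: whp_and => //.
    apply: whp_and => //; first exact: whp_acyclic.
    (* The case [k = 1] uses [alpha < 2], the range in which isolated edges abound. *)
    have wk k : (k <= 1)%N -> whp p (fun n G => (2 < #|copies k (path_graph k) G|)%N).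
      move=> k1; have wfP : wf_graph k (path_graph k) by case: k k1 => [|[|]].
      have conP : connected_graph k (path_graph k) by case: k k1 {wfP} => [|[|]].
      apply: whp_mono (whp_copies wfP alpha_gt0 conP (ltW alpha_gt1) (ler0n _ 2) _) => //.
        by near=> n => G _; rewrite ltr_nat.
      by case: k k1 {wfP conP} => [|[|]] // _; rewrite /= ?mulr0 ?mulr1.
    by apply: whp_and => //; apply: wk.
  apply: (whp_all p01) => c _; rewrite /r; case: asboolP => h.
    by apply: whp_mono h => //; near=> n => G _ ->.
  have [//|h'] := realizes_dichotomy c gen.
  by apply: whp_mono h' => //; near=> n => G _ /negbTE ->.
move=> n G n' G' GV GV' /andP[nG /allP rG] /andP[nG' /allP rG'] x.
have : realizes G' (gsig G x).
  have := rG' (gsig G x); rewrite mem_enum => /(_ isT)/eqP ->.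
  have := rG (gsig G x); rewrite mem_enum => /(_ isT)/eqP <-.
  by apply/hasP; exists x; rewrite ?mem_enum.
by move=> /hasP[x' _ /eqP E]; exists x'; exact: nice_sim2.
Unshelve. all: by end_near. Qed.

End SparseLaw.

Section NoLaw.
Variables (R : realType) (alpha : R).
Hypothesis alpha_gt0 : 0 < alpha.
Let p (n : nat) : R := n%:R `^ (- alpha).
Let p01 n : 0 <= p n <= 1 := pw01 n alpha_gt0.

Lemma negl_bounded_below (A : forall n, pred {set {set 'I_n}}) (c : R) : 0 < c ->
  (\forall n \near \oo, c <= PrG p (@A n)) -> ~ negl p A.
Proof.
move=> c0 cA /cvgrPdist_lt/(_ c c0) H.
have [n [h1 h2]] := filter_ex (filterI cA H).
by move: h2; rewrite sub0r normrN ger0_norm ?Pr_ge0 // ltNge h1.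
Qed.

Lemma no_law (f : sentence) (c : R) : qdepth f = 3 -> 0 < c ->
  (\forall n \near \oo, c <= PrG p (fun G : {set {set 'I_n}} => holds (adj_of G) f)) ->
  (\forall n \near \oo, c <= PrG p (fun G : {set {set 'I_n}} => ~~ holds (adj_of G) f)) ->
  ~ zero_one_law p 3.
Proof.
move=> f3 c0 h1 h2 law; have [/(whpP p (fun n E => holds E f)) w|/(whpP p (fun n E => ~~ holds E f)) w] := law f f3.
  exact: negl_bounded_below c0 h2 w.
apply: (negl_bounded_below c0 h1); apply: negl_mono w => //.
by near=> n => G _; rewrite negbK.
Unshelve. all: by end_near. Qed.

Lemma no_law_tree c k H i : (c, k, H, i) \in sig_table -> 1 < alpha -> alpha * k%:R = k.+1%:R ->
  ~ zero_one_law p 3.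
Proof.
move=> row a1 ak; have [wfH conH sH ik sg] := row_ok row.
have ak' : alpha * (size H)%:R = k.+1%:R by rewrite sH.
have [c1 c10 hc1] := copies_pos wfH alpha_gt0 conH (ltW a1) ak'.
have e2 := nosubcopy_pos wfH alpha_gt0 ak'.
(* Half of [expR (-2)] is given up to graphs with short cycles, in which the signature need not
   force the tree; their probability tends to [0]. *)
pose d : R := expR (-2) / 2; have d0 : 0 < d by rewrite divr_gt0 ?expR_gt0.
apply: (@no_law (realizes_f c) (Num.min c1 d)); first exact: realizes_f_depth.
- by rewrite lt_min c10.
- near=> n; apply: (@le_trans _ _ c1); first by rewrite ge_min lexx.
  apply: (@le_trans _ _ (PrG p (fun G : {set {set 'I_n}} => (0 < #|copies k H G|)%N))); first by near: n.
  by apply: le_Pr => // G GV; rewrite realizes_fP; exact: copies_realizes wfH GV ik sg.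
- near=> n; apply: (@le_trans _ _ d); first by rewrite ge_min lexx orbT.
  have h1 : expR (-2) <= PrG p (fun G : {set {set 'I_n}} => ~~ has_copy k H G) by near: n.
  have h2 : PrG p (fun G : {set {set 'I_n}} => ~~ acyclic G) <= d.
    have : `|0 - PrG p (fun G : {set {set 'I_n}} => ~~ acyclic G)| <= d.
      by near: n; move/cvgrPdist_le: (whp_acyclic a1); apply.
    by rewrite sub0r normrN ger0_norm // Pr_ge0.
  have h3 : PrG p (fun G : {set {set 'I_n}} => ~~ has_copy k H G) <=
     PrG p (fun G : {set {set 'I_n}} => ~~ holds (adj_of G) (realizes_f c)) +
     PrG p (fun G : {set {set 'I_n}} => ~~ acyclic G).
    apply: le_trans (Pr_or _ _ _ _) => //; apply: le_Pr => // G GV; rewrite /= realizes_fP.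
    move=> nh; rewrite orbC -implyNb negbK; apply/implyP => acy.
    apply: contra nh; exact: realizes_has_copy row.
  by move: h1 h2 h3; rewrite /d; lra.
Unshelve. all: by end_near. Qed.

Definition triangle_f : sentence :=
  let z := ord0 : 'I_3 in let y := lift ord0 (ord0 : 'I_2) : 'I_3 in
  let x := lift ord0 (lift ord0 (ord0 : 'I_1) : 'I_2) : 'I_3 in
  FEx (FEx (FEx (FAnd (FAdj x y) (FAnd (FAdj y z) (FAdj x z))))).

Lemma triangle_fP n (G : {set {set 'I_n}}) : holds (adj_of G) triangle_f =
  [exists x, [exists y, [exists z, [&& adj_of G x y, adj_of G y z & adj_of G x z]]]].
Proof.
rewrite /holds /=; apply: eq_existsb => x; apply: eq_existsb => y; apply: eq_existsb => z.
by rewrite !extendS !extend0.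
Qed.

Lemma no_law_one : alpha = 1 -> ~ zero_one_law p 3.
Proof.
move=> a1; apply: (@no_law triangle_f (Num.min 97^-1 (expR (-2)))) => //.
- near=> n; apply: (@le_trans _ _ 97^-1); first by rewrite ge_min lexx.
  have n6 : (6 <= n)%N by near: n; exact: nbhs_infty_ge.
  apply: le_trans (Pr_triangle_ge alpha_gt0 a1 n6) _; apply: (le_Pr (p01 n)) => G GV.
  move=> /card_gt0P[A]; rewrite inE => /andP[/eqP A3 AG]; rewrite triangle_fP.
  have /card_gt0P[x xA] : (0 < #|A|)%N by rewrite A3.
  have /existsP[y /and3P[_ /eqP xy /eqP/existsP[z /and4P[_ _ /eqP zx /eqP zy]]]] := in_triangle AG A3 xA.
  apply/existsP; exists x; apply/existsP; exists y; apply/existsP; exists z.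
  by rewrite xy (adj_of_sym G y) zy (adj_of_sym G x) zx.
- near=> n; apply: (@le_trans _ _ (expR (-2))); first by rewrite ge_min lexx orbT.
  apply: (@le_trans _ _ (PrG p (fun G : {set {set 'I_n}} => ~~ has_copy 2 (cycle_graph 2) G))).
    by near: n; apply: nosubcopy_pos => //; rewrite a1 mul1r.
  apply: le_Pr => // G GV; apply: contra; rewrite triangle_fP.
  move=> /existsP[x /existsP[y /existsP[z /and3P[xy yz xz]]]].
  apply: tree_has_copy => //; exists [:: x; y; z]; split=> //=; last by move=> _; rewrite xy yz xz.
  by rewrite !inE negb_or (adj_neq GV xy) (adj_neq GV yz) (adj_neq GV xz).
Unshelve. all: by end_near. Qed.

End NoLaw.

Theorem theorem5 (R : realType) (alpha : R) (alpha_gt0 : 0 < alpha) :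
  ~ zero_one_law (fun n : nat => n%:R `^ (- alpha)) 3 <->
  alpha \in [:: 1; 7 / 6; 6 / 5; 5 / 4; 4 / 3; 3 / 2; 2].
Proof.
split=> [nlaw|].
  have [//|nin] := boolP (alpha \in _); case: nlaw.
  move: nin; rewrite !inE !negb_or => /and5P[n1 n7 n6 n5 /and3P[n4 n3 n2]].
  have [a1|a1|a1] := ltgtP alpha 1; last by rewrite a1 eqxx in n1.
    exact: zero_one_dense.
  have [a2|a2|a2] := ltgtP alpha 2; last by rewrite a2 eqxx in n2.
    apply: zero_one_sparse => // k.
    (* For [k = 0] the equation reads 0 = 1, for [k = 1] it is [alpha = 2], and k = 2, ..., 6 give
       3/2, 4/3, 5/4, 6/5 and 7/6. *)
    do 7?[case: k => [_|k]]; last by rewrite !ltnS.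
    - by rewrite mulr0 eq_sym oner_eq0.
    - by rewrite mulr1.
    - by apply: contra n3 => /eqP h; apply/eqP; lra.
    - by apply: contra n4 => /eqP h; apply/eqP; lra.
    - by apply: contra n5 => /eqP h; apply/eqP; lra.
    - by apply: contra n6 => /eqP h; apply/eqP; lra.
    - by apply: contra n7 => /eqP h; apply/eqP; lra.
  exact: zero_one_gt2.
rewrite !inE; do ?[case/orP]; move=> /eqP aE.
- exact: no_law_one.
(* One signature for each threshold is enough: the table has at least one row for every number of
   edges from 6 down to 1. *)
- by apply: (@no_law_tree _ _ alpha_gt0 (true, false, true, false, true) 6 (path_graph 6) 3) => //; rewrite aE; lra.
- by apply: (@no_law_tree _ _ alpha_gt0 (true, false, true, true, true) 5 (path_graph 5) 2) => //; rewrite aE; lra.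
- by apply: (@no_law_tree _ _ alpha_gt0 (true, false, true, true, false) 4 (path_graph 4) 2) => //; rewrite aE; lra.
- by apply: (@no_law_tree _ _ alpha_gt0 (false, false, true, false, true) 3 (path_graph 3) 0) => //; rewrite aE; lra.
- by apply: (@no_law_tree _ _ alpha_gt0 (false, false, true, true, false) 2 (path_graph 2) 0) => //; rewrite aE; lra.
- by apply: (@no_law_tree _ _ alpha_gt0 (false, true, false, false, false) 1 (path_graph 1) 0) => //; rewrite aE; lra.
Qed.
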